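(* Let $p$ be a prime and let $(L,q)=\bigoplus_{i\ge 0}(L_i,p^iq_i)$ be a Jordan decomposition of an integral $\mathbb{Z}_p$-lattice $L$ of rank $r$, with $L_i$ of rank $r_i$. Set $$w=\sum_{i>0}(i-1)\frac{r_i(r_i-1)}{2}+\sum_{i<j} i\,r_ir_j .$$ If $p\neq 2$, then $$\#O(L^\sharp)=p^{w}\prod_{i>0}\#O(\bar q_i).$$ If $p=2$, then $$\#O(L^\sharp)=2^{w-t_1}\prod_{i>0} A_i\,2^{t_i-s_i},\qquad A_i=\begin{cases}\#O(\bar q_i)\,2^{t_0r_i} & \text{if } L_i \text{ is free},\\ \#O(\bar b_i)\,2^{(t_0-1)r_i} & \text{if } L_i\text{ is bound}.\end{cases}$$
   Context: A $\mathbb{Z}_p$-lattice $(L,q)$ is a finitely generated free $\mathbb{Z}_p$-module $L$ with a non-degenerate $\mathbb{Q}_p$-valued quadratic form $q$; its bilinear form is $b(x,y)=q(x+y)-q(x)-q(y)$, so $b(x,x)=2q(x)$. It is integral if $b(L,L)\subseteq\mathbb{Z}_p$; even if $b(x,x)\in 2\mathbb{Z}_p$ for all $x\in L$ (equivalently $q(L)\subseteq\mathbb{Z}_p$); odd if integral but not even; unimodular if integral with determinant of a Gram matrix of $b$ a unit of $\mathbb{Z}_p$. The zero lattice is even and unimodular. A Jordan decomposition of $(L,q)$ is an orthogonal decomposition $(L,q)=\bigoplus_i(L_i,p^iq_i)$ in which every $(L_i,q_i)$ is unimodular (almost all $L_i$ are zero); $b_i$ denotes the bilinear form of $q_i$.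 When $L$ is integral only indices $i\ge 0$ occur; set $L_i=0$ for $i<0$. On $L_i/pL_i$ define the $\mathbb{Q}_p/p\mathbb{Z}_p$-valued quadratic form $\bar q_i(x+pL_i)=q_i(x)\bmod p\mathbb{Z}_p$ and the bilinear form $\bar b_i(x+pL_i,y+pL_i)=b_i(x,y)\bmod p\mathbb{Z}_p$. $O(\bar q_i)$ and $O(\bar b_i)$ are the groups of linear automorphisms of $L_i/pL_i$ preserving $\bar q_i$, respectively $\bar b_i$ (trivial groups if $L_i=0$). The dual is $L^\vee=\{x\in L\otimes\mathbb{Q}_p: b(x,L)\subseteq\mathbb{Z}_p\}$, and the discriminant group is $L^\sharp=L^\vee/L$. If $L$ is even, $L^\sharp$ carries the quadratic form $q^\sharp(x+L)=q(x)+\mathbb{Z}_p\in\mathbb{Q}_p/\mathbb{Z}_p$, and $O(L^\sharp)$ is the group of automorphisms of the group $L^\sharp$ preserving $q^\sharp$. If $L$ is odd, $L^\sharp$ carries the bilinear form $b^\sharp(x+L,y+L)=b(x,y)+\mathbb{Z}_p\in\mathbb{Q}_p/\mathbb{Z}_p$, and $O(L^\sharp)$ is the group of automorphisms preserving $b^\sharp$. For $p=2$: $t_i=0$ if $(L_i,q_i)$ is even and $t_i=1$ otherwise. $L_i$ is free if both $(L_{i-1},q_{i-1})$ and $(L_{i+1},q_{i+1})$ are even (i.e. $t_{i-1}=t_{i+1}=0$), and bound otherwise. Moreover $s_i=1$ if $(t_{i-1},t_i,t_{i+1})=(1,0,1)$; $s_i=-1$ if $(t_{i-1},t_i,t_{i+1})=(0,1,1)$;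 $s_i=1$ if $(t_{i-1},t_i,t_{i+1})=(1,1,1)$; and $s_i=0$ in all other cases. (These apply to all indices $i$, including those with $L_i=0$.) *)

(* Defs.v *)
From HB Require Import structures.
From mathcomp Require Import all_boot all_order all_algebra.
From mathcomp Require Import generic_quotient ring_quotient fraction.
From mathcomp Require Import finmap.
From mathcomp Require Import boolp classical_sets functions cardinality.

Set Implicit Arguments.
Unset Strict Implicit.
Unset Printing Implicit Defensive.

Import Order.TTheory GRing.Theory Num.Theory.
Import VectorInternalTheory.

(* The ring Z_p as the inverse limit of the Z/p^n: an element is the sequence *)
(* of its residues modulo p^n, written as naturals < p^n (the bound follows   *)
(* from the compatibility condition).                                         *)
Record padic_int (p : nat) (p_pr : prime p) := PadicInt {
  residue : nat -> nat;
  residueP : forall n, residue n = (residue n.+1 %% p ^ n)%N }.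

Section PadicRing.
Variables (p : nat) (p_pr : prime p).
Local Notation Zp := (padic_int p_pr).

HB.instance Definition _ := gen_eqMixin Zp.
HB.instance Definition _ := gen_choiceMixin Zp.

Lemma residue_inj (x y : Zp) : residue x =1 residue y -> x = y.
Proof.
case: x y => x xP [y yP] /= /funext exy; move: xP; rewrite exy => xP.
by congr PadicInt; apply: Prop_irrelevance.
Qed.

Lemma residue_mod (x : Zp) n : (residue x n %% p ^ n)%N = residue x n.
Proof. by rewrite residueP modn_mod. Qed.

Lemma residueD (x : Zp) m n : residue x (m + n) = residue x m %[mod p ^ m].
Proof.
elim: n => [|n IHn]; first by rewrite addn0.
rewrite -IHn addnS [in RHS]residueP modn_dvdm //.
by rewrite dvdn_exp2l // leq_addr.
Qed.

Fact padic_of_subproof (f : nat -> nat)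
    (fP : forall n, f n.+1 = f n %[mod p ^ n]) n :
  (f n %% p ^ n = (f n.+1 %% p ^ n.+1) %% p ^ n)%N.
Proof. by rewrite modn_dvdm ?dvdn_exp2l // fP. Qed.

Definition padic_of (f : nat -> nat) fP : Zp :=
  PadicInt p_pr (@padic_of_subproof f fP).

Fact padic_cst_subproof (k n : nat) : k = k %[mod p ^ n]. Proof. by []. Qed.

Lemma residueS (x : Zp) n : residue x n.+1 = residue x n %[mod p ^ n].
Proof. by rewrite -addn1 residueD. Qed.

Fact padic_add_subproof (x y : Zp) n :
  (residue x n.+1 + residue y n.+1 = residue x n + residue y n %[mod p ^ n]).
Proof. by rewrite -modnDm !residueS modnDm. Qed.

Fact padic_mul_subproof (x y : Zp) n :
  (residue x n.+1 * residue y n.+1 = residue x n * residue y n %[mod p ^ n]).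
Proof. by rewrite -modnMm !residueS modnMm. Qed.

Fact padic_opp_subproof (x : Zp) n :
  (p ^ n.+1 - residue x n.+1 = p ^ n - residue x n %[mod p ^ n])%N.
Proof.
have pe0 k : (0 < p ^ k)%N by rewrite expn_gt0 prime_gt0.
have lex k : (residue x k <= p ^ k)%N by rewrite -residue_mod ltnW // ltn_mod.
apply/eqP; rewrite -(eqn_modDr (residue x n.+1)) subnK //.
rewrite -modnDmr residueS modnDmr subnK // modnn.
by rewrite expnS modnMl.
Qed.

Local Open Scope ring_scope.

Definition padic_zero := padic_of (padic_cst_subproof 0).
Definition padic_one := padic_of (padic_cst_subproof 1).
Definition padic_add (x y : Zp) := padic_of (padic_add_subproof x y).
Definition padic_mul (x y : Zp) := padic_of (padic_mul_subproof x y).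
Definition padic_opp (x : Zp) := padic_of (padic_opp_subproof x).

Fact padic_addA : associative padic_add.
Proof.
by move=> x y z; apply: residue_inj => n /=; rewrite modnDmr modnDml addnA.
Qed.

Fact padic_addC : commutative padic_add.
Proof. by move=> x y; apply: residue_inj => n /=; rewrite addnC. Qed.

Fact padic_add0 : left_id padic_zero padic_add.
Proof.
by move=> x; apply: residue_inj => n /=; rewrite modnDml add0n residue_mod.
Qed.

Fact padic_addN : left_inverse padic_zero padic_opp padic_add.
Proof.
move=> x; apply: residue_inj => n /=; rewrite modnDml subnK ?modnn ?mod0n //.
by rewrite -residue_mod ltnW // ltn_mod expn_gt0 prime_gt0.
Qed.

HB.instance Definition _ := GRing.isZmodule.Build Zp
  padic_addA padic_addC padic_add0 padic_addN.

Fact padic_mulA : associative padic_mul.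
Proof.
by move=> x y z; apply: residue_inj => n /=; rewrite modnMmr modnMml mulnA.
Qed.

Fact padic_mulC : commutative padic_mul.
Proof. by move=> x y; apply: residue_inj => n /=; rewrite mulnC. Qed.

Fact padic_mul1 : left_id padic_one padic_mul.
Proof.
by move=> x; apply: residue_inj => n /=; rewrite modnMml mul1n residue_mod.
Qed.

Fact padic_mulD : left_distributive padic_mul +%R.
Proof.
move=> x y z; apply: residue_inj => n /=.
by rewrite modnMml modnDml modnDmr mulnDl.
Qed.

Fact padic_one_neq0 : padic_one != 0.
Proof.
apply/eqP => /(congr1 (fun x => residue x 1)) /=.
by rewrite expn1 modn_small ?mod0n // prime_gt1.
Qed.

HB.instance Definition _ := GRing.Zmodule_isComNzRing.Build Zp
  padic_mulA padic_mulC padic_mul1 padic_mulD padic_one_neq0.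

Definition padic_unit : {pred Zp} := fun x => `[< exists y : Zp, y * x = 1 >].

Definition padic_inv (x : Zp) : Zp :=
  if pselect (exists y : Zp, y * x = 1) is left ex then projT1 (cid ex) else x.

Fact padic_mulV : {in padic_unit, left_inverse 1 padic_inv *%R}.
Proof.
move=> x /asboolP ex; rewrite /padic_inv; case: pselect => // ex'.
by case: (cid ex').
Qed.

Fact padic_unitP (x y : Zp) : y * x = 1 -> padic_unit x.
Proof. by move=> yx; apply/asboolP; exists y. Qed.

Fact padic_inv_out : {in [predC padic_unit], padic_inv =1 id}.
Proof. by move=> x /asboolPn nex; rewrite /padic_inv; case: pselect. Qed.

HB.instance Definition _ := GRing.ComNzRing_hasMulInverse.Build Zp
  padic_mulV padic_unitP padic_inv_out.

Lemma padic_neq0P (x : Zp) : x != 0 -> exists m, ~~ (p ^ m %| residue x m)%N.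
Proof.
move=> x0; apply: contrapT => /forallNP h; case/eqP: x0.
apply: residue_inj => n /=; rewrite mod0n -residue_mod.
by apply/eqP; have := h n => /negP; rewrite negbK.
Qed.

Fact padic_integral : GRing.integral_domain_axiom Zp.
Proof.
move=> x y xy0; apply: contrapT => /negP; rewrite negb_or => /andP[].
move=> /padic_neq0P[m xm] /padic_neq0P[n yn].
have: (p ^ (m + n) %| residue x (m + n) * residue y (m + n))%N.
  by rewrite /dvdn -[X in X == _]/(residue (x * y) (m + n)) xy0 /= mod0n.
have: ~~ (p ^ m %| residue x (m + n))%N by rewrite /dvdn residueD.
have: ~~ (p ^ n %| residue y (m + n))%N by rewrite /dvdn addnC residueD.
move: (residue x _) (residue y _) => a b {xm yn}.
have [->|b0] := posnP b; first by rewrite dvdn0.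
have [->|a0] := posnP a; first by rewrite dvdn0.
rewrite !pfactor_dvdn ?muln_gt0 ?a0 // -!ltnNge lognM //.
by move=> lb la; rewrite leqNgt -addnS leq_add // ltnW.
Qed.

HB.instance Definition _ := GRing.ComUnitRing_isIntegral.Build Zp padic_integral.

Lemma residue_nat (k n : nat) : residue (k%:R : Zp) n = (k %% p ^ n)%N.
Proof.
elim: k => [|k IHk] //=; rewrite -natr1.
have -> : residue (k%:R + 1 : Zp) n = ((residue (k%:R : Zp) n + 1 %% p ^ n) %% p ^ n)%N.
  by [].
by rewrite IHk modnDml modnDmr addn1.
Qed.

Lemma padic_nat_neq0 (k : nat) : (0 < k)%N -> k%:R != 0 :> Zp.
Proof.
move=> k0; apply/eqP => /(congr1 (fun x : Zp => residue x k)).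
rewrite residue_nat /= modn_small ?mod0n; first by move=> kE; rewrite kE in k0.
exact: ltn_expl (prime_gt1 p_pr).
Qed.

Lemma padic_half : odd p -> exists y : Zp, y * 2%:R = 1.
Proof.
move=> p_odd; pose m n := (p ^ n)./2.
have mE n : (p ^ n = (m n).*2.+1)%N by rewrite -[LHS]odd_double_half oddX p_odd orbT.
have mS n : (m n.+1 = p./2 * p ^ n + m n)%N.
  rewrite /m expnS -[X in (X * _)%N]odd_double_half p_odd mulnDl mul1n -doubleMl.
  by rewrite addnC halfD odd_double /= doubleK.
have fP n : ((m n.+1).+1 = (m n).+1 %[mod p ^ n])%N.
  by rewrite mS -addnS modnMDl.
exists (padic_of fP); apply: residue_inj => n.
rewrite -[LHS]/((residue (padic_of fP) n * residue (2%:R : Zp) n) %% p ^ n)%N.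
by rewrite residue_nat /= modnMml modnMmr muln2 doubleS -mE -addn1 modnDl.
Qed.

End PadicRing.

Notation padic_rat p_pr := {fraction (padic_int p_pr)}.

Local Open Scope ring_scope.
Local Open Scope quotient_scope.

Section Lattices.
Variables (p : nat) (p_pr : prime p).
Local Notation Zp := (padic_int p_pr).
Local Notation Qp := (padic_rat p_pr).
Local Notation "x %:F" := (@tofrac Zp x).

(* The subgroup c Z_p of Q_p. *)
Definition mulZp (c : Qp) : {pred Qp} :=
  fun y => `[< exists a : Zp, y = c * a%:F >].

Fact mulZp_closed c : zmod_closed (mulZp c).
Proof.
split; first by apply/asboolP; exists 0; rewrite tofrac0 mulr0.
move=> x y /asboolP[a ->] /asboolP[b ->]; apply/asboolP; exists (a - b).
by rewrite tofracB mulrBr.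
Qed.

HB.instance Definition _ c := GRing.isZmodClosed.Build Qp (mulZp c)
  (mulZp_closed c).

Lemma mulZp1 (a : Zp) : a%:F \in mulZp 1.
Proof. by apply/asboolP; exists a; rewrite mul1r. Qed.

Lemma two_neq0 : 2%:R != 0 :> Qp.
Proof. by rewrite -[2%:R](rmorph_nat (@tofrac Zp)) tofrac_eq0 padic_nat_neq0. Qed.

(* Q_p / c Z_p *)
Notation Qp_mod c := (Quotient.quot (mulZp c)).

Definition polar (M : lmodType Zp) (q : M -> Qp) (x y : M) : Qp :=
  q (x + y) - q x - q y.

Definition quadratic_form (M : lmodType Zp) (q : M -> Qp) : Prop :=
  (forall a x, q (a *: x) = a%:F ^+ 2 * q x) /\
  (forall a x y z,
     polar q (a *: x + y) z = a%:F * polar q x z + polar q y z).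

Definition nondegenerate (M : lmodType Zp) (q : M -> Qp) : Prop :=
  forall x, (forall y, polar q x y = 0) -> x = 0.

Record lattice := Lattice {
  lattice_module :> vectType Zp;
  form : lattice_module -> Qp;
  form_quadratic : quadratic_form form;
  form_nondegenerate : nondegenerate form }.

Section OneLattice.
Variable L : lattice.
Local Notation q := (@form L).
Local Notation b := (polar q).

Definition lattice_rank : nat := dim L.

Definition integral : Prop := forall x y : L, b x y \in mulZp 1.

Definition even_lattice : Prop := forall x : L, b x x \in mulZp 2%:R.

Definition lattice_basis (i : 'I_lattice_rank) : L :=
  @r2v Zp L (delta_mx 0 i).

Definition gram : 'M[Qp]_lattice_rank :=
  \matrix_(i, j) b (lattice_basis i) (lattice_basis j).

Definition unimodular : Prop :=
  integral /\ exists2 u : Zp, u \is a GRing.unit & \det gram = u%:F.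

(* L (x) Q_p, in the coordinates given by [lattice_basis] *)
Local Notation V := 'rV[Qp]_lattice_rank.

Definition embed (x : L) : V := map_mx (@tofrac Zp) (v2r x).

Definition polarV (u v : V) : Qp := (u *m gram *m v^T) 0 0.

Definition formV (u : V) : Qp := polarV u u / 2%:R.

Lemma polarC (x y : L) : b x y = b y x.
Proof. by rewrite /polar [x + y]addrC addrAC. Qed.

Lemma polarP a (x y z : L) : b (a *: x + y) z = a%:F * b x z + b y z.
Proof. exact: (form_quadratic L).2. Qed.

Lemma polar0 (z : L) : b 0 z = 0.
Proof.
have := polarP 1 0 0 z; rewrite scaler0 addr0 rmorph1 mul1r => e.
by apply: (addrI (b 0 z)); rewrite addr0 -e.
Qed.

Lemma polar_sum n (a : 'I_n -> Zp) (x : 'I_n -> L) (z : L) :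
  b (\sum_i a i *: x i) z = \sum_i (a i)%:F * b (x i) z.
Proof.
elim: n a x => [|n IHn] a x; first by rewrite !big_ord0 polar0.
by rewrite !big_ord_recl polarP IHn.
Qed.

Lemma polarxx (x : L) : b x x = form x *+ 2.
Proof.
rewrite /polar -mulr2n -scaler_nat (form_quadratic L).1 rmorph_nat.
by apply/eqP; rewrite -addrA -opprD -mulr2n subr_eq expr2 -mulrA !mulr_natl mulr2n.
Qed.

Lemma lattice_basisE (x : L) : x = \sum_i v2r x 0 i *: lattice_basis i.
Proof.
rewrite -[LHS]v2rK [X in r2v X]row_sum_delta linear_sum.
by apply: eq_bigr => i _; rewrite linearZ.
Qed.

Lemma polarV_embed (x y : L) : polarV (embed x) (embed y) = b x y.
Proof.
rewrite [in RHS](lattice_basisE x) polar_sum /polarV -mulmxA mxE.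
apply: eq_bigr => i _; rewrite !mxE; congr (_ * _).
rewrite polarC [in RHS](lattice_basisE y) polar_sum.
by apply: eq_bigr => j _; rewrite !mxE mulrC [in RHS]polarC.
Qed.

Lemma formV_embed (x : L) : formV (embed x) = form x.
Proof. by rewrite /formV polarV_embed polarxx -[_ *+ 2]mulr_natr mulfK ?two_neq0. Qed.

Lemma polarVC u v : polarV u v = polarV v u.
Proof.
rewrite /polarV -[in LHS](trmxK (u *m _ *m _)) mxE !trmx_mul trmxK mulmxA.
by congr ((_ *m _ *m _) 0 0); apply/matrixP => i j; rewrite !mxE polarC.
Qed.

Lemma polarVD u u' v : polarV (u + u') v = polarV u v + polarV u' v.
Proof. by rewrite /polarV !mulmxDl mxE. Qed.

Lemma formVD u v : formV (u + v) = formV u + polarV u v + formV v.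
Proof.
rewrite /formV polarVD ![polarV _ (u + v)]polarVC !polarVD [polarV v u]polarVC.
have -> (a c d : Qp) : a + c + (c + d) = a + c * 2%:R + d.
  by rewrite !addrA mulr_natr mulr2n !addrA.
rewrite !mulrDl.
by rewrite mulfK ?two_neq0.
Qed.

Definition in_dual : {pred V} :=
  fun u => `[< forall x : L, polarV u (embed x) \in mulZp 1 >].

Fact in_dual_closed : zmod_closed in_dual.
Proof.
split=> [|u v /asboolP ud /asboolP vd]; apply/asboolP => x.
  by rewrite /polarV !mul0mx mxE rpred0.
by rewrite /polarV !mulmxBl mxE [X in _ + X]mxE rpredB; [|exact: ud|exact: vd].
Qed.

HB.instance Definition _ := GRing.isZmodClosed.Build V in_dual in_dual_closed.

Record dual := Dual { dual_val :> V; dual_valP : dual_val \in in_dual }.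
HB.instance Definition _ := [isSub for dual_val].
HB.instance Definition _ := [Choice of dual by <:].
HB.instance Definition _ := [SubChoice_isSubZmodule of dual by <:].

(* L as a subgroup of its dual; when L is not integral this is the part of L *)
(* lying in the dual.                                                        *)
Definition lattice_in_dual : {pred dual} :=
  fun u => `[< exists x : L, val u = embed x >].

Fact lattice_in_dual_closed : zmod_closed lattice_in_dual.
Proof.
split=> [|u v /asboolP[x ux] /asboolP[y vy]]; apply/asboolP.
  by exists 0; rewrite /embed linear0 map_mx0.
by exists (x - y); rewrite raddfB /= ux vy /embed !raddfB.
Qed.

HB.instance Definition _ := GRing.isZmodClosed.Build dual lattice_in_dual
  lattice_in_dual_closed.

Definition discriminant := Quotient.quot lattice_in_dual.

HB.instance Definition _ := GRing.Zmodule.on discriminant.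
HB.instance Definition _ := Quotient.on discriminant.

Definition disc_form (x : discriminant) : Qp_mod 1 :=
  \pi_(Qp_mod 1) (formV (val (repr x))).

Definition disc_polar (x y : discriminant) : Qp_mod 1 :=
  \pi_(Qp_mod 1) (polarV (val (repr x)) (val (repr y))).

Lemma discP (u v : dual) : u = v %[mod discriminant] ->
  exists x : L, val u = val v + embed x.
Proof.
move=> /eqP; rewrite -Quotient.idealrBE => /asboolP[x]; rewrite raddfB => uvx.
by exists x; rewrite -uvx addrC subrK.
Qed.

Lemma disc_form_pi (u : dual) : even_lattice ->
  disc_form (\pi_discriminant u) = \pi_(Qp_mod 1) (formV (val u)).
Proof.
move=> evL; have [x ux] := discP (reprK (\pi_discriminant u)).
apply/eqP; rewrite -Quotient.idealrBE ux formVD formV_embed addrC !addrA addNr.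
rewrite add0r rpredD //; first by have /asboolP := dual_valP u; apply.
have /asboolP[a] := evL x; rewrite polarxx -[_ *+ 2]mulr_natl => e.
rewrite (mulfI two_neq0 e).
exact: mulZp1.
Qed.

Lemma disc_polar_pi (u v : dual) : integral ->
  disc_polar (\pi_discriminant u) (\pi_discriminant v) =
  \pi_(Qp_mod 1) (polarV (val u) (val v)).
Proof.
move=> intL; have [x ux] := discP (reprK (\pi_discriminant u)).
have [y vy] := discP (reprK (\pi_discriminant v)).
have dualP (z : dual) (t : L) : polarV (val z) (embed t) \in mulZp 1.
  by have /asboolP := dual_valP z; apply.
apply/eqP; rewrite -Quotient.idealrBE ux vy polarVD.
rewrite ![polarV _ (_ + embed y)]polarVC !polarVD.
rewrite [polarV (val v) (val u)]polarVC -!addrA addrC -!addrA addNr addr0.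
rewrite [polarV _ (val u)]polarVC rpredD ?dualP // rpredD ?dualP //.
by rewrite polarV_embed; apply: intL.
Qed.

(* L / pL, as a Z_p-module; its Z_p-linear endomorphisms are the F_p-linear   *)
(* ones since p acts as zero.                                                *)
Definition p_multiple : {pred L} := fun x => `[< exists y : L, x = p%:R *: y >].

Fact p_multiple_closed : zmod_closed p_multiple.
Proof.
split; first by apply/asboolP; exists 0; rewrite scaler0.
move=> x y /asboolP[u ->] /asboolP[v ->]; apply/asboolP; exists (u - v).
by rewrite scalerBr.
Qed.

HB.instance Definition _ := GRing.isZmodClosed.Build L p_multiple
  p_multiple_closed.

Definition reduction := Quotient.quot p_multiple.

HB.instance Definition _ := GRing.Zmodule.on reduction.
HB.instance Definition _ := Quotient.on reduction.

Definition reduction_scale (a : Zp) (x : reduction) : reduction :=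
  \pi_reduction (a *: repr x).

Lemma pi_reduction_scale a (x : L) :
  reduction_scale a (\pi_reduction x) = \pi_reduction (a *: x).
Proof.
apply/eqP; rewrite -Quotient.idealrBE -scalerBr.
have /asboolP[y ->] : repr (\pi_reduction x) - x \in p_multiple.
  by rewrite Quotient.idealrBE reprK.
by apply/asboolP; exists (a *: y); rewrite !scalerA mulrC.
Qed.

Lemma pi_reductionD (x y : L) :
  \pi_reduction (x + y) = \pi_reduction x + \pi_reduction y.
Proof. exact: Quotient.pi_add. Qed.

Fact reduction_scaleA a b x :
  reduction_scale a (reduction_scale b x) = reduction_scale (a * b) x.
Proof. by elim/(@quotW _ reduction): x => x; rewrite !pi_reduction_scale scalerA. Qed.

Fact reduction_scale1 : left_id 1 reduction_scale.
Proof. by elim/(@quotW _ reduction) => x; rewrite pi_reduction_scale scale1r. Qed.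

Fact reduction_scaleDr : right_distributive reduction_scale +%R.
Proof.
move=> a; elim/(@quotW _ reduction) => x; elim/(@quotW _ reduction) => y.
rewrite -pi_reductionD !pi_reduction_scale.
by rewrite scalerDr pi_reductionD.
Qed.

Fact reduction_scaleDl x : {morph reduction_scale^~ x : a b / a + b}.
Proof.
move=> a b; elim/(@quotW _ reduction): x => x; rewrite !pi_reduction_scale.
by rewrite scalerDl pi_reductionD.
Qed.

HB.instance Definition _ := GRing.Zmodule_isLmodule.Build Zp reduction
  reduction_scaleA reduction_scale1 reduction_scaleDr reduction_scaleDl.

Definition red_form (x : reduction) : Qp_mod p%:R :=
  \pi_(Qp_mod p%:R) (q (repr x)).

Definition red_polar (x y : reduction) : Qp_mod p%:R :=
  \pi_(Qp_mod p%:R) (b (repr x) (repr y)).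

Lemma reductionP (x y : L) : x = y %[mod reduction] ->
  exists z : L, x = y + p%:R *: z.
Proof.
move=> /eqP; rewrite -Quotient.idealrBE => /asboolP[z xyz].
by exists z; rewrite -xyz addrC subrK.
Qed.

Lemma mulZp_nat (k : nat) (y : Qp) : y \in mulZp 1 -> k%:R * y \in mulZp k%:R.
Proof. by move=> /asboolP[a ->]; apply/asboolP; exists a; rewrite mul1r. Qed.

Lemma polarZl a (x z : L) : b (a *: x) z = a%:F * b x z.
Proof. by rewrite -[a *: x]addr0 polarP polar0 addr0. Qed.

Lemma formD (x y : L) : form (x + y) = form x + b x y + form y.
Proof. by rewrite /polar [form x + _]addrC addrAC !subrK. Qed.

Lemma mulp_form (x : L) : integral -> p%:R * form x \in mulZp 1.
Proof.
move=> intL; have := intL x x; rewrite polarxx => /asboolP[a e].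
have [p2|p2] := eqVneq p 2%N.
  by rewrite [X in X%:R * _]p2 mulr_natl e; apply/asboolP; exists a.
have p_odd : odd p by case: (even_prime p_pr) p2 => // ->.
have [y y2] := padic_half p_pr p_odd.
have -> : form x = (y * a)%:F.
  apply: (mulfI two_neq0); rewrite mulr_natl e mul1r -(rmorph_nat (@tofrac Zp)).
  by rewrite -rmorphM mulrA [_ * y]mulrC y2 mul1r.
by rewrite -(rmorph_nat (@tofrac Zp)) -rmorphM mulZp1.
Qed.

Lemma red_form_pi (x : L) : integral ->
  red_form (\pi_reduction x) = \pi_(Qp_mod p%:R) (form x).
Proof.
move=> intL; have [z xz] := reductionP (reprK (\pi_reduction x)).
apply/eqP; rewrite -Quotient.idealrBE xz formD -[_ + _ + form (_ *: _)]addrA.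
rewrite addrAC subrr add0r.
rewrite polarC polarZl rmorph_nat rpredD //; first exact/mulZp_nat/intL.
by rewrite (form_quadratic L).1 rmorph_nat expr2 -mulrA mulZp_nat // mulp_form.
Qed.

Lemma red_polar_pi (x y : L) : integral ->
  red_polar (\pi_reduction x) (\pi_reduction y) = \pi_(Qp_mod p%:R) (b x y).
Proof.
move=> intL; have [z xz] := reductionP (reprK (\pi_reduction x)).
have [t yt] := reductionP (reprK (\pi_reduction y)).
apply/eqP; rewrite -Quotient.idealrBE xz yt addrC [x + _]addrC polarP.
rewrite rmorph_nat addrCA rpredD ?mulZp_nat ?intL //.
rewrite [b x (y + _)]polarC [y + _]addrC polarP rmorph_nat [b y x]polarC.
by rewrite addrCA addNr addr0 mulZp_nat // intL.
Qed.

Local Open Scope classical_set_scope.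

Definition O_red_form : set (reduction -> reduction) :=
  [set f | bijective f /\ linear f /\
    forall x, red_form (f x) = red_form x].

Definition O_red_polar : set (reduction -> reduction) :=
  [set f | bijective f /\ linear f /\
    forall x y, red_polar (f x) (f y) = red_polar x y].

(* Intended for integral lattices: a lattice in the second case is then odd. *)
Definition O_disc : set (discriminant -> discriminant) :=
  [set f | bijective f /\ {morph f : x y / x + y} /\
    if pselect even_lattice then forall x, disc_form (f x) = disc_form x
    else forall x y, disc_polar (f x) (f y) = disc_polar x y].

End OneLattice.

(* L is the internal orthogonal direct sum of the images of the L_i, of which *)
(* only those with i < N may be nonzero.                                      *)
Definition jordan_decomposition (L : lattice) (L_ : nat -> lattice)
    (iota : forall i, {linear L_ i -> L}) (N : nat) : Prop :=
  [/\ forall i, unimodular (L_ i),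
      forall i, (N <= i)%N -> lattice_rank (L_ i) = 0%N,
      bijective (fun u : forall i : 'I_N, L_ i => \sum_(i < N) iota i (u i)),
      forall i (x : L_ i), form (iota i x) = p%:R ^+ i * form x &
      forall i j (x : L_ i) (y : L_ j),
        i != j -> polar (@form L) (iota i x) (iota j y) = 0].

Section JordanInvariants.
Variable L_ : nat -> lattice.

Definition jordan_parity (i : nat) : nat :=
  if pselect (even_lattice (L_ i)) then 0%N else 1%N.

(* L_{-1} = 0 is even *)
Definition jordan_parity_prev (i : nat) : nat :=
  if i is j.+1 then jordan_parity j else 0%N.

Definition jordan_free (i : nat) : bool :=
  (jordan_parity_prev i == 0%N) && (jordan_parity i.+1 == 0%N).

Definition jordan_s (i : nat) : int :=
  match jordan_parity_prev i, jordan_parity i, jordan_parity i.+1 with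
  | 1%N, 0%N, 1%N => 1
  | 0%N, 1%N, 1%N => -1
  | 1%N, 1%N, 1%N => 1
  | _, _, _ => 0
  end.

End JordanInvariants.
End Lattices.

Arguments O_red_form {p p_pr} L _.
Arguments O_red_polar {p p_pr} L _.
Arguments O_disc {p p_pr} L _.

(* The cardinality of a finite set (and 0 for an infinite one). *)
Definition card_set (T : choiceType) (A : set T) : nat := #|` fset_set A|%fset.

(* Main.v *)
(* Write the discriminant group as the sum of the Z/p^(lam a), one factor for each basis
   vector of a block L_i with i = lam a > 0.  An endomorphism F is a p-adic matrix E, with
   F_ab = p^(lam a - lam b) E_ab (truncated subtraction) and E_ab taken modulo
   p^min(lam a, lam b).  Hence #O(L^sharp) is p^(sum of the min(lam a, lam b)) times the
   density of the set of matrices E for which the rescaled pullback P(E) of the Gram matrix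
   B agrees with B, modulo p^min(lam a, lam b) off the diagonal and, for p = 2, modulo
   2 p^(lam a - t_0) on the diagonal.

   The congruences are imposed one after the other.  If invertible moves E -> E + E * Z
   preserve all congruences imposed so far and shift the next one by an arbitrary amount,
   that congruence divides the density by p.  One starts from the condition that the
   diagonal blocks of E preserve the reductions of the L_i; its density is the product of
   the #O(q_i) or #O(b_i), divided by p^(sum of the r_i^2).

   For p odd the remaining congruences are all independent.  For p = 2 those on the diagonal
   are not.  Let u_i be a characteristic vector of L_i.  The value of P(E) - B on u_i is
   determined modulo 4 by the values on characteristic vectors of the blocks of E next to the
   diagonal; at the start of a run of odd lattices this makes one congruence automatic.
   Modulo 8 it is, by a Gauss sum argument, a difference of two quantities indexed by i - 2
   and i, and the congruence is automatic unless both L_(i-2) and L_i are odd.  The automatic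
   congruences account for the exponents t_i - s_i. *)

(* Why p = 2 is exceptional: replacing E by E + E * (p^k Z) changes P(E) by a linear term of order
   p^k and a quadratic term of order p^(2k). A diagonal entry moves in steps of 2 p^k, so the
   quadratic term is negligible modulo 2 p^(k+1) unless p = 2 and k <= 1. For k = 1 the value on a
   vector x of one block changes modulo 8 by 4 (b(x, Z x) + b(Z x, Z x)); if x is characteristic the
   two summands agree modulo 2, so that value does not move at all. It can be moved only by mixing
   two odd blocks at distance 2, and the values modulo 4 by mixing blocks at distance 1 with a skew
   first-order term; this is where the neighbouring parities enter. Densities replace group orders
   because the intermediate solution sets need not be groups: a move only has to be injective modulo
   p^M and to preserve the congruences already imposed. The exponent w is a remainder: the sum of
   all min(lam a, lam b), minus the sum of the r_i^2, exceeds by exactly w the number of congruences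
   needed when all of them are independent. *)
From HB Require Import structures.
Require Import Defs.
From Stdlib Require Import Ring.
From mathcomp Require Import all_boot all_order all_algebra fingroup.
From mathcomp Require Import generic_quotient ring_quotient fraction finmap.
From mathcomp Require Import boolp classical_sets functions cardinality.
From mathcomp Require Import zify.
Set Implicit Arguments.
Unset Strict Implicit.
Unset Printing Implicit Defensive.
Import GRing.Theory Num.Theory VectorInternalTheory.
Local Open Scope ring_scope.

(** * Divisibility of p-adic integers *)

(* The [ring] tactic needs the operations of [padic_int] with their original names; [padic_ring]
   translates the generic ring operations back to them. *)
Lemma padic_ring_theory (p : nat) (p_pr : prime p) :
  ring_theory (padic_zero p_pr) (padic_one p_pr) (@padic_add p p_pr)
    (@padic_mul p p_pr) (fun x y => padic_add x (padic_opp y)) (@padic_opp p p_pr) eq.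
Proof.
split => //.
- exact: (@add0r (padic_int p_pr)).
- exact: (@addrC (padic_int p_pr)).
- exact: (@addrA (padic_int p_pr)).
- exact: (@mul1r (padic_int p_pr)).
- exact: (@mulrC (padic_int p_pr)).
- exact: (@mulrA (padic_int p_pr)).
- exact: (@mulrDl (padic_int p_pr)).
- exact: (@subrr (padic_int p_pr)).
Qed.

Ltac padic_norm pr t :=
  lazymatch t with
  | @GRing.add _ ?a ?b =>
    let a' := padic_norm pr a in let b' := padic_norm pr b in
    constr:(@padic_add _ pr a' b')
  | @GRing.mul _ ?a ?b =>
    let a' := padic_norm pr a in let b' := padic_norm pr b in
    constr:(@padic_mul _ pr a' b')
  | @GRing.opp _ ?a =>
    let a' := padic_norm pr a in constr:(@padic_opp _ pr a')
  | @GRing.zero _ => constr:(padic_zero pr)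
  | @GRing.one _ => constr:(padic_one pr)
  | @GRing.natmul _ ?a 2 =>
    let a' := padic_norm pr a in constr:(@padic_add _ pr a' a')
  | @GRing.natmul _ ?a 4 =>
    let a' := padic_norm pr a in constr:(@padic_add _ pr a' (@padic_add _ pr a' (@padic_add _ pr a' a')))
  | @GRing.exp _ ?a 2 =>
    let a' := padic_norm pr a in constr:(@padic_mul _ pr a' a')
  | @GRing.natmul _ ?a ?k =>
    let a' := padic_norm pr a in constr:(((a' : padic_int pr) *+ k)%R)
  | @GRing.exp _ ?a ?k =>
    let a' := padic_norm pr a in constr:(((a' : padic_int pr) ^+ k)%R)
  | @fun_of_matrix _ ?m ?n ?A ?i ?j =>
    constr:(@fun_of_matrix (padic_int pr) m n A i j)
  | _ => constr:(t : padic_int pr)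
  end.

Lemma padic_eq_addr0 (p : nat) (p_pr : prime p) (x y : padic_int p_pr) :
  padic_add x (padic_zero p_pr) = padic_add y (padic_zero p_pr) -> x = y.
Proof. exact: (@addIr (padic_int p_pr)). Qed.

Ltac padic_ring pr :=
  lazymatch goal with |- @eq _ ?l ?r =>
    let l' := padic_norm pr l in let r' := padic_norm pr r in
    apply: (@padic_eq_addr0 _ pr l' r'); ring
  end.

Section Divisibility.
Variables (p : nat) (p_pr : prime p).
Local Notation Zp := (padic_int p_pr).
Local Notation pe := (p%:R : Zp).
Implicit Types (c d x y z : Zp) (e : nat).
Add Ring Zp_ring : (padic_ring_theory p_pr).

Definition dv c : {pred Zp} := fun x => `[< exists y, x = c * y >].

Lemma dvP c x : reflect (exists y, x = c * y) (x \in dv c).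
Proof. exact: asboolP. Qed.

Fact dv_closed c : zmod_closed (dv c).
Proof.
split; first by apply/dvP; exists 0; rewrite mulr0.
move=> x y /dvP[a ->] /dvP[b ->]; apply/dvP; exists (a - b).
by rewrite mulrBr.
Qed.

HB.instance Definition _ c := GRing.isZmodClosed.Build Zp (dv c) (dv_closed c).

Lemma dvMr c x y : x \in dv c -> x * y \in dv c.
Proof. by move=> /dvP[a ->]; apply/dvP; exists (a * y); rewrite mulrA. Qed.

Lemma dvMl c x y : y \in dv c -> x * y \in dv c.
Proof. by rewrite mulrC; exact: dvMr. Qed.

Lemma cong_trans c x y z : x - y \in dv c -> y - z \in dv c -> x - z \in dv c.
Proof.
by move=> h1 h2; have := rpredD h1 h2; rewrite addrA subrK.
Qed.

Lemma cong_sym c x y : x - y \in dv c -> y - x \in dv c.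
Proof. by rewrite -opprB rpredN. Qed.

Lemma cong0 c x y : x - y \in dv c -> y \in dv c -> x \in dv c.
Proof. by move=> h1 h2; have := rpredD h1 h2; rewrite subrK. Qed.

Lemma dv_refl c : c \in dv c.
Proof. by apply/dvP; exists 1; rewrite mulr1. Qed.

Lemma dv1 x : x \in dv 1.
Proof. by apply/dvP; exists x; rewrite mul1r. Qed.

Lemma dvM c d x y : x \in dv c -> y \in dv d -> x * y \in dv (c * d).
Proof.
by move=> /dvP[a ->] /dvP[b ->]; apply/dvP; exists (a * b); rewrite mulrACA.
Qed.

Lemma dv_trans c d x : d \in dv c -> x \in dv d -> x \in dv c.
Proof. by move=> /dvP[a ->] /dvP[b ->]; rewrite -mulrA dvMr ?dv_refl. Qed.

Lemma dv_mull c d x : x \in dv (c * d) -> x \in dv c.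
Proof. by apply: dv_trans; rewrite dvMr ?dv_refl. Qed.

Lemma dv_mulr c d x : x \in dv (c * d) -> x \in dv d.
Proof. by apply: dv_trans; rewrite dvMl ?dv_refl. Qed.

Lemma dvMcancel c d x : c != 0 -> (c * x \in dv (c * d)) = (x \in dv d).
Proof.
move=> c0; apply/idP/idP => [/dvP[y]|/(dvM (dv_refl c))//].
by rewrite -mulrA => /(mulfI c0) ->; rewrite dvMr ?dv_refl.
Qed.

Lemma dvX e1 e2 x : (e1 <= e2)%N -> x \in dv (pe ^+ e2) -> x \in dv (pe ^+ e1).
Proof. by move=> /subnKC <-; rewrite exprD; apply: dv_mull. Qed.

Lemma dvXr e1 e2 y : (e1 <= e2)%N -> pe ^+ e2 * y \in dv (pe ^+ e1).
Proof. by move=> le; apply: (dvX le); rewrite dvMr ?dv_refl. Qed.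

Lemma expD_eq c k1 k2 l1 l2 : (k1 + k2 = l1 + l2)%N ->
  c ^+ k1 * c ^+ k2 = c ^+ l1 * c ^+ l2.
Proof. by move=> e; rewrite -!exprD e. Qed.

Lemma dvp_expl e y : (0 < e)%N -> pe ^+ e * y \in dv pe.
Proof. by move=> e0; have := dvXr y e0; rewrite expr1. Qed.

Lemma pe_neq0 : pe != 0.
Proof. by rewrite padic_nat_neq0 ?prime_gt0. Qed.

Lemma peX_neq0 e : pe ^+ e != 0.
Proof. by rewrite expf_neq0 ?pe_neq0. Qed.

Lemma two_Zp_neq0 : 2%:R != 0 :> Zp.
Proof. by rewrite padic_nat_neq0. Qed.

Lemma residue_lt x e : (residue x e < p ^ e)%N.
Proof. by rewrite -residue_mod ltn_mod expn_gt0 prime_gt0. Qed.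

Lemma residue1_mod x : (residue x 1 %% p)%N = residue x 1.
Proof. by have := residue_mod x 1; rewrite expn1. Qed.

Lemma residue_add x y e :
  residue (x + y) e = ((residue x e + residue y e) %% p ^ e)%N.
Proof. by []. Qed.

Lemma residue_mul x y e :
  residue (x * y) e = ((residue x e * residue y e) %% p ^ e)%N.
Proof. by []. Qed.

(** Division by p^e is done on residues: modulo p^k the quotient is the residue of [x] modulo p^(k +
    e), divided by p^e. *)
Lemma dvXP e x : reflect (residue x e = 0%N) (x \in dv (pe ^+ e)).
Proof.
apply: (iffP (dvP _ _)) => [[y ->]|x0].
  by rewrite residue_mul -natrX residue_nat modnn mul0n mod0n.
have pe0 k : (0 < p ^ k)%N by rewrite expn_gt0 prime_gt0.
have dvx k : (p ^ e %| residue x (k + e))%N.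
  by rewrite /dvdn addnC residueD x0 mod0n.
have fP k : (residue x (k.+1 + e) %/ p ^ e = residue x (k + e) %/ p ^ e %[mod p ^ k])%N.
  apply/eqP; rewrite -(eqn_pmul2r (pe0 e)) !muln_modl -!expnD !divnK //.
  by rewrite addSn residueS.
exists (padic_of p_pr fP); apply: residue_inj => k.
rewrite residue_mul -natrX residue_nat /= modnMml modnMmr.
by rewrite mulnC divnK // residueD residue_mod.
Qed.

Lemma residue_eqP e x y :
  reflect (residue x e = residue y e) (x - y \in dv (pe ^+ e)).
Proof.
apply: (iffP idP) => [/dvXP xy0|exy].
  by rewrite -[x](subrK y) residue_add xy0 add0n residue_mod.
apply/dvXP; have := residue_add (x - y) y e; have := residue_lt (x - y) e.
rewrite subrK exy.
move: (residue (x - y) e) (residue y e) (residue_lt y e) => a b lb la ab.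
have : (a + b == 0 + b %[mod p ^ e])%N by rewrite -ab add0n modn_small.
by rewrite eqn_modDr mod0n modn_small // => /eqP.
Qed.

Lemma residueK e x : (residue x e)%:R - x \in dv (pe ^+ e).
Proof. by apply/residue_eqP; rewrite residue_nat residue_mod. Qed.

Lemma dvX_nat e k : (k%:R \in dv (pe ^+ e)) = (p ^ e %| k)%N.
Proof. by apply/dvXP/eqP; rewrite residue_nat. Qed.

Lemma dvpP x : x \in dv pe = (residue x 1 == 0%N).
Proof. by rewrite -{1}[pe]expr1; apply/dvXP/eqP. Qed.

Lemma dvpM x y : (x * y \in dv pe) = (x \in dv pe) || (y \in dv pe).
Proof.
rewrite !dvpP residue_mul expn1 -/(dvdn _ _) Euclid_dvdM //.
by congr orb; rewrite /dvdn modn_small // -[p in (_ < p)%N]expn1 residue_lt.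
Qed.

Lemma dvp1 : (1 : Zp) \in dv pe = false.
Proof. by rewrite -[1]/(1%:R) -[pe]expr1 dvX_nat expn1 dvdn1 gtn_eqF ?prime_gt1. Qed.

End Divisibility.

Section Two.
Hypothesis two_pr : prime 2.
Local Notation Zp := (padic_int two_pr).
Implicit Types x y : Zp.
Add Ring Z2_ring : (padic_ring_theory two_pr).

Lemma dv2_cases x : x \in dv 2%:R \/ x - 1 \in dv 2%:R.
Proof.
rewrite dvpP -[X in x - 1 \in dv X]expr1.
have := residue_lt x 1; rewrite expn1.
case: eqP => [_ _|]; first by left.
move=> r0 r2; right; apply/residue_eqP.
rewrite -[1]/(1%:R) residue_nat modn_small //.
by move: (residue x 1) r0 r2 => [|[|]].
Qed.

Lemma dv2N x : (x \notin dv 2%:R) = (x - 1 \in dv 2%:R).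
Proof.
case: (dv2_cases x) => h; rewrite h.
  apply/esym/negP => h1; have := rpredB h h1.
  by rewrite opprB addrC subrK dvp1.
apply/negP => h1; have := rpredB h1 h.
by rewrite opprB addrC subrK dvp1.
Qed.

Lemma dv2_sqr x : x * x - x \in dv 2%:R.
Proof.
have -> : x * x - x = x * (x - 1) by padic_ring two_pr.
by case: (dv2_cases x) => h; [apply: dvMr|apply: dvMl].
Qed.

End Two.

(** * Densities of sets of p-adic matrices *)

Section Density.
Variables (p : nat) (p_pr : prime p) (n M : nat).
Local Notation Zp := (padic_int p_pr).
Local Notation pe := (p%:R : Zp).
Local Notation mat := 'M[Zp]_n.
Local Notation T := {ffun 'I_n * 'I_n -> 'I_(p ^ M)}.
Implicit Types (E : mat) (S : mat -> Prop) (A : T) (mu : 'I_n -> 'I_n -> nat).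
Add Ring Zp_ring : (padic_ring_theory p_pr).

Definition digits_mx A : mat := \matrix_(a, b) (A (a, b) : nat)%:R.

Definition mx_digits E : T := [ffun ab => Ordinal (residue_lt (E ab.1 ab.2) M)].

Definition mxcong mu E E' := forall a b, E a b - E' a b \in dv (pe ^+ mu a b).

Local Notation meq := (mxcong (fun _ _ => M)).

Definition stable mu S := forall E E', mxcong mu E E' -> S E -> S E'.

Local Notation mstable := (stable (fun _ _ => M)).

Definition count S := #|[set A : T | `[< S (digits_mx A) >]]|.

(* The natural measure of [S], when [S] only depends on the entries modulo p^M. *)
Definition density S : rat := (count S)%:R / #|{: T}|%:R.

Lemma mxcong_sym mu E E' : mxcong mu E E' -> mxcong mu E' E.
Proof. by move=> h a b; rewrite -opprB rpredN. Qed.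

Lemma digits_mxK E : meq (digits_mx (mx_digits E)) E.
Proof. by move=> a b; rewrite mxE ffunE /= residueK. Qed.

Lemma mx_digits_eq E E' : mx_digits E = mx_digits E' -> meq E E'.
Proof.
move=> /ffunP e a b; apply/residue_eqP.
by have := congr1 val (e (a, b)); rewrite !ffunE.
Qed.

Lemma digits_mx_inj A A' : meq (digits_mx A) (digits_mx A') -> A = A'.
Proof.
move=> h; apply/ffunP => -[a b]; apply: val_inj => /=.
have /residue_eqP := h a b; rewrite !mxE !residue_nat.
by rewrite !modn_small.
Qed.

Lemma count_ext S S' : (forall E, S E <-> S' E) -> count S = count S'.
Proof.
move=> h; rewrite /count; congr #|pred_of_set _|; apply/setP => A.
by rewrite !inE; apply/asboolP/asboolP => /h.
Qed.

Lemma density_ext S S' : (forall E, S E <-> S' E) -> density S = density S'.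
Proof. by move=> h; rewrite /density (count_ext h). Qed.

Lemma card_digits_gt0 : (0 < #|{: T}|)%N.
Proof. by rewrite card_ffun card_ord !expn_gt0 prime_gt0. Qed.

Lemma density_setT : density (fun _ => True) = 1.
Proof.
rewrite /density /count (_ : [set _ | _] = [set: T]); last first.
  by apply/setP => A; rewrite !inE; apply/asboolP.
by rewrite cardsT divff // pnatr_eq0 -lt0n card_digits_gt0.
Qed.

(** Injectivity on classes modulo p^M is enough to compare counts; equality then comes from the move
    with the opposite shift, and no inverse map has to be written down. *)
Definition admissible (s : mat -> mat) :=
  forall E E', meq (s E) (s E') -> meq E E'.

Lemma count_le S S' (s : mat -> mat) : mstable S' -> admissible s ->
  (forall E, S E -> S' (s E)) -> (count S <= count S')%N.
Proof.
move=> stS' sadm sS.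
pose g A := mx_digits (s (digits_mx A)).
have g_inj : injective g.
  by move=> A A' /mx_digits_eq/sadm/digits_mx_inj.
rewrite /count -(card_imset _ g_inj); apply/subset_leq_card/fintype.subsetP => A'.
case/imsetP => A; rewrite !inE => SA ->.
by apply: (stS' _ _ _ (sS _ SA)); apply: mxcong_sym; apply: digits_mxK.
Qed.

(* The p classes of [f E] modulo c p are permuted cyclically by the moves, so they have the
   same density. *)
Lemma density_step S (f : mat -> Zp) (c : Zp) :
    c != 0 -> pe ^+ M \in dv (c * pe) ->
    mstable S ->
    (forall E E', meq E E' -> f E - f E' \in dv (pe ^+ M)) ->
    (forall E, S E -> f E \in dv c) ->
    (forall v : Zp, exists2 s, admissible s & forall E, S E ->
       S (s E) /\ f (s E) - f E - c * v \in dv (c * pe)) ->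
  density (fun E => S E /\ f E \in dv (c * pe)) = density S / p%:R.
Proof.
move=> c0 cM stS fcont Sf moves.
pose cl (k : nat) E := S E /\ f E - c * k%:R \in dv (c * pe).
have stcl k : mstable (cl k).
  move=> E E' EE' [SE fE]; split; first exact: (stS _ _ EE' SE).
  have -> : f E' - c * k%:R = (f E - c * k%:R) - (f E - f E').
    by padic_ring p_pr.
  by rewrite rpredB // (dv_trans cM) // fcont.
have cl_le k l : (count (cl k) <= count (cl l))%N.
  have [s sadm sP] := moves (l%:R - k%:R).
  apply: (count_le (stcl l) sadm) => E [SE fE]; have [SsE fsE] := sP _ SE.
  split=> //.
  have -> : f (s E) - c * l%:R
    = (f (s E) - f E - c * (l%:R - k%:R)) + (f E - c * k%:R).
    by padic_ring p_pr.
  exact: rpredD.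
have cl_eq k : count (cl k) = count (cl 0%N).
  by apply/eqP; rewrite eqn_leq !cl_le.
have fE0 : count (fun E => S E /\ f E \in dv (c * pe)) = count (cl 0%N).
  by apply: count_ext => E; rewrite /cl mulr0 subr0.
suff cntS : count S = (p * count (cl 0%N))%N.
  rewrite /density cntS fE0 natrM mulrAC [_ * _%:R]mulrC mulfK //.
  by rewrite pnatr_eq0 -lt0n prime_gt0.
have p_gt0 := prime_gt0 p_pr.
have [y yP] : {y : mat -> Zp | forall E, S E -> f E = c * y E}.
  exists (fun E => if pselect (exists z, f E = c * z) is left e
                   then projT1 (cid e) else 0) => E /Sf/dvP e.
  by case: pselect => // e'; case: (cid e').
pose kap A : 'I_p := Ordinal (ltn_pmod (residue (y (digits_mx A)) 1) p_gt0).
rewrite /count -sum1_card (partition_big kap xpredT) //=.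
transitivity (\sum_(k < p) count (cl 0))%N; last first.
  by rewrite sum_nat_const card_ord.
apply: eq_bigr => k _; rewrite -(cl_eq k) /count -sum1_card; apply: eq_bigl => A.
rewrite !inE; apply/andP/asboolP => [[/asboolP SA /eqP kA]|[SA fA]].
  split=> //; rewrite (yP _ SA) -mulrBr dvMcancel //; rewrite -[pe]expr1.
  apply/residue_eqP; rewrite -kA residue_nat /= expn1 modn_mod.
  by rewrite residue1_mod.
split; first exact/asboolP.
apply/eqP/val_inj => /=; move: fA; rewrite (yP _ SA) -mulrBr dvMcancel //.
rewrite -[pe]expr1 => /residue_eqP ->; rewrite residue_nat expn1 modn_mod.
by rewrite modn_small.
Qed.

(* The moves for one condition have to respect the conditions before it in  *)
(* the list, but may spoil the later ones.                                  *)
Lemma density_seq (J : eqType) (s : seq J) S (f : J -> mat -> Zp) (c : J -> Zp) :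
    (forall i, c i != 0) -> (forall i, i \in s -> pe ^+ M \in dv (c i * pe)) ->
    mstable S ->
    (forall i E E', meq E E' -> f i E - f i E' \in dv (pe ^+ M)) ->
    (forall E i, i \in s -> S E -> f i E \in dv (c i)) ->
    (forall s1 i s2, s = s1 ++ i :: s2 -> forall v : Zp,
       exists2 g, admissible g & forall E, S E ->
       (forall j, j \in s1 -> f j E \in dv (c j * pe)) ->
       [/\ S (g E), forall j, j \in s1 -> f j (g E) - f j E \in dv (c j * pe) &
           f i (g E) - f i E - c i * v \in dv (c i * pe)]) ->
  density (fun E => S E /\ forall i, i \in s -> f i E \in dv (c i * pe))
  = density S / p%:R ^+ size s.
Proof.
move=> c0 cM stS fcont; elim/last_ind: s cM => [|s i IHs] cM Sf moves.
  rewrite expr0 divr1; apply: density_ext => E; split=> [[]//|SE].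
  by split=> // i; rewrite in_nil.
have sub_s j : j \in s -> j \in rcons s i by rewrite mem_rcons inE orbC => ->.
pose S1 E := S E /\ forall i, i \in s -> f i E \in dv (c i * pe).
have -> : density (fun E => S E /\ forall j, j \in rcons s i -> f j E \in dv (c j * pe))
   = density (fun E => S1 E /\ f i E \in dv (c i * pe)).
  apply: density_ext => E; split=> [[SE fE]|[[SE fE] fi]].
    split; last by apply: fE; rewrite mem_rcons inE eqxx.
    by split=> // j /sub_s; apply: fE.
  by split=> // j; rewrite mem_rcons inE => /orP[/eqP ->|/fE].
have i_in : i \in rcons s i by rewrite mem_rcons inE eqxx.
rewrite (density_step (c0 i)); first last.
- move=> v; have [] := moves s i [::] _ v; first by rewrite cats1.
  move=> g gadm gP; exists g => // E [SE fE]; have [SgE fgE fi] := gP _ SE fE.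
  split=> //; split=> // j js; rewrite -(subrK (f j E) (f j _)) rpredD ?fgE //.
  exact: fE.
- by move=> E [SE _]; apply: Sf.
- exact: fcont.
- move=> E E' EE' [SE fE]; split; first exact: (stS _ _ EE' SE).
  move=> j js; have -> : f j E' = f j E - (f j E - f j E') by padic_ring p_pr.
  by rewrite rpredB ?fE // (dv_trans (cM _ (sub_s _ js))) ?fcont.
- exact: cM.
rewrite IHs.
- by rewrite size_rcons exprSr invfM mulrA.
- by move=> j /sub_s; apply: cM.
- by move=> E j /sub_s; apply: Sf.
by move=> s1 j s2 sE; apply: (moves s1 j (rcons s2 i)); rewrite sE rcons_cat.
Qed.

(* Exchanging the coordinates in [D] between two independent samples.       *)
Lemma density_indep (D : pred ('I_n * 'I_n)) S S' :
    (forall E E', (forall a b, ~~ D (a, b) -> E a b = E' a b) -> S E -> S E') ->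
    (forall E E', (forall a b, D (a, b) -> E a b = E' a b) -> S' E -> S' E') ->
  density (fun E => S E /\ S' E) = density S * density S'.
Proof.
move=> SD S'D.
have T0 : #|{: T}|%:R != 0 :> rat by rewrite pnatr_eq0 -lt0n card_digits_gt0.
suff cntE : (count (fun E => S E /\ S' E)%type * #|{: T}| = count S * count S')%N.
  rewrite /density mulf_div -natrM -cntE natrM -mulf_div divff ?mulr1 //.
rewrite /count -cardsT -!cardsX.
pose mix (A A' : T) : T := [ffun ab => if D ab then A ab else A' ab].
have mixK A A' : mix (mix A A') (mix A' A) = A.
  by apply/ffunP => ab; rewrite !ffunE; case: (D ab).
pose sw (x : T * T) := (mix x.2 x.1, mix x.1 x.2).
have swK : involutive sw by move=> [A A']; rewrite /sw /= !mixK.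
rewrite -(card_imset _ (inv_inj swK)); congr #|pred_of_set _|.
apply/setP => -[A A']; apply/imsetP/idP => [[[C C']]|].
  rewrite !inE andbT /= => /asboolP[SC S'C] [-> ->]; apply/andP; split; apply/asboolP.
    by apply: (SD _ _ _ SC) => a b Dab; rewrite !mxE ffunE (negPf Dab).
  by apply: (S'D _ _ _ S'C) => a b Dab; rewrite !mxE ffunE Dab.
rewrite !inE /= => /andP[/asboolP SA /asboolP S'A'].
exists (sw (A, A')); last by rewrite swK.
rewrite !inE /= andbT; apply/asboolP; split.
  by apply: (SD _ _ _ SA) => a b Dab; rewrite !mxE ffunE (negPf Dab).
by apply: (S'D _ _ _ S'A') => a b Dab; rewrite !mxE ffunE Dab.
Qed.

Definition in_box mu A := [forall ab, (A ab < p ^ mu ab.1 ab.2)%N].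

Lemma card_residue_class (k b : nat) : (k <= M)%N -> (b < p ^ k)%N ->
  #|[pred x : 'I_(p ^ M) | (x %% p ^ k == b)%N]| = (p ^ (M - k))%N.
Proof.
move=> kM bk; have pk0 : (0 < p ^ k)%N by rewrite expn_gt0 prime_gt0.
have MkE : (p ^ M = p ^ (M - k) * p ^ k)%N by rewrite -expnD subnK.
have lt_h (i : 'I_(p ^ (M - k))) : (i * p ^ k + b < p ^ M)%N.
  rewrite MkE -[X in (_ < X * _)%N](subnK (ltn_ord i)) mulnDl mulSn.
  by rewrite ltn_addl // addnC ltn_add2r.
pose h (i : 'I_(p ^ (M - k))) : 'I_(p ^ M) := Ordinal (lt_h i).
have h_inj : injective h.
  move=> i j /(congr1 val) /= /addIn /eqP; rewrite eqn_pmul2r // => /eqP.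
  exact: val_inj.
rewrite -[RHS]card_ord -(card_codom h_inj); apply: eq_card => x; rewrite !inE.
apply/eqP/codomP => [xb|[i ->]]; last by rewrite /= modnMDl modn_small.
have lt_x : (x %/ p ^ k < p ^ (M - k))%N by rewrite ltn_divLR // -MkE.
by exists (Ordinal lt_x); apply: val_inj => /=; rewrite -xb -divn_eq.
Qed.

(** A residue modulo p^mu has p^(M - mu) lifts modulo p^M. This converts a density into a number of
    digit matrices in a box, the form in which endomorphisms are counted. *)
Lemma density_box mu S : (forall a b, mu a b <= M)%N -> stable mu S ->
  density S = #|[set A : T | in_box mu A & `[< S (digits_mx A) >]]|%:R
              / p%:R ^+ (\sum_a \sum_b mu a b).
Proof.
move=> muM stS.
have pgt0 k : (0 < p ^ k)%N by rewrite expn_gt0 prime_gt0.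
have lt_rho (A : T) ab : (A ab %% p ^ mu ab.1 ab.2 < p ^ M)%N.
  by rewrite (leq_ltn_trans (leq_mod _ _)).
pose rho A : T := [ffun ab => Ordinal (lt_rho A ab)].
have rho_box A : in_box mu (rho A).
  by apply/forallP => ab; rewrite ffunE /= ltn_pmod.
have rho_cong A : mxcong mu (digits_mx (rho A)) (digits_mx A).
  move=> a b; rewrite !mxE ffunE /=; apply/residue_eqP.
  by rewrite !residue_nat modn_mod.
have rho_id A : in_box mu A -> rho A = A.
  move=> /forallP Abox; apply/ffunP => ab; apply: val_inj; rewrite ffunE /=.
  by rewrite modn_small.
have cntE : count S = (#|[set A : T | in_box mu A & `[< S (digits_mx A) >]]|
    * \prod_(ab : 'I_n * 'I_n) p ^ (M - mu ab.1 ab.2))%N.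
  rewrite /count -sum1_card.
  rewrite (partition_big rho [in [set A : T | in_box mu A & `[< S (digits_mx A) >]]]).
    rewrite -sum_nat_const; apply: eq_bigr => B; rewrite inE => /andP[Bbox /asboolP SB].
    transitivity #|family (fun ab => [pred x : 'I_(p ^ M)
        | (x %% p ^ mu ab.1 ab.2 == B ab)%N])|; last first.
      rewrite card_family foldrE big_map big_enum /=; apply: eq_bigr => ab _.
      by rewrite card_residue_class //; apply: (forallP Bbox).
    rewrite -sum1_card; apply: eq_bigl => A; rewrite !inE.
    apply/andP/familyP => [[_ /eqP <-] ab|h].
      by rewrite inE ffunE.
    have rhoA : rho A = B.
      by apply/ffunP => ab; apply: val_inj; rewrite ffunE /=; have /eqP := h ab.
    by rewrite rhoA eqxx; split=> //; apply/asboolP; apply: (stS _ _ _ SB); rewrite -rhoA.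
  move=> A; rewrite !inE => SA; rewrite rho_box /=.
  by apply: asboolT; apply: (stS _ _ _ SA); apply: mxcong_sym.
rewrite /density cntE natrM -mulrA; congr (_ * _).
have p0 k : (p ^ k)%:R != 0 :> rat by rewrite pnatr_eq0 -lt0n.
rewrite pair_big /= -natrX expn_sum card_ffun card_ord.
rewrite -expnM mulnC card_prod !card_ord.
have -> : (p ^ (n * n * M) = \prod_(ab : 'I_n * 'I_n) p ^ M)%N.
  by rewrite prod_nat_const card_prod !card_ord -expnM mulnC.
have -> : (\prod_(ab : 'I_n * 'I_n) p ^ M
  = \prod_(ab : 'I_n * 'I_n) p ^ (M - mu ab.1 ab.2)
     * \prod_(ab : 'I_n * 'I_n) p ^ mu ab.1 ab.2)%N.
  by rewrite -big_split /=; apply: eq_bigr => ab _; rewrite -expnD subnK.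
rewrite -!expn_sum natrM invfM mulrA divff ?mul1r //.
Qed.

End Density.

(** * Pullback of a form along an endomorphism *)

Section Weights.
Variables (p : nat) (p_pr : prime p) (n : nat) (lam : 'I_n -> nat).
Local Notation Zp := (padic_int p_pr).
Local Notation pe := (p%:R : Zp).
Local Notation mat := 'M[Zp]_n.
Implicit Types (E X Y Z W : mat) (a b c d x y : 'I_n).
Add Ring Zp_ring : (padic_ring_theory p_pr).

(* The distance from [lam c] to the interval between [lam a] and [lam b].   *)
Definition gap a c b : nat :=
  minn (lam a) (lam b) - lam c + (lam c - maxn (lam a) (lam b)).

(** The exponent in Z^T X Z when [X c d] stands for p^(- min (lam c) (lam d)) X_cd, as the entries
    of [pullback] do, and Z is scaled like an endomorphism. It equals [gap a d b + gap d c a]. *)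
Definition gap2 a c d b : nat :=
  minn (lam a) (lam b) + (lam c - lam a) + (lam d - lam b) - minn (lam c) (lam d).

(* Writing F_ab = p^(lam a - lam b) E_ab (truncated subtraction) for an      *)
(* endomorphism F of the sum of the Z/p^(lam a), [star] is composition in    *)
(* terms of E.                                                              *)
Definition star E Z : mat := \matrix_(a, b) \sum_c pe ^+ gap a c b * E a c * Z c b.

Lemma starE E Z a b : star E Z a b = \sum_c pe ^+ gap a c b * E a c * Z c b.
Proof. by rewrite mxE. Qed.

(** Associativity amounts to a cocycle identity between the [gap] exponents, which reflects
    composition of endomorphisms. *)
Lemma star_assoc E Z W : star (star E Z) W = star E (star Z W).
Proof.
apply/matrixP => a b; rewrite !starE.
under eq_bigr => c _ do rewrite starE mulr_sumr mulr_suml.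
under [RHS]eq_bigr => c _ do rewrite starE mulr_sumr.
rewrite exchange_big /=; apply: eq_bigr => x _; apply: eq_bigr => c _.
have eg : (gap a c b + gap a x c = gap a x b + gap x c b)%N by rewrite /gap; lia.
have e := expD_eq pe eg.
transitivity (pe ^+ gap a c b * pe ^+ gap a x c * (E a x * Z x c * W c b)).
  by padic_ring p_pr.
by rewrite e; padic_ring p_pr.
Qed.

Lemma starDl X Y Z : star (X + Y) Z = star X Z + star Y Z.
Proof.
apply/matrixP => a b; rewrite [RHS]mxE !starE -big_split /=; apply: eq_bigr => c _.
by rewrite mxE; padic_ring p_pr.
Qed.

Lemma starZl k X Z : star (k *: X) Z = k *: star X Z.
Proof.
apply/matrixP => a b; rewrite [RHS]mxE !starE mulr_sumr; apply: eq_bigr => c _.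
by rewrite mxE; padic_ring p_pr.
Qed.

Lemma starZr k X Z : star X (k *: Z) = k *: star X Z.
Proof.
apply/matrixP => a b; rewrite [RHS]mxE !starE mulr_sumr; apply: eq_bigr => c _.
by rewrite mxE; padic_ring p_pr.
Qed.

Definition mdv k X := forall a b, X a b \in dv k.

Lemma star_mdvl k X Z : mdv k X -> mdv k (star X Z).
Proof.
by move=> h a b; rewrite starE rpred_sum // => c _; rewrite dvMr // dvMl.
Qed.

Lemma star_mdvr k X Z : mdv k Z -> mdv k (star X Z).
Proof. by move=> h a b; rewrite starE rpred_sum // => c _; rewrite dvMl. Qed.

(** Since Z * Z vanishes modulo p, composing with 1 + Z is invertible modulo p with inverse 1 - Z.
    Injectivity is lifted from p^i to p^(i+1) by dividing the difference of the two matrices by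
    p^i. *)
Lemma admissible_star M Z : mdv pe (star Z Z) ->
  admissible M (fun E => E + star E Z).
Proof.
move=> Z2 E E' h.
suff: forall i, (i <= M)%N -> mdv (pe ^+ i) (E - E').
  by move=> /(_ M (leqnn M)) D a b; have := D a b; rewrite !mxE.
have hD : mdv (pe ^+ M) ((E - E') + star (E - E') Z).
  have -> : star (E - E') Z = star E Z - star E' Z.
    by rewrite -[- E']scaleN1r starDl starZl scaleN1r.
  move: (star E Z) (star E' Z) h => X X' h a b.
  have -> : (E - E' + (X - X')) a b = (E + X) a b - (E' + X') a b.
    by rewrite !mxE; padic_ring p_pr.
  exact: h.
move: (E - E' : mat) hD => D hD; elim=> [|i IHi] iM.
  by move=> a b; rewrite expr0 dv1.
have {}IHi := IHi (ltnW iM).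
have [D1 DE] : exists D1 : mat, D = pe ^+ i *: D1.
  have e a b : exists k : Zp, D a b = pe ^+ i * k by apply/dvP.
  exists (\matrix_(a, b) projT1 (cid (e a b))); apply/matrixP => a b.
  by rewrite !mxE; case: (cid _).
have hD1 : mdv pe (D1 + star D1 Z).
  move=> a b; rewrite -(dvMcancel _ _ (peX_neq0 p_pr i)) -exprSr.
  apply: (dvX iM); have := hD a b; rewrite DE starZl !mxE.
  by rewrite mulrDr.
have hDZ : mdv pe (star D1 Z + star D1 (star Z Z)).
  rewrite -star_assoc -starDl; exact: star_mdvl.
have hZ2 : mdv pe (star D1 (star Z Z)) by apply: star_mdvr.
move=> a b; rewrite DE mxE exprSr dvMcancel ?peX_neq0 //.
have -> : D1 a b = (D1 + star D1 Z) a b - ((star D1 Z + star D1 (star Z Z)) a b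
                    - star D1 (star Z Z) a b).
  move: (star D1 _) (star D1 _) => X X'.
  by rewrite !mxE; padic_ring p_pr.
by rewrite rpredB // rpredB.
Qed.

Section Form.
Variable B : mat.
Hypothesis B_sym : B^T = B.
Hypothesis B_block : forall a b, lam a != lam b -> B a b = 0.

Lemma B_symE a b : B a b = B b a. Proof. by rewrite -{1}B_sym mxE. Qed.

Lemma star_block Z : star B Z = B *m Z.
Proof.
apply/matrixP => a b; rewrite starE mxE; apply: eq_bigr => c _.
have [eac|/B_block->] := eqVneq (lam a) (lam c); last by rewrite mulr0 !mul0r.
by rewrite (_ : gap a c b = 0%N) ?mul1r // /gap; lia.
Qed.

Definition pullbil E E' : mat :=
  \matrix_(a, b) \sum_c \sum_d pe ^+ gap a c b * E c a * B c d * E' d b.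

(* In terms of F, the matrix p^(- min (lam a) (lam b)) P_ab of P = [pullback E] *)
(* is the Gram matrix of the pullback along F of the form on the sum of the *)
(* Z/p^(lam a) with Gram matrix p^(- lam a) B_ab.                           *)
Definition pullback E := pullbil E E.

Lemma pullbackE E a b :
  pullback E a b = \sum_c \sum_d pe ^+ gap a c b * E c a * B c d * E d b.
Proof. by rewrite mxE. Qed.

Definition quad_star X Z : mat :=
  \matrix_(a, b) \sum_c \sum_d pe ^+ gap2 a c d b * Z c a * X c d * Z d b.

Lemma quad_starE X Z a b : quad_star X Z a b =
  \sum_c \sum_d pe ^+ gap2 a c d b * Z c a * X c d * Z d b.
Proof. by rewrite mxE. Qed.

Lemma pullbil_tr E E' : (pullbil E E')^T = pullbil E' E.
Proof.
apply/matrixP => a b; rewrite !mxE exchange_big /=.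
apply: eq_bigr => c _; apply: eq_bigr => d _.
have [ecd|ecd] := eqVneq (lam c) (lam d).
  rewrite (B_symE d c); have -> : gap b d a = gap a c b by rewrite /gap; lia.
  by padic_ring p_pr.
by rewrite [B c d]B_block // [B d c]B_block 1?eq_sym // !(mulr0, mul0r).
Qed.

Lemma pullback_sym E a b : pullback E a b = pullback E b a.
Proof. by rewrite {1}/pullback -pullbil_tr mxE. Qed.

Lemma pullbilDl E E' E'' : pullbil (E + E') E'' = pullbil E E'' + pullbil E' E''.
Proof.
apply/matrixP => a b; rewrite !mxE -big_split; apply: eq_bigr => c _ /=.
rewrite -big_split; apply: eq_bigr => d _ /=.
by rewrite mxE; padic_ring p_pr.
Qed.

Lemma pullbilDr E E' E'' : pullbil E'' (E + E') = pullbil E'' E + pullbil E'' E'.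
Proof. by rewrite -pullbil_tr pullbilDl linearD /= !pullbil_tr. Qed.

Lemma pullbil_star E E' Z : pullbil E' (star E Z) = star (pullbil E' E) Z.
Proof.
apply/matrixP => a b; rewrite starE mxE.
under [RHS]eq_bigr => x _.
  rewrite mxE mulr_sumr mulr_suml.
  under eq_bigr => c _ do rewrite mulr_sumr mulr_suml.
  over.
rewrite [RHS]exchange_big /=; apply: eq_bigr => c _.
rewrite [RHS]exchange_big /=; apply: eq_bigr => d _.
rewrite starE mulr_sumr; apply: eq_bigr => x _.
have [ecd|ecd] := eqVneq (lam c) (lam d); last first.
  by rewrite B_block // !(mulr0, mul0r).
have eg : (gap a c b + gap d x b = gap a x b + gap a c x)%N by rewrite /gap; lia.
have e := expD_eq pe eg.
transitivity (pe ^+ gap a c b * pe ^+ gap d x b * (E' c a * B c d * E d x * Z x b)).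
  by padic_ring p_pr.
by rewrite e; padic_ring p_pr.
Qed.

Lemma pullbil_star2 E Z :
  pullbil (star E Z) (star E Z) = quad_star (pullback E) Z.
Proof.
rewrite pullbil_star -pullbil_tr pullbil_star.
apply/matrixP => a b; rewrite starE quad_starE exchange_big /=; apply: eq_bigr => d _.
rewrite mxE starE mulr_sumr mulr_suml; apply: eq_bigr => c _.
rewrite (pullback_sym E d c).
have eg : (gap2 a c d b = gap a d b + gap d c a)%N by rewrite /gap2 /gap; lia.
by rewrite eg exprD; padic_ring p_pr.
Qed.

(** The new pullback depends on [E] only through [pullback E]. A move can therefore be analysed from
    the congruences already known, without looking at [E] itself. *)
Lemma pullback_star E Z : pullback (E + star E Z) =
  pullback E + star (pullback E) Z + (star (pullback E) Z)^T
  + quad_star (pullback E) Z.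
Proof.
rewrite /pullback pullbilDl !pullbilDr pullbil_star2 -[pullbil (star E Z) E]pullbil_tr.
by rewrite pullbil_star !addrA.
Qed.

Lemma quad_starZ k X Z : quad_star X (k *: Z) = k ^+ 2 *: quad_star X Z.
Proof.
apply/matrixP => a b; rewrite !mxE mulr_sumr; apply: eq_bigr => c _.
rewrite mulr_sumr; apply: eq_bigr => d _; rewrite !mxE.
by padic_ring p_pr.
Qed.

Lemma pullbil_mxcong M E1 E2 E1' E2' :
  mdv (pe ^+ M) (E1 - E1') -> mdv (pe ^+ M) (E2 - E2') ->
  mdv (pe ^+ M) (pullbil E1 E2 - pullbil E1' E2').
Proof.
move=> h1 h2 a b; rewrite !mxE -sumrB rpred_sum // => c _.
rewrite -sumrB rpred_sum // => d _.
have := h1 c a; have := h2 d b; rewrite !mxE => {}h2 {}h1.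
have -> : pe ^+ gap a c b * E1 c a * B c d * E2 d b
    - pe ^+ gap a c b * E1' c a * B c d * E2' d b
  = pe ^+ gap a c b * B c d * E1 c a * (E2 d b - E2' d b)
    + pe ^+ gap a c b * B c d * E2' d b * (E1 c a - E1' c a).
  by padic_ring p_pr.
by rewrite rpredD // dvMl.
Qed.

Lemma pullback_cont M E E' : mxcong (fun _ _ => M) E E' ->
  mdv (pe ^+ M) (pullback E - pullback E').
Proof.
move=> h; have hE : mdv (pe ^+ M) (E - E') by move=> a b; rewrite !mxE.
exact: pullbil_mxcong.
Qed.

End Form.
End Weights.

(** Exponents are positive because the unimodular block L_0 dies in the discriminant group. The
    inverse [gmV] is kept as data, since moves and characteristic vectors are built from it. *)
Record jordan_gram (p : nat) (p_pr : prime p) (n : nat) := JordanGram {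
  lam : 'I_n -> nat;
  gm : 'M[padic_int p_pr]_n;
  gmV : 'M[padic_int p_pr]_n;
  lam_gt0 : forall a, (0 < lam a)%N;
  gm_sym : gm^T = gm;
  gm_block : forall a b, lam a != lam b -> gm a b = 0;
  gmV_block : forall a b, lam a != lam b -> gmV a b = 0;
  gmK : gm *m gmV = 1%:M }.

(** * Congruences between different blocks, and the levels without quadratic corrections *)

Section Levels.
Variables (p : nat) (p_pr : prime p) (n M : nat) (G : jordan_gram p_pr n).
Local Notation Zp := (padic_int p_pr).
Local Notation pe := (p%:R : Zp).
Local Notation mat := 'M[Zp]_n.
Local Notation lam := (lam G).
Local Notation B := (gm G).
Local Notation iB := (gmV G).
Local Notation star := (star lam).
Local Notation gp := (gap lam).
Local Notation P := (pullback lam B).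
Local Notation quad := (quad_star lam).
Local Notation dens := (@density p p_pr n M).
Implicit Types (E X Z : mat) (a b c d x y : 'I_n).
Add Ring Zp_ring : (padic_ring_theory p_pr).

(** The margin makes p^M a multiple of 2 p^(lam a), and of 8 when p = 2; these bound all moduli that
    occur. *)
Hypothesis M_large : forall a, (lam a + 3 <= M)%N.

Let B_block a b : lam a != lam b -> B a b = 0.
Proof. exact: gm_block. Qed.

Lemma gmVK : iB *m B = 1%:M.
Proof. exact: mulmx1C (gmK G). Qed.

Lemma gmV_sym : iB^T = iB.
Proof.
have iBT : iB^T *m B = 1%:M.
  by have := congr1 trmx (gmK G); rewrite trmx_mul gm_sym trmx1.
by rewrite -[LHS]mulmx1 -(gmK G) mulmxA iBT mul1mx.
Qed.

Lemma gm_symE a b : B a b = B b a. Proof. by rewrite -{1}(gm_sym G) mxE. Qed.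
Lemma gmV_symE a b : iB a b = iB b a. Proof. by rewrite -{1}gmV_sym mxE. Qed.

Lemma mul_gmV_delta a b c d : (iB *m delta_mx a b) c d = iB c a * (d == b)%:R.
Proof.
rewrite mxE (bigD1 a) //= !mxE eqxx /= big1 ?addr0 // => k ka.
by rewrite !mxE (negPf ka) mulr0.
Qed.

Lemma pe_two : p = 2%N -> pe = 2%:R.
Proof. exact: (congr1 (fun k : nat => k%:R : Zp)). Qed.

(** For odd p the number 2 is a unit, so conditions modulo 2 p^k can be written uniformly for all
    primes. *)
Lemma dv2_pe : pe \in dv 2%:R.
Proof.
have [p2|p2] := eqVneq p 2%N.
  by rewrite pe_two // dv_refl.
have p_odd : odd p by case: (even_prime p_pr) p2 => // ->.
have [z z2] := padic_half p_pr p_odd.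
by apply/dvP; exists (z * pe); rewrite mulrA [_ * z]mulrC z2 mul1r.
Qed.

Lemma dv2_odd (k r : Zp) : p <> 2%N -> r \in dv k -> r \in dv (2%:R * k).
Proof.
move=> p2 /dvP[t ->].
have p_odd : odd p by case: (even_prime p_pr) => //.
have [z z2] := padic_half p_pr p_odd.
apply/dvP; exists (z * t); transitivity (z * 2%:R * k * t); last by padic_ring p_pr.
by rewrite z2 mul1r.
Qed.

Definition minlam a b := minn (lam a) (lam b).

Definition defect E a b := P E a b - B a b.

Lemma defect_diff E a b : defect E a b = P E a b - B a b. Proof. by []. Qed.

Lemma defect_sym E a b : defect E a b = defect E b a.
Proof.
by rewrite /defect (gm_symE a) (pullback_sym (gm_sym G) B_block).
Qed.

Lemma defect_cont E E' a b : mxcong (fun _ _ => M) E E' ->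
  defect E a b - defect E' a b \in dv (pe ^+ M).
Proof.
move=> h; have := pullback_cont lam B h a b.
rewrite /defect; move: (P E) (P E') => X X'; rewrite !mxE => hX.
have -> : X a b - B a b - (X' a b - B a b) = X a b - X' a b by padic_ring p_pr.
exact: hX.
Qed.

Lemma defect_stable E E' (k : Zp) a b : mxcong (fun _ _ => M) E E' ->
  pe ^+ M \in dv k -> defect E a b \in dv k -> defect E' a b \in dv k.
Proof.
move=> h cM hE; have -> : defect E' a b = defect E a b - (defect E a b - defect E' a b).
  by padic_ring p_pr.
by rewrite rpredB // (dv_trans cM) // defect_cont.
Qed.

Lemma defect_star E Z a b : defect (E + star E Z) a b =
  defect E a b + star (P E) Z a b + star (P E) Z b a + quad (P E) Z a b.
Proof.
rewrite /defect (pullback_star (gm_sym G) B_block).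
move: (star (P E) Z) (quad (P E) Z) => X Y; rewrite !mxE.
by padic_ring p_pr.
Qed.

Lemma star_near E Z a b : mdv pe (P E - B) ->
  star (P E) Z a b - (B *m Z) a b \in dv pe.
Proof.
move=> h; have := star_mdvl lam Z h a b.
rewrite -[- B]scaleN1r starDl starZl scaleN1r (star_block B_block).
by move: (star _ _) (B *m Z) => X Y; rewrite !mxE.
Qed.

Section Offblock.
Variable S : mat -> Prop.
Hypothesis S_stable : stable (fun _ _ => M) S.
Hypothesis S_block : forall E a b, S E -> lam a = lam b -> defect E a b \in dv pe.
Hypothesis S_move : forall E E',
  (forall a b, lam a = lam b -> E' a b - E a b \in dv pe) -> S E -> S E'.

Definition offblock_pairs :=
  sort (fun u v : 'I_n * 'I_n => lam u.2 - lam u.1 <= lam v.2 - lam v.1)%N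
    [seq u <- enum [set: 'I_n * 'I_n] | (lam u.1 < lam u.2)%N].

Lemma mem_offblock u : (u \in offblock_pairs) = (lam u.1 < lam u.2)%N.
Proof. by rewrite mem_sort mem_filter mem_enum inE andbT. Qed.

(** The pairs are treated by increasing distance of their exponents. A move aimed at (a, b) touches,
    to first order, the pairs (a, y); if [lam y] differs from [lam b] and is no farther from
    [lam a], then [lam b] lies outside the interval from [lam a] to [lam y], and the gap yields a
    factor p. *)
Lemma density_offblock :
  dens (fun E => S E /\ forall a b, lam a != lam b -> defect E a b \in dv pe)
  = dens S / p%:R ^+ size offblock_pairs.
Proof.
have M0 (a : 'I_n) : (0 < M)%N by have := M_large a; lia.
have peM (a : 'I_n) : pe ^+ M \in dv pe.
  by have := dvXr (1 : Zp) (M0 a); rewrite mulr1 expr1.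
rewrite -(@density_seq p p_pr n M _ offblock_pairs S
  (fun u E => defect E u.1 u.2) (fun _ => 1)).
- apply: density_ext => E; split=> [[SE hE]|[SE hE]]; split=> //.
    move=> [a b]; rewrite mem_offblock /= mul1r => lt_ab; apply: hE.
    by rewrite neq_ltn lt_ab.
  move=> a b; rewrite neq_ltn => /orP[] lt_ab.
    by have := hE (a, b); rewrite mem_offblock mul1r; apply.
  by rewrite defect_sym; have := hE (b, a); rewrite mem_offblock mul1r; apply.
- by move=> _; rewrite oner_neq0.
- by move=> u _; rewrite mul1r (peM u.1).
- exact: S_stable.
- by move=> u E E' h; apply: defect_cont.
- by move=> E u _ _; apply: dv1.
move=> s1 [a b] s2 sE v.
have := mem_offblock (a, b); rewrite sE mem_cat inE eqxx orbT /= => /esym lt_ab.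
have s1P u : u \in s1 ->
    [/\ (lam u.1 < lam u.2)%N, (lam u.2 - lam u.1 <= lam b - lam a)%N & u != (a, b)].
  move=> us1; have := mem_offblock u; rewrite sE mem_cat us1 /= => /esym ->.
  have s_uniq : uniq offblock_pairs by rewrite sort_uniq filter_uniq ?enum_uniq.
  have s_sort : sorted (fun u v : 'I_n * 'I_n =>
      lam u.2 - lam u.1 <= lam v.2 - lam v.1)%N offblock_pairs.
    by apply: sort_sorted => ? ?; apply: leq_total.
  move: s_uniq s_sort; rewrite sE cat_uniq sorted_pairwise; last first.
    by move=> ? ? ?; apply: leq_trans.
  rewrite pairwise_cat allrel_consr => /and3P[_ + _] /andP[/andP[/allP hs _] _].
  rewrite /= negb_or => /andP[nab _]; split=> //; first exact: hs.
  by apply: contraNneq nab => <-.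
(* Chosen so that [B *m Z] is v times the elementary matrix at (b, a). All products of two entries
   in Z * Z vanish because [a] and [b] lie in different blocks. *)
pose Z : mat := v *: (iB *m delta_mx b a).
have ZE c d : Z c d = v * (iB c b * (d == a)%:R) by rewrite mxE mul_gmV_delta.
have Z0 c d : d != a -> Z c d = 0 by move=> da; rewrite ZE (negPf da) !mulr0.
have Z0' c d : lam c != lam b -> Z c d = 0.
  by move=> cb; rewrite ZE gmV_block // mul0r mulr0.
exists (fun E => E + star E Z).
  apply: admissible_star => x y; rewrite starE rpred_sum // => c _.
  have [->|ca] := eqVneq c a; last by rewrite (Z0 x) // mulr0 mul0r rpred0.
  by rewrite (Z0' a) ?mulr0 ?rpred0 // neq_ltn lt_ab.
move=> E SE _.
have starPZ x y : (lam x < lam y)%N -> star (P E) Z x y \in dv pe.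
  move=> xy; rewrite starE rpred_sum // => c _.
  have [ya|ya] := eqVneq y a; last by rewrite (Z0 _ y) // mulr0 rpred0.
  have [cb|cb] := eqVneq (lam c) (lam b); last by rewrite Z0' // mulr0 rpred0.
  by rewrite -mulrA; apply: dvp_expl; rewrite /gap; move: xy; rewrite ya; lia.
have quadZ x y : (lam x < lam y)%N -> quad (P E) Z x y = 0.
  move=> xy; rewrite quad_starE big1 // => c _; rewrite big1 // => d _.
  have [ya|ya] := eqVneq y a; last by rewrite (Z0 _ y) // mulr0.
  by rewrite (Z0 c x) ?mulr0 ?mul0r //; move: xy; rewrite ya; case: eqVneq => // ->; lia.
have starZP x y : (lam x < lam y)%N -> (lam y - lam x <= lam b - lam a)%N ->
    star (P E) Z y x - v * ((x, y) == (a, b))%:R \in dv pe.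
  move=> xy dxy; rewrite xpair_eqE; have [xa|xa] := eqVneq x a; last first.
    rewrite mulr0 subr0 starE rpred_sum // => c _.
    by rewrite Z0 // mulr0 rpred0.
  rewrite xa in xy dxy *; have [yb|yb] := eqVneq (lam y) (lam b); last first.
    have -> : (y == b) = false by apply: contra_neqF yb => /eqP ->.
    rewrite mulr0 subr0 starE rpred_sum // => c _.
    have [cb|cb] := eqVneq (lam c) (lam b); last by rewrite Z0' // mulr0 rpred0.
    by rewrite -mulrA; apply: dvp_expl; rewrite /gap; lia.
  have -> : v * (true && (y == b))%:R = (B *m Z) y a.
    rewrite /= -scalemxAr mulmxA gmK mul1mx !mxE eqxx andbT //.
  rewrite starE [in X in _ - X]mxE -sumrB rpred_sum // => c _.
  have [cb|cb] := eqVneq (lam c) (lam b); last first.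
    by rewrite Z0' // !mulr0 subr0 rpred0.
  rewrite (_ : gp y c a = 0%N) ?mul1r; last by rewrite /gap; lia.
  by rewrite -mulrBl dvMr // S_block // yb cb.
split.
- apply: S_move SE => x y xy.
  have -> : (E + star E Z) x y - E x y = star E Z x y.
    by move: (star E Z) => X; rewrite mxE; padic_ring p_pr.
  rewrite starE rpred_sum // => c _.
  have [ya|ya] := eqVneq y a; last by rewrite (Z0 _ y) // mulr0 rpred0.
  have [cb|cb] := eqVneq (lam c) (lam b); last by rewrite Z0' // mulr0 rpred0.
  by rewrite -mulrA; apply: dvp_expl; rewrite /gap; move: xy; rewrite ya; lia.
- move=> [x y] /s1P /= [xy dxy xyn]; rewrite defect_star quadZ // addr0 mul1r.
  have := starZP _ _ xy dxy; rewrite (negPf xyn) mulr0 subr0 => h.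
  have -> : defect E x y + star (P E) Z x y + star (P E) Z y x - defect E x y
    = star (P E) Z x y + star (P E) Z y x.
    by move: (star (P E) Z) => X; padic_ring p_pr.
  by rewrite rpredD // starPZ.
rewrite /= defect_star quadZ // addr0 !mul1r.
have -> : defect E a b + star (P E) Z a b + star (P E) Z b a - defect E a b - v
  = star (P E) Z a b + (star (P E) Z b a - v).
  by move: (star (P E) Z) => X; padic_ring p_pr.
have := starZP _ _ lt_ab (leqnn _); rewrite eqxx mulr1 => h.
by rewrite rpredD // starPZ.
Qed.

End Offblock.

Section HigherLevels.
Variable tau : nat.
Hypothesis tau_le1 : (tau <= 1)%N.
Hypothesis tau_odd : p <> 2%N -> tau = 0%N.

(** The target congruences truncated at p^k. With [tau] = 1 (p = 2 and L odd) only the bilinear form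
    must be preserved: the diagonal modulus 2 p^(lam a) drops to 2^(lam a) = 2 * 2^(lam a - 1). *)
Definition level k E :=
  (forall a b, a != b -> defect E a b \in dv (pe ^+ minn (minlam a b) k)) /\
  (forall a, defect E a a \in dv (2%:R * pe ^+ minn (lam a - tau) k)).

Definition level_pairs k : seq ('I_n * 'I_n) :=
  [seq u <- enum [set: 'I_n * 'I_n] |
    if u.1 == u.2 then (k < lam u.1 - tau)%N
    else (u.1 < u.2)%N && (k < minlam u.1 u.2)%N].

Lemma level_near k E : (0 < k)%N -> level k E -> mdv pe (P E - B).
Proof.
move=> k0 [h1 h2] a b.
have -> : (P E - B) a b = defect E a b by rewrite mxE [X in _ + X]mxE.
have la := lam_gt0 G a; have lb := lam_gt0 G b.
have [->|ab] := eqVneq a b; last first.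
  rewrite -[pe]expr1; apply: dvX (h1 _ _ ab); rewrite /minlam; lia.
have [p2|p2] := eqVneq p 2%N.
  by move: (h2 b) => /dv_mull; rewrite pe_two.
have := h2 b; move/dv_mulr; rewrite -[in dv pe](expr1 pe); apply: dvX.
by rewrite tau_odd; [lia|apply/eqP].
Qed.

Lemma level_stable k : stable (fun _ _ => M) (level k).
Proof.
move=> E E' h [h1 h2]; split=> [a b ab|a].
  apply: defect_stable h _ (h1 _ _ ab).
  rewrite -[pe ^+ M]mulr1 dvXr //.
  by have := M_large a; rewrite /minlam; lia.
apply: defect_stable h _ (h2 a).
have [i Mi] : exists i, M = (minn (lam a - tau) k + i).+1.
  by exists (M - (minn (lam a - tau) k)).-1; have := M_large a; lia.
by rewrite Mi exprS exprD mulrA dvMr // dvM ?dv2_pe ?dv_refl.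
Qed.

(** This says that the quadratic term of a move of size p^k is negligible on the diagonal. It fails
    for p = 2 and k = 1, where 4 is not a multiple of 8. *)
Lemma dv_sqr_level k : (0 < k)%N -> (p = 2%N -> (1 < k)%N) ->
  pe ^+ k ^+ 2 \in dv (2%:R * (pe ^+ k * pe)).
Proof.
move=> k0 k1; have [p2|/eqP p2] := eqVneq p 2%N; last first.
  apply: dv2_odd => //; rewrite expr2 dvM ?dv_refl //.
  by rewrite -[pe ^+ k]mulr1; apply: dvp_expl.
have [i ->] : exists i, k = i.+2 by exists k.-2; have := k1 p2; lia.
have -> : pe ^+ i.+2 ^+ 2 = pe * (pe ^+ i.+2 * pe) * pe ^+ i.
  by rewrite expr2 !exprS; padic_ring p_pr.
by rewrite dvMr // dvM ?dv_refl ?dv2_pe.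
Qed.

(** Once quadratic terms are negligible, each entry on or above the diagonal can be shifted
    independently of all others, so every pending congruence costs a factor p. *)
Lemma density_level k : (0 < k)%N -> (p = 2%N -> (1 < k)%N) ->
  dens (level k.+1) = dens (level k) / p%:R ^+ size (level_pairs k).
Proof.
move=> k0 k1.
pose cc (u : 'I_n * 'I_n) := if u.1 == u.2 then 2%:R * pe ^+ k else pe ^+ k.
have cc_pe u : cc u * pe = if u.1 == u.2 then 2%:R * (pe ^+ k * pe) else pe ^+ k.+1.
  by rewrite /cc; case: ifP; rewrite ?exprSr ?mulrA.
have sq2 := dv_sqr_level k0 k1.
have sq1 : pe ^+ k ^+ 2 \in dv (pe ^+ k * pe) by apply: dv_mulr sq2.
rewrite -(@density_seq p p_pr n M _ (level_pairs k) (level k)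
  (fun u E => defect E u.1 u.2) cc).
- apply: density_ext => E; split=> [[h1 h2]|[[h1 h2] h]].
    split.
      split=> [a b ab|a]; first by apply: dvX (h1 _ _ ab); lia.
      have := h2 a; rewrite -(subnKC (_ : minn (lam a - tau) k <= minn (lam a - tau) k.+1)%N).
        by rewrite exprD mulrA; apply: dv_mull.
      by lia.
    move=> [a b]; rewrite mem_filter cc_pe /=.
    case: eqVneq => [<-|ab] /andP[lt_k _].
      by have := h2 a; rewrite -exprSr (minn_idPr lt_k).
    by move/andP: lt_k => [_ lt_k]; have := h1 _ _ ab; rewrite (minn_idPr lt_k).
  split=> [a b ab|a].
    have [lt_k|lt_k] := ltnP k (minlam a b); last first.
      by have := h1 _ _ ab; rewrite !(minn_idPl _) // leqW.
    rewrite (minn_idPr lt_k); move: (ab); rewrite neq_ltn => /orP[] lt_ab.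
      by have := h (a, b); rewrite mem_filter cc_pe /= (negPf ab) lt_ab lt_k mem_enum inE; apply.
    have := h (b, a); rewrite mem_filter cc_pe /= eq_sym (negPf ab) lt_ab /minlam minnC.
    by rewrite lt_k mem_enum inE defect_sym; apply.
  have [lt_k|lt_k] := ltnP k (lam a - tau); last first.
    by have := h2 a; rewrite !(minn_idPl _) // leqW.
  have := h (a, a); rewrite mem_filter cc_pe /= eqxx lt_k mem_enum inE.
  by rewrite (minn_idPr lt_k) -exprSr; apply.
- by move=> u; rewrite /cc; case: ifP => _; rewrite ?mulf_neq0 ?peX_neq0 ?two_Zp_neq0.
- move=> [a b]; rewrite mem_filter cc_pe /= => /andP[+ _].
  case: ifP => _ lt_k; have := M_large a => Ma.
    have [i ->] : exists i, M = (k.+1 + i).+1 by exists (M - k.+1).-1; lia.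
    by rewrite exprS exprD mulrA dvMr // -exprSr dvM ?dv2_pe ?dv_refl.
  have [i ->] : exists i, M = (k.+1 + i)%N by exists (M - k.+1)%N; move: lt_k; rewrite /minlam; lia.
  by rewrite exprD dvMr ?dv_refl.
- exact: level_stable.
- by move=> u E E' h; apply: defect_cont.
- move=> E [a b]; rewrite mem_filter /cc /= => /andP[+ _] [h1 h2].
  case: eqVneq => [<- lt_k|ab /andP[_ lt_k]].
    by have := h2 a; rewrite (minn_idPr (ltnW lt_k)).
  by have := h1 _ _ ab; rewrite (minn_idPr (ltnW lt_k)).
move=> s1 [a b] s2 sE v.
have le_pair u : u \in level_pairs k -> (u.1 <= u.2)%N.
  by rewrite mem_filter => /andP[+ _]; case: eqVneq => [->//|_ /andP[/ltnW]].
have ab_in : (a, b) \in level_pairs k by rewrite sE mem_cat inE eqxx orbT.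
have le_ab := le_pair _ ab_in; rewrite /= in le_ab.
(* As [P E] is congruent to B modulo p, the linear term is p^k v at (a, b) plus its transpose; for a
   = b the two copies add up to 2 p^k v. *)
pose Z0 : mat := v *: (iB *m delta_mx a b); pose Z := pe ^+ k *: Z0.
have BZ0 x y : (B *m Z0) x y = v * ((x == a) && (y == b))%:R.
  by rewrite -scalemxAr mulmxA gmK mul1mx !mxE.
exists (fun E => E + star E Z).
  apply: admissible_star; rewrite starZl starZr => x y; rewrite !mxE dvMr //.
  by rewrite -[pe ^+ k]mulr1; apply: dvp_expl.
move=> E SE _; have near := level_near k0 SE.
have dE x y : defect (E + star E Z) x y - defect E x y =
   pe ^+ k * (star (P E) Z0 x y + star (P E) Z0 y x) + pe ^+ k ^+ 2 * quad (P E) Z0 x y.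
  rewrite defect_star starZr quad_starZ.
  by move: (star (P E) Z0) (quad _ _) => X Y; rewrite !mxE; padic_ring p_pr.
have dE1 x : defect (E + star E Z) x x - defect E x x
    - 2%:R * pe ^+ k * (v * ((x, x) == (a, b))%:R) \in dv (2%:R * (pe ^+ k * pe)).
  have := star_near Z0 x x near; rewrite BZ0 -xpair_eqE => h.
  rewrite dE; move: h; move: (star (P E) Z0) (quad _ _) => X Y /dvP[w hw].
  have -> : X x x = v * ((x, x) == (a, b))%:R + pe * w by rewrite -hw addrC subrK.
  set t := v * _.
  have -> : pe ^+ k * (t + pe * w + (t + pe * w)) + pe ^+ k ^+ 2 * Y x x - 2%:R * pe ^+ k * t
    = 2%:R * (pe ^+ k * pe) * w + pe ^+ k ^+ 2 * Y x x by padic_ring p_pr.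
  by apply: rpredD; [rewrite dvMr ?dv_refl|exact: dvMr sq2].
have dE2 x y : (x < y)%N -> defect (E + star E Z) x y - defect E x y
    - pe ^+ k * (v * ((x, y) == (a, b))%:R) \in dv (pe ^+ k * pe).
  move=> lt_xy.
  have := star_near Z0 x y near; rewrite BZ0 -xpair_eqE.
  have := star_near Z0 y x near; rewrite BZ0.
  have -> : ((y == a) && (x == b))%:R = 0 :> Zp.
    case: eqVneq => // ya; case: eqVneq => // xb.
    by move: lt_xy; rewrite ya xb ltnNge le_ab.
  rewrite dE; move: (star (P E) Z0) (quad _ _) => X Y /dvP[w hw] /dvP[w' hw'].
  have -> : X y x = pe * w by rewrite -hw mulr0 subr0.
  have -> : X x y = v * ((x, y) == (a, b))%:R + pe * w' by rewrite -hw' addrC subrK.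
  set t := v * _.
  have -> : pe ^+ k * (t + pe * w' + pe * w) + pe ^+ k ^+ 2 * Y x y - pe ^+ k * t
    = pe ^+ k * pe * (w + w') + pe ^+ k ^+ 2 * Y x y by padic_ring p_pr.
  by apply: rpredD; [rewrite dvMr ?dv_refl|exact: dvMr sq1].
have move_near u : u \in level_pairs k ->
    defect (E + star E Z) u.1 u.2 - defect E u.1 u.2 - cc u * (v * (u == (a, b))%:R)
    \in dv (cc u * pe).
  case: u => x y; rewrite mem_filter cc_pe /cc /=; case: eqVneq => [<- _|xy /andP[/andP[lt_xy _] _]].
    exact: dE1.
  by rewrite exprSr dE2.
split.
- case: SE => h1 h2; split=> [x y xy|x].
    rewrite -[defect _ _ _](subrK (defect E x y)) rpredD ?h1 //.
    rewrite dE rpredD // dvMr // ?exprS ?expr1 ?dvMr // -[pe ^+ k]mulr1 dvXr //; lia.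
  rewrite -[defect _ _ _](subrK (defect E x x)) rpredD ?h2 //.
  have dvm : 2%:R * pe ^+ k \in dv (2%:R * pe ^+ minn (lam x - tau) k).
    by rewrite dvM ?dv_refl // -[pe ^+ k]mulr1 dvXr // geq_minr.
  rewrite -[_ - defect E x x](subrK (2%:R * pe ^+ k * (v * ((x, x) == (a, b))%:R))).
  apply: rpredD; last exact: dvMr dvm.
  apply: (dv_trans dvm); apply: (@dv_mull _ _ _ pe); rewrite -[X in dv X]mulrA.
  exact: dE1.
- move=> u us1.
  have u_in : u \in level_pairs k by rewrite sE mem_cat us1.
  have s_uniq : uniq (level_pairs k) by rewrite filter_uniq ?enum_uniq.
  have un : u != (a, b).
    move: s_uniq; rewrite sE cat_uniq /= negb_or => /and3P[_ /andP[nab _] _].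
    by apply: contraNneq nab => <-.
  by have := move_near u u_in; rewrite (negPf un) mulr0 mulr0 subr0.
by have := move_near _ ab_in; rewrite eqxx mulr1.
Qed.

Lemma density_levels k m : (0 < k)%N -> (p = 2%N -> (1 < k)%N) -> (k <= m)%N ->
  dens (level m) = dens (level k) / p%:R ^+ (\sum_(k <= i < m) size (level_pairs i)).
Proof.
move=> k0 k1; elim: m => [|m IHm].
  by rewrite leqn0 => /eqP ->; rewrite big_geq // expr0 divr1.
rewrite leq_eqVlt => /orP[/eqP ->|]; first by rewrite big_geq // expr0 divr1.
rewrite ltnS => km; rewrite density_level ?IHm //; last 2 first.
- exact: leq_trans km.
- by move=> /k1 h; apply: leq_trans km.
by rewrite big_nat_recr //= exprD invfM mulrA.
Qed.

End HigherLevels.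
End Levels.

(** * Gauss sums *)

(* [chi] is a quadratic character with polar form [beta]; comparing the Gauss *)
(* sum of [chi] with that of its translate by [w] shows that [w] is isotropic. *)
Lemma gauss_isotropic (F : fieldType) (V : finZmodType) (chi : V -> F)
    (beta : V -> V -> F) (g : V -> V) (w : V) :
    (#|V|%:R != 0 :> F) ->
    (forall x, chi x != 0) ->
    (forall x y, chi (x + y) = chi x * chi y * beta x y) ->
    (forall x x' y, beta (x + x') y = beta x y * beta x' y) ->
    (forall x y, beta x y = beta y x) ->
    (forall z, (forall y, beta y z = 1) -> chi z = 1) ->
    injective g ->
    (forall x, chi (g x) * beta (g x) w = chi x) ->
  chi w = 1.
Proof.
move=> V0 chi0 chiD betaD betaC chiK g_inj gw.
(* The radical is a subgroup, so its order divides that of V and is nonzero in F as well. *)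
have K0 : #|[set z | [forall y, beta y z == 1]]|%:R != 0 :> F.
  set K := [set z | _].
  have beta0 y : beta y 0 = 1.
    have bn0 : beta 0 y != 0.
      by have := chi0 (0 + y); rewrite chiD mulf_eq0 negb_or => /andP[].
    by apply: (mulfI bn0); rewrite mulr1 (betaC y 0) -betaD addr0.
  have K_group : group_set K.
    apply/group_setP; split; first by rewrite inE; apply/forallP => y; rewrite beta0.
    move=> z z'; rewrite !inE => /forallP hz /forallP hz'; apply/forallP => y.
    by rewrite betaC betaD !(betaC _ y) (eqP (hz y)) (eqP (hz' y)) mulr1.
  have /dvdnP[q qE] : (#|K| %| #|V|)%N.
    by rewrite -cardsT; apply: (@cardSg _ [group of [set: V]] (Group K_group)); apply: finset.subsetT.
  by apply: contraNneq V0 => K0; rewrite qE natrM K0 mulr0.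
pose S := \sum_x chi x.
have gw_sum : S = S / chi w.
  rewrite {1}/S (eq_bigr (fun x => chi (g x) * beta (g x) w)) => [|x _]; last by rewrite gw.
  rewrite -(reindex_inj g_inj (P := xpredT) (F := fun y => chi y * beta y w)) /=.
  rewrite /S [in RHS](reindex_inj (addIr w)) /= mulr_suml; apply: eq_bigr => y _.
  by rewrite chiD [RHS]mulrAC mulfK.
suff S0 : S != 0.
  by apply: (mulfI S0); rewrite mulr1 {1}gw_sum divfK.
(* Substituting x = y + z turns the product into the double sum of chi(z) beta(y, z). The sum over y
   vanishes unless z is in the radical, where chi is 1; hence the Gauss sum is not 0. *)
suff : S * (\sum_y (chi y)^-1) = #|V|%:R * #|[set z | [forall y, beta y z == 1]]|%:R.
  move=> e; apply/negP => /eqP S0; move/eqP: e.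
  by rewrite S0 mul0r eq_sym mulf_eq0 (negPf V0) (negPf K0).
have -> : S * (\sum_y (chi y)^-1) = \sum_y \sum_z chi z * beta y z.
  rewrite mulr_sumr; apply: eq_bigr => y _.
  rewrite /S (reindex_inj (addrI y)) /= mulr_suml; apply: eq_bigr => z _.
  by rewrite chiD mulrAC [chi y * _]mulrC mulfK.
rewrite exchange_big /= -[#|[set z | _]|]sum1_card natr_sum mulr_sumr [RHS]big_mkcond /=.
apply: eq_bigr => z _; rewrite -mulr_sumr inE.
case: ifP => [/forallP h|/negbT /forallPn[y0 y0P]].
  rewrite chiK; last by move=> y; exact/eqP.
  rewrite mul1r mulr1 (eq_bigr (fun=> 1)) => [|y _]; last exact/eqP.
  by rewrite sumr_const.
suff -> : \sum_y beta y z = 0 by rewrite mulr0.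
have : (1 - beta y0 z) * (\sum_y beta y z) = 0.
  rewrite mulrBl mul1r mulr_sumr; apply/eqP; rewrite subr_eq0; apply/eqP.
  by rewrite [LHS](reindex_inj (addrI y0)) /=; apply: eq_bigr => y _; rewrite betaD.
move/eqP; rewrite mulf_eq0 subr_eq0 eq_sym (negPf y0P) => /eqP //.
Qed.

(** * Reduction to the residue field *)

Section ResidueField.
Variables (p : nat) (p_pr : prime p).
Local Notation Zp := (padic_int p_pr).
Local Notation pe := (p%:R : Zp).

Definition to_Fp (x : Zp) : 'F_p := (residue x 1)%:R.

Fact to_Fp_additive : zmod_morphism to_Fp.
Proof.
move=> x y; have := residue_add (x - y) y 1; rewrite subrK expn1 => ex.
by apply/eqP; rewrite eq_sym subr_eq /to_Fp -natrD ex Fp_nat_mod.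
Qed.

Fact to_Fp_monoid : monoid_morphism to_Fp.
Proof.
split.
  by have := residue_nat p_pr 1 1; rewrite /to_Fp expn1 => ->; rewrite Fp_nat_mod.
by move=> x y; rewrite /to_Fp residue_mul expn1 Fp_nat_mod // natrM.
Qed.

HB.instance Definition _ := GRing.isZmodMorphism.Build Zp 'F_p to_Fp to_Fp_additive.
HB.instance Definition _ := GRing.isMonoidMorphism.Build Zp 'F_p to_Fp to_Fp_monoid.

Lemma val_Fp_nat k : (k < p)%N -> (k%:R : 'F_p) = k :> nat.
Proof. by move=> kp; rewrite val_Fp_nat // modn_small. Qed.

Lemma to_Fp_eq0 x : (to_Fp x == 0) = (x \in dv pe).
Proof.
rewrite dvpP -val_eqE /= val_Fp_nat //.
by rewrite -[p in (_ < p)%N]expn1 residue_lt.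
Qed.

Lemma to_Fp_lift (k : 'F_p) : to_Fp (k : nat)%:R = k.
Proof. by rewrite /to_Fp residue_nat expn1 Fp_nat_mod // natr_Zp. Qed.

(** Over the field F_p a one-sided inverse of a square matrix is two-sided. *)
Lemma mulmx_inv_cong n (X Y : 'M[Zp]_n) :
  mdv pe (X *m Y - 1%:M) -> mdv pe (Y *m X - 1%:M).
Proof.
have mdvE (W : 'M[Zp]_n) : mdv pe W <-> map_mx to_Fp W = 0.
  split=> [h|/matrixP h] => [|a b].
    by apply/matrixP => a b; rewrite !mxE; apply/eqP; rewrite to_Fp_eq0.
  by have := h a b; rewrite !mxE => /eqP; rewrite to_Fp_eq0.
move=> /mdvE; rewrite map_mxB map_mx1 map_mxM => /eqP; rewrite subr_eq0 => /eqP.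
move/mulmx1C => e; apply/mdvE.
by rewrite map_mxB map_mx1 map_mxM e subrr.
Qed.

End ResidueField.

(** * Block forms and characteristic vectors *)

Lemma sum_symmetric (V : zmodType) n (F : 'I_n -> 'I_n -> V) :
    (forall c d, F c d = F d c) ->
  \sum_c \sum_d F c d = \sum_c F c c + (\sum_(c < n) \sum_(d < n | (d < c)%N) F c d) *+ 2.
Proof.
move=> Fsym; have e : \sum_(c < n) \sum_(d < n | (d < c)%N) F c d
    = \sum_(c < n) \sum_(d < n | (c < d)%N) F c d.
  rewrite (exchange_big_dep xpredT) //=; apply: eq_bigr => c _.
  by apply: eq_bigr => d _; apply: Fsym.
rewrite mulr2n {2}e -!big_split /=.
apply: eq_bigr => c _; rewrite (bigD1 c) //=; congr (_ + _).
rewrite (bigID (fun d : 'I_n => d < c)%N) /=; congr (_ + _).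
  apply: eq_bigl => d; case: (ltngtP d c) => [dc|dc|/val_inj ->].
  - by rewrite andbT; apply: contraTneq dc => ->; rewrite ltnn.
  - by rewrite andbF.
  - by rewrite eqxx.
apply: eq_bigl => d; case: (ltngtP d c) => [dc|dc|/val_inj ->].
- by rewrite andbF.
- by rewrite andbT; apply: contraTneq dc => ->; rewrite ltnn.
- by rewrite eqxx.
Qed.

Section Forms.
Variables (p : nat) (p_pr : prime p) (n : nat) (G : jordan_gram p_pr n).
Local Notation Zp := (padic_int p_pr).
Local Notation mat := 'M[Zp]_n.
Local Notation vec := 'cV[Zp]_n.
Local Notation lam := (lam G).
Local Notation B := (gm G).
Local Notation iB := (gmV G).
Implicit Types (E X : mat) (x y z w : vec) (a b c d : 'I_n) (i j k : nat).
Add Ring Zp_ring : (padic_ring_theory p_pr).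

Definition bf X x y : Zp := (x^T *m X *m y) 0 0.

Lemma bfE X x y : bf X x y = \sum_c \sum_d x c 0 * X c d * y d 0.
Proof.
rewrite /bf -mulmxA mxE; apply: eq_bigr => c _; rewrite !mxE mulr_sumr.
by apply: eq_bigr => d _; rewrite mulrA.
Qed.

Lemma bfDl X x x' y : bf X (x + x') y = bf X x y + bf X x' y.
Proof. by rewrite /bf linearD /= !mulmxDl mxE. Qed.

Lemma bfDr X x y y' : bf X x (y + y') = bf X x y + bf X x y'.
Proof. by rewrite /bf mulmxDr mxE. Qed.

Lemma bfDX X X' x y : bf (X + X') x y = bf X x y + bf X' x y.
Proof. by rewrite /bf mulmxDr mulmxDl mxE. Qed.

Lemma bfZX (k : Zp) X x y : bf (k *: X) x y = k * bf X x y.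
Proof. by rewrite /bf -scalemxAr -scalemxAl mxE. Qed.

Lemma bfBX X X' x y : bf (X - X') x y = bf X x y - bf X' x y.
Proof. by rewrite -[- X']scaleN1r bfDX bfZX mulN1r. Qed.

Lemma bfZl X (k : Zp) x y : bf X (k *: x) y = k * bf X x y.
Proof. by rewrite /bf linearZ /= -!scalemxAl mxE. Qed.

Lemma bfZr X (k : Zp) x y : bf X x (k *: y) = k * bf X x y.
Proof. by rewrite /bf -scalemxAr mxE. Qed.

Lemma bf_tr X x y : bf X x y = bf X^T y x.
Proof. by rewrite /bf -[x^T *m X *m y]trmxK mxE !trmx_mul trmxK mulmxA. Qed.

Lemma bf_mulmx X E x y : bf X (E *m x) (E *m y) = bf (E^T *m X *m E) x y.
Proof. by rewrite /bf trmx_mul !mulmxA. Qed.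

Lemma bf_mdv (k : Zp) X x y : mdv k X -> bf X x y \in dv k.
Proof.
move=> h; rewrite bfE rpred_sum // => c _; rewrite rpred_sum // => d _.
by rewrite dvMr // dvMl.
Qed.

Definition supp j x := forall c, lam c != j -> x c 0 = 0.

Lemma bf_supp X X' j k x y : supp j x -> supp k y ->
  (forall a b, lam a = j -> lam b = k -> X a b = X' a b) -> bf X x y = bf X' x y.
Proof.
move=> hx hy h; rewrite !bfE; apply: eq_bigr => c _; apply: eq_bigr => d _.
have [cj|/hx ->] := eqVneq (lam c) j; last by rewrite !mul0r.
have [dk|/hy ->] := eqVneq (lam d) k; last by rewrite !mulr0.
by rewrite h.
Qed.

Lemma bf_supp_dv (k : Zp) X j l x y : supp j x -> supp l y ->
  (forall a b, lam a = j -> lam b = l -> X a b \in dv k) -> bf X x y \in dv k.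
Proof.
move=> hx hy h; rewrite bfE rpred_sum // => c _; rewrite rpred_sum // => d _.
have [cj|/hx ->] := eqVneq (lam c) j; last by rewrite !mul0r rpred0.
have [dl|/hy ->] := eqVneq (lam d) l; last by rewrite !mulr0 rpred0.
by rewrite dvMr // dvMl // h.
Qed.

Lemma bf_diag_dv_on (S : pred 'I_n) (k : Zp) X x : X^T = X ->
  (forall c, ~~ S c -> x c 0 = 0) ->
  (forall a b, S a -> S b -> a != b -> X a b \in dv k) ->
  (forall a, S a -> X a a \in dv (2%:R * k)) -> bf X x x \in dv (2%:R * k).
Proof.
move=> Xs hx h1 h2; rewrite bfE sum_symmetric; last first.
  by move=> c d; rewrite -{1}Xs mxE; padic_ring p_pr.
rewrite rpredD //.
  rewrite rpred_sum // => c _.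
  have [cS|/hx ->] := boolP (S c); last by rewrite mulr0 rpred0.
  by rewrite dvMr // dvMl // h2.
rewrite -[_ *+ 2]mulr_natl; apply: dvM; first exact: dv_refl.
rewrite rpred_sum // => c _; rewrite rpred_sum // => d dc.
have [cS|/hx ->] := boolP (S c); last by rewrite !mul0r rpred0.
have [dS|/hx ->] := boolP (S d); last by rewrite !mulr0 rpred0.
by rewrite dvMr // dvMl // h1 //; apply: contraTneq dc => ->; rewrite ltnn.
Qed.

Lemma bf_diag_dv (k : Zp) X j x : X^T = X -> supp j x ->
  (forall a b, lam a = j -> lam b = j -> a != b -> X a b \in dv k) ->
  (forall a, lam a = j -> X a a \in dv (2%:R * k)) -> bf X x x \in dv (2%:R * k).
Proof.
move=> Xs hx h1 h2; apply: (@bf_diag_dv_on [pred a | lam a == j]) => //.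
  by move=> a b /eqP aj /eqP bj; apply: h1.
by move=> a /eqP; apply: h2.
Qed.

Definition blk i x : vec := \col_c (if lam c == i then x c 0 else 0).

Lemma blk_supp i x : supp i (blk i x).
Proof. by move=> c ci; rewrite mxE (negPf ci). Qed.

Definition gm_blk i : mat := \matrix_(c, d) ((lam c == i)%:R * B c d).

Local Notation bbk i := (bf (gm_blk i)).

Lemma gm_blk_sym i : (gm_blk i)^T = gm_blk i.
Proof.
apply/matrixP => c d; rewrite !mxE (gm_symE G d c).
have [->//|cd] := eqVneq (lam c) (lam d).
by rewrite (gm_block cd) !mulr0.
Qed.

Lemma bbk_sym i x y : bbk i x y = bbk i y x.
Proof. by rewrite bf_tr gm_blk_sym. Qed.

Lemma bbk_blkl i x y : bbk i (blk i x) y = bbk i x y.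
Proof.
rewrite !bfE; apply: eq_bigr => c _; apply: eq_bigr => d _; rewrite !mxE.
by case: ifP => _; rewrite ?mul0r ?mulr0 ?mul0r.
Qed.

Lemma bbk_blkr i x y : bbk i x (blk i y) = bbk i x y.
Proof. by rewrite bbk_sym bbk_blkl bbk_sym. Qed.

Lemma bbk_cong (k : Zp) i x x' y :
  (forall c, lam c = i -> x c 0 - x' c 0 \in dv k) ->
  bbk i x y - bbk i x' y \in dv k.
Proof.
move=> h; have -> : bbk i x y - bbk i x' y = bbk i (x - x') y.
  by rewrite bfDl -[- x']scaleN1r bfZl mulN1r.
rewrite bfE rpred_sum // => c _; rewrite rpred_sum // => d _; rewrite !mxE.
have [ci|_] := eqVneq (lam c) i; last by rewrite mul0r mulr0 mul0r rpred0.
by rewrite !dvMr // h.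
Qed.

Lemma bbk_sqrD i x y : bbk i (x + y) (x + y) = bbk i x x + bbk i x y *+ 2 + bbk i y y.
Proof. by rewrite bfDl !bfDr (bbk_sym i y x); padic_ring p_pr. Qed.

Lemma bbk_lift i x (x' : vec) : (forall c, lam c = i -> x c 0 - x' c 0 \in dv (p%:R : Zp)) ->
  exists t : vec, forall y, bbk i x y = bbk i (x' + p%:R *: t) y.
Proof.
move=> h; have h' c : exists r : Zp, lam c = i -> x c 0 - x' c 0 = p%:R * r.
  have [ci|ci] := eqVneq (lam c) i; last by exists 0 => ci'; rewrite ci' eqxx in ci.
  by have /dvP[r rE] := h c ci; exists r.
exists (\col_c projT1 (cid (h' c))) => y.
rewrite -bbk_blkl -[RHS]bbk_blkl; congr bf; apply/matrixP => c o; rewrite !mxE.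
case: ifP => // /eqP ci; case: (cid (h' c)) => r /= rE.
by rewrite -rE // addrC subrK.
Qed.

(** With x = x' + p t on the block, the square changes by 2 p b(x', t) + p^2 b(t, t), and 2 divides
    p. This is why q_i modulo p is well defined on the reduction. *)
Lemma bbk_sq_cong i x (x' : vec) : (forall c, lam c = i -> x c 0 - x' c 0 \in dv (p%:R : Zp)) ->
  bbk i x x - bbk i x' x' \in dv (2%:R * p%:R : Zp).
Proof.
move=> /bbk_lift[t tE]; rewrite tE bbk_sym tE bbk_sqrD bfZl !bfZr.
have /dvP[r rE] := dv2_pe p_pr.
apply/dvP; exists (bbk i x' t + r * bbk i t t).
transitivity (2%:R * p%:R * bbk i x' t + p%:R * (p%:R * bbk i t t)).
  by move: (bbk i _ _) (bbk i _ _) (bbk i _ _) => q1 q2 q3; padic_ring p_pr.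
by rewrite {2}rE; move: (bbk i _ _) (bbk i _ _) => q1 q2; padic_ring p_pr.
Qed.

Lemma bf_gm_blk i x y : supp i x -> bf B x y = bbk i x y.
Proof.
move=> hx; rewrite !bfE; apply: eq_bigr => c _; apply: eq_bigr => d _; rewrite mxE.
by have [ci|/hx ->] := eqVneq (lam c) i; rewrite ?mul1r // !mul0r.
Qed.

Lemma delta_supp a : supp (lam a) (delta_mx a 0 : vec).
Proof. by move=> c; rewrite mxE; case: (eqVneq c a) => // ->; rewrite eqxx. Qed.

Lemma bf_delta X a b : bf X (delta_mx a 0) (delta_mx b 0) = X a b.
Proof.
rewrite /bf mxE (bigD1 b) //= big1 ?addr0 => [|k kb]; last first.
  by rewrite !mxE (negPf kb) mulr0.
rewrite !mxE !eqxx mulr1 (bigD1 a) //= big1 ?addr0 => [|k ka]; last first.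
  by rewrite !mxE (negPf ka) mul0r.
by rewrite !mxE !eqxx mul1r.
Qed.

Lemma bbk_coord k c x : lam c = k -> bbk k x (iB *m delta_mx c 0) = x c 0.
Proof.
move=> ck; have hs : supp k (iB *m delta_mx c 0).
  move=> d dk; rewrite mxE big1 // => e _; rewrite mxE.
  case: (eqVneq e c) => [->|_]; last by rewrite mulr0.
  by rewrite gmV_block ?mul0r // ck.
rewrite bbk_sym -(bf_gm_blk _ hs) /bf trmx_mul (gmV_sym G) -!mulmxA (mulmxA iB).
rewrite (gmVK G) mul1mx mxE (bigD1 c) //= big1 ?addr0 => [|e ec].
  by rewrite !mxE !eqxx mul1r.
by rewrite !mxE (negPf ec) mul0r.
Qed.

End Forms.

Section TwoForms.
Variables (two_pr : prime 2) (n : nat) (G : jordan_gram two_pr n).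
Local Notation Zp := (padic_int two_pr).
Local Notation mat := 'M[Zp]_n.
Local Notation vec := 'cV[Zp]_n.
Local Notation lam := (lam G).
Local Notation B := (gm G).
Local Notation iB := (gmV G).
Local Notation P := (pullback lam B).
Local Notation bbk i := (bf (gm_blk G i)).
Local Notation blk := (blk G).
Local Notation supp := (supp G).
Local Notation even x := (x \in dv (2%:R : Zp)).
Implicit Types (E X : mat) (x y z w : vec) (a b c d : 'I_n) (i j k : nat).
Add Ring Z2_ring : (padic_ring_theory two_pr).

(** With z = B y one has b(y, y) = z^T B^(-1) z, which modulo 2 is the sum of the [iB c c] z_c^2,
    hence of the [iB c c] z_c. This is the product with the diagonal of the inverse Gram matrix, so
    that diagonal is characteristic on every block at once. *)
Definition char_vec : vec := \col_a iB a a.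

Local Notation u := char_vec.

Lemma char_vecE c : u c 0 = iB c c. Proof. by rewrite mxE. Qed.

Lemma char_vecP i y : bbk i y y - bbk i u y \in dv (2%:R : Zp).
Proof.
pose y' := blk i y; pose z := B *m y'.
have -> : bbk i y y = bf iB z z.
  rewrite -bbk_blkl -bbk_blkr -(bf_gm_blk _ (@blk_supp _ _ _ G i y)) bf_mulmx.
  by rewrite (gm_sym G) gmK mul1mx.
have -> : bbk i u y = \sum_c iB c c * z c 0.
  rewrite -bbk_blkr bbk_sym -(bf_gm_blk _ (@blk_supp _ _ _ G i y)) bf_tr (gm_sym G).
  by rewrite /bf -mulmxA mxE; apply: eq_bigr => c _; rewrite !mxE.
rewrite bfE sum_symmetric; last first.
  by move=> c d; rewrite (gmV_symE G d c); padic_ring two_pr.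
rewrite addrAC -sumrB rpredD // ?rpred_sum // => [c _|].
  have -> : z c 0 * iB c c * z c 0 - iB c c * z c 0 = iB c c * (z c 0 * z c 0 - z c 0).
    by padic_ring two_pr.
  by rewrite dvMl // dv2_sqr.
by rewrite -[_ *+ 2]mulr_natl dvMr ?dv_refl.
Qed.

Definition par j := [exists a, (lam a == j) && (B a a \notin dv (2%:R : Zp))].

Lemma parPn j a : ~~ par j -> lam a = j -> even (B a a).
Proof.
move=> pj aj; apply: contrapT => /negP h; case/negP: pj.
by apply/existsP; exists a; rewrite aj eqxx.
Qed.

Lemma par_even j x : ~~ par j -> even (bbk j x x).
Proof.
move=> pj; rewrite -bbk_blkl -bbk_blkr -[X in dv X]mulr1.
apply: (bf_diag_dv (j := j)); [exact: gm_blk_sym|exact: blk_supp| |].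
  by move=> *; apply: dv1.
by move=> a aj; rewrite mulr1 mxE dvMl // (parPn pj).
Qed.

Lemma par_char j a : ~~ par j -> lam a = j -> even (iB a a).
Proof.
move=> pj aj; have -> : iB a a = bbk j (iB *m delta_mx a 0) (iB *m delta_mx a 0).
  rewrite -bf_gm_blk; last first.
    move=> c ca; rewrite mxE big1 // => k _; rewrite mxE.
    case: eqVneq => [->|_]; last by rewrite mulr0.
    by rewrite gmV_block ?mul0r // aj.
  by rewrite bf_mulmx gmV_sym gmVK mul1mx bf_delta.
exact: par_even.
Qed.

Lemma char_par j a : lam a = j -> (forall c, lam c = j -> even (iB c c)) ->
  even (B a a).
Proof.
move=> aj h; have := char_vecP j (delta_mx a 0).
have -> : bbk j (delta_mx a 0) (delta_mx a 0) = B a a.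
  by rewrite bf_delta mxE aj eqxx mul1r.
move=> h1; rewrite -(subrK (bbk j u (delta_mx a 0)) (B a a)) rpredD //.
have := @bbk_cong _ _ _ G 2%:R j u 0 (delta_mx a 0); rewrite [bbk j 0 _](_ : _ = 0) ?subr0.
  by apply=> c cj; rewrite !mxE subr0 h.
by rewrite /bf trmx0 !mul0mx mxE.
Qed.

(** If all [iB c c] of the block were even, its characteristic vector would be 0 modulo 2 and every
    square in the block would be even. *)
Lemma parP j : par j -> exists2 a, lam a = j & iB a a \notin dv (2%:R : Zp).
Proof.
move=> /existsP[a /andP[/eqP aj Ba]]; apply: contrapT => h; case/negP: Ba.
apply: (char_par aj) => c cj; apply: contrapT => /negP hc; apply: h.
by exists c.
Qed.

Definition dist_wt j l k : nat := minn j k - l + (l - maxn j k).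

Definition wt_gm j k : mat := \matrix_(c, d) (2%:R ^+ dist_wt j (lam c) k * B c d).

Lemma bf_pullback E j k x y : supp j x -> supp k y ->
  bf (P E) x y = bf (wt_gm j k) (E *m x) (E *m y).
Proof.
move=> hx hy; rewrite bf_mulmx; apply: (bf_supp hx hy) => a b aj bk.
rewrite pullbackE mxE exchange_big /=; apply: eq_bigr => d _; rewrite mxE mulr_suml.
apply: eq_bigr => c _; rewrite !mxE.
rewrite (_ : gap lam a c b = dist_wt j (lam c) k); last by rewrite /gap aj bk.
by padic_ring two_pr.
Qed.

(** A block at distance d from j enters the pullback with weight 2^d, so modulo 8 only distances 0,
    1 and 2 count. *)
Lemma bf_pullback8 E j x : (0 < j)%N -> supp j x ->
  bf (P E) x x - (bbk j (E *m x) (E *m x)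
     + 2%:R * (bbk j.-1 (E *m x) (E *m x) + bbk j.+1 (E *m x) (E *m x))
     + 4%:R * (bbk j.-2 (E *m x) (E *m x) + bbk j.+2 (E *m x) (E *m x)))
    \in dv (2%:R * (2%:R * 2%:R)).
Proof.
move=> j0 hx; rewrite (bf_pullback _ hx hx); move: (E *m x) => y.
have -> : bf (wt_gm j j) y y - (bbk j y y + 2%:R * (bbk j.-1 y y + bbk j.+1 y y)
     + 4%:R * (bbk j.-2 y y + bbk j.+2 y y))
   = bf (wt_gm j j - (gm_blk G j + 2%:R *: (gm_blk G j.-1 + gm_blk G j.+1)
         + 4%:R *: (gm_blk G j.-2 + gm_blk G j.+2))) y y.
  by rewrite bfBX !(bfDX, bfZX).
apply: bf_mdv => c d; rewrite !mxE.
(* For small j the truncated indices [j.-1] and [j.-2] may coincide or be 0; this is harmless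
   because no basis vector has exponent 0. *)
have c0 := lam_gt0 G c; set l := lam c in c0 *.
pose q : nat := (l == j) + 2 * ((l == j.-1) + (l == j.+1)) + 4 * ((l == j.-2) + (l == j.+2)).
have -> : 2%:R ^+ dist_wt j l j * B c d - ((l == j)%:R * B c d
      + 2%:R * ((l == j.-1)%:R * B c d + (l == j.+1)%:R * B c d)
      + 4%:R * ((l == j.-2)%:R * B c d + (l == j.+2)%:R * B c d))
   = (2%:R ^+ dist_wt j l j - q%:R) * B c d :> Zp.
  have -> : q%:R = (l == j)%:R + 2%:R * ((l == j.-1)%:R + (l == j.+1)%:R)
      + 4%:R * ((l == j.-2)%:R + (l == j.+2)%:R) :> Zp.
    by rewrite -!natrD -!natrM -!natrD.
  by padic_ring two_pr.
apply: dvMr; rewrite -natrX.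
have [big|small] := leqP 3 (dist_wt j l j).
  have -> : q = 0%N by move: big; rewrite /q /dist_wt; lia.
  rewrite subr0 natrX -(subnK big) exprD dvMl //.
  by rewrite !exprS expr0 mulr1 dv_refl.
suff -> : (2 ^ dist_wt j l j = q)%N by rewrite subrr rpred0.
move: small; rewrite /q /dist_wt.
have [->|[->|[->|[e|[e|h]]]]] : l = j \/ l = j.+1 \/ l = j.+2 \/ l = j.-1
   \/ l = j.-2 \/ (3 <= minn j j - l + (l - maxn j j))%N by lia.
- by rewrite minnn maxnn subnn eqxx; lia.
- by rewrite minnn maxnn (_ : j - j.+1 + (j.+1 - j) = 1)%N; lia.
- by rewrite minnn maxnn (_ : j - j.+2 + (j.+2 - j) = 2)%N; lia.
- by rewrite minnn maxnn (_ : j - l + (l - j) = 1)%N; lia.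
- by rewrite minnn maxnn (_ : j - l + (l - j) = 2)%N; lia.
by lia.
Qed.

(** The weight of a block is odd precisely when its index lies between j and k. *)
Lemma bf_pullback2 E j k x y : (j <= k)%N -> supp j x -> supp k y ->
  bf (P E) x y - \sum_(j <= i < k.+1) bbk i (E *m x) (E *m y) \in dv (2%:R : Zp).
Proof.
move=> jk hx hy; rewrite (bf_pullback _ hx hy); move: (E *m x) (E *m y) => v w.
have -> : \sum_(j <= i < k.+1) bbk i v w = bf (\sum_(j <= i < k.+1) gm_blk G i) v w.
  by rewrite /bf mulmx_sumr mulmx_suml summxE.
rewrite -bfBX; apply: bf_mdv => c d; rewrite !mxE summxE.
under eq_bigr => i _ do rewrite mxE.
rewrite -mulr_suml -mulrBl dvMr //.
have [/andP[jc ck]|out] := boolP ((j <= lam c) && (lam c <= k))%N.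
  rewrite (_ : dist_wt j _ k = 0%N); last by rewrite /dist_wt; lia.
  rewrite expr0 (bigD1_seq (lam c)) ?iota_uniq ?mem_index_iota ?jc ?ltnS //=.
  rewrite eqxx big1 => [|i /negPf]; last by rewrite eq_sym => ->.
  by rewrite addr0 subrr rpred0.
rewrite big_nat_cond big1 => [|i /andP[/andP[ji ik] _]]; last first.
  by case: eqVneq => // e; move: out; rewrite e ji -ltnS ik.
rewrite subr0 -[2%:R ^+ _]mulr1; apply: dvp_expl.
by move: out; rewrite /dist_wt; lia.
Qed.

End TwoForms.

(** * Endomorphisms preserving the form modulo 2 *)

Section Near.
Variables (two_pr : prime 2) (n : nat) (G : jordan_gram two_pr n).
Local Notation Zp := (padic_int two_pr).
Local Notation mat := 'M[Zp]_n.
Local Notation vec := 'cV[Zp]_n.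
Local Notation lam := (lam G).
Local Notation B := (gm G).
Local Notation iB := (gmV G).
Local Notation P := (pullback lam B).
Local Notation bbk i := (bf (gm_blk G i)).
Local Notation blk := (blk G).
Local Notation supp := (supp G).
Local Notation u := (char_vec G).
Local Notation even x := (x \in dv (2%:R : Zp)).
Implicit Types (E X : mat) (x y z w t v : vec) (a b c d : 'I_n) (i j k : nat).
Add Ring Z2_ring : (padic_ring_theory two_pr).

Lemma bbk_diff j k x y : supp k y -> j != k -> bbk j x y = 0.
Proof.
move=> hy jk; rewrite bbk_sym -bbk_blkr (_ : bf _ _ _ = bf B (blk j x) y); last first.
  by rewrite (bf_gm_blk _ (@blk_supp _ _ _ G _ _)) bbk_sym.
rewrite bfE big1 // => c _; rewrite big1 // => d _.
have [dk|/hy->] := eqVneq (lam d) k; last by rewrite mulr0.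
have [cj|cj] := eqVneq (lam c) j; last by rewrite blk_supp // !mul0r.
by rewrite (gm_block (j := G)) ?mulr0 ?mul0r // cj dk.
Qed.

Lemma bbk_cong2 i v (v' : vec) y : (forall c, lam c = i -> even (v c 0 - v' c 0)) ->
  even (bbk i v y - bbk i v' y).
Proof. exact: bbk_cong. Qed.

(** Writing v = u + 2 t on the block, the difference is 4 (b(u, t) + b(t, t)), and the bracket is
    even since u is characteristic. *)
Lemma bbk_sq_char i v : (forall c, lam c = i -> even (v c 0 - u c 0)) ->
  bbk i v v - bbk i u u \in dv (2%:R * (2%:R * 2%:R) : Zp).
Proof.
move=> /bbk_lift[t tE]; rewrite tE bbk_sym tE bbk_sqrD bfZl !bfZr.
have /dvP[r rE] := char_vecP G i t; have {rE}rE : bbk i t t = bbk i u t + 2%:R * r.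
  by rewrite -rE addrC subrK.
rewrite rE; apply/dvP; exists (bbk i u t + r).
by padic_ring two_pr.
Qed.

Section NearE.
Variable E : mat.
Hypothesis E_near : mdv (2%:R : Zp) (P E - B).

Lemma near_bf j x y : supp j x -> even (bf (P E) x y - bbk j x y).
Proof.
move=> hx; rewrite -(bf_gm_blk _ hx) -bfBX; exact: bf_mdv.
Qed.

Lemma near_bbk k x y : even (bbk k (E *m blk k x) (E *m blk k y) - bbk k x y).
Proof.
have h1 := bf_pullback2 (G := G) E (leqnn k) (@blk_supp _ _ _ G k x) (@blk_supp _ _ _ G k y).
rewrite big_nat1 in h1; apply: cong_trans (cong_sym h1) _.
have := near_bf (blk k y) (@blk_supp _ _ _ G k x).
by rewrite bbk_blkl bbk_blkr.
Qed.

Definition diag_blk : mat := \matrix_(a, b) (if lam a == lam b then E a b else 0).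

Lemma diag_blkE k y c : lam c = k -> (diag_blk *m y) c 0 = (E *m blk k y) c 0.
Proof.
move=> ck; rewrite !mxE; apply: eq_bigr => d _; rewrite !mxE ck eq_sym.
by case: ifP => _; rewrite ?mul0r ?mulr0.
Qed.

(** Modulo 2 the block-diagonal part of E is an isometry of the nondegenerate form B, hence
    invertible. *)
Lemma diag_blk_inv : mdv (2%:R : Zp) (iB *m diag_blk^T *m B *m diag_blk - 1%:M).
Proof.
have h : mdv (2%:R : Zp) (diag_blk^T *m B *m diag_blk - B).
  move=> a b; rewrite -bf_delta bfBX -bf_mulmx [bf B _ (delta_mx b 0)]bf_delta.
  have hs k y : supp k y -> supp k (diag_blk *m y).
    move=> hy c ck; rewrite mxE big1 // => d _; rewrite mxE.
    have [dk|/hy ->] := eqVneq (lam d) k; last by rewrite mulr0.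
    by rewrite dk (negPf ck) mul0r.
  have ha := hs _ _ (@delta_supp _ _ _ G a); have hb := hs _ _ (@delta_supp _ _ _ G b).
  rewrite (bf_gm_blk _ ha); have [ab|ab] := eqVneq (lam a) (lam b); last first.
    by rewrite (gm_block ab) subr0 (bbk_diff _ hb) // rpred0.
  have := near_bbk (lam a) (delta_mx a 0) (delta_mx b 0).
  rewrite [X in _ - X](_ : _ = B a b); last by rewrite bf_delta mxE eqxx mul1r.
  move=> h1; apply: cong_trans h1; have e y c : lam c = lam a ->
      even ((diag_blk *m y) c 0 - (E *m blk (lam a) y) c 0).
    by move=> ca; rewrite (diag_blkE _ ca) subrr rpred0.
  apply: cong_trans (bbk_cong2 _ (e _)) _; rewrite bbk_sym [X in _ - X]bbk_sym.
  exact: (bbk_cong2 _ (e _)).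
have -> : iB *m diag_blk^T *m B *m diag_blk - 1%:M
    = iB *m (diag_blk^T *m B *m diag_blk - B).
  by rewrite mulmxBr gmVK !mulmxA.
by move=> a b; rewrite mxE rpred_sum // => c _; rewrite dvMl // h.
Qed.

Lemma near_surj k z : exists y, forall c, lam c = k ->
  even (z c 0 - (E *m blk k y) c 0).
Proof.
exists (iB *m diag_blk^T *m B *m z) => c ck; rewrite -(diag_blkE _ ck).
have := mulmx_inv_cong diag_blk_inv; move: (iB *m _ *m _) => X h.
apply: cong_sym; rewrite mulmxA.
have -> : (diag_blk *m X *m z) c 0 - z c 0 = ((diag_blk *m X - 1%:M) *m z) c 0.
  by rewrite mulmxBl mul1mx; move: (_ *m z) => W; rewrite !mxE.
by rewrite mxE rpred_sum // => d _; rewrite dvMr.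
Qed.

(** A characteristic vector is unique modulo 2, and the diagonal block of E is an isometry modulo 2,
    so it fixes this vector. *)
Lemma near_char k c : lam c = k -> even ((E *m blk k u) c 0 - u c 0).
Proof.
move=> ck; rewrite -!(bbk_coord _ ck); move: (iB *m _) => z.
have [y zy] := near_surj k z.
rewrite bbk_sym [X in _ - X]bbk_sym.
apply: cong_trans (bbk_cong2 _ zy) _.
rewrite bbk_sym; apply: cong_trans (near_bbk k u y) _.
apply: cong_trans (cong_sym (char_vecP G k y)) _.
apply: cong_trans (cong_sym (near_bbk k y y)) _.
apply: cong_trans (char_vecP G k _) _.
by rewrite bbk_sym; apply: cong_sym; apply: bbk_cong2.
Qed.

(** Vectors of different blocks stay orthogonal modulo 2 under the pullback, to which only the
    blocks j and j + 1 contribute modulo 2. *)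
Lemma near_adjacent j x y : supp j x -> supp j.+1 y ->
  even (bbk j (E *m x) (E *m y) + bbk j.+1 (E *m x) (E *m y)).
Proof.
move=> hx hy; have := bf_pullback2 E (leqnSn j) hx hy.
rewrite big_ltn // big_nat1 => /cong_sym h.
apply: (cong0 h); apply: (cong0 (near_bf y hx)).
by rewrite (bbk_diff _ hy) ?rpred0 // ltn_eqF.
Qed.

Lemma near_adjacent2 j x y : supp j x -> supp j.+2 y ->
  even (bbk j (E *m x) (E *m y) + bbk j.+1 (E *m x) (E *m y)
        + bbk j.+2 (E *m x) (E *m y)).
Proof.
move=> hx hy; have := bf_pullback2 E (ltnW (ltnW (leqnn j.+2))) hx hy.
rewrite big_ltn; last by lia.
rewrite big_ltn // big_nat1 addrA => /cong_sym h.
apply: (cong0 h); apply: (cong0 (near_bf y hx)).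
by rewrite (bbk_diff _ hy) ?rpred0 // ltn_eqF.
Qed.

Lemma near_cross_char k x :
  even (bbk k (E *m x) (E *m x) - bbk k (E *m blk k u) (E *m x)).
Proof.
apply: cong_trans (char_vecP G k _) (cong_sym _).
by apply: bbk_cong2 => c; apply: near_char.
Qed.

Lemma even_add_sub (r s : Zp) : even (r + s) -> even (r - s).
Proof.
move=> h; have -> : r - s = r + s - 2%:R * s by padic_ring two_pr.
by rewrite rpredB // dvMr ?dv_refl.
Qed.

(** The square in block j + 1 is linear modulo 2, being the product with the image of the
    characteristic vector; orthogonality then carries this product over to block j. *)
Lemma near_cross_next j x : supp j x ->
  even (bbk j.+1 (E *m x) (E *m x) - bbk j (E *m blk j.+1 u) (E *m x)).
Proof.
move=> hx; apply: cong_trans (near_cross_char _ _) _.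
rewrite bbk_sym [bbk j _ _]bbk_sym; apply: even_add_sub; rewrite addrC.
exact: near_adjacent (@blk_supp _ _ _ G _ _).
Qed.

Lemma near_cross_prev j x : supp j.+1 x ->
  even (bbk j (E *m x) (E *m x) - bbk j.+1 (E *m blk j u) (E *m x)).
Proof.
move=> hx; apply: cong_trans (near_cross_char _ _) _.
by apply: even_add_sub; apply: near_adjacent => //; apply: blk_supp.
Qed.

Lemma near_ublk k : bbk k (E *m blk k u) (E *m blk k u) - bbk k u u
  \in dv (2%:R * (2%:R * 2%:R) : Zp).
Proof. by apply: bbk_sq_char => c; apply: near_char. Qed.

Definition neighbor_vec i : vec := E *m blk i.-1 u + E *m blk i.+1 u.

Lemma bf_pullback4 i x : (0 < i)%N -> supp i x ->
  bf (P E) x x - (bbk i (E *m x) (E *m x) + 2%:R * bbk i (neighbor_vec i) (E *m x))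
    \in dv (2%:R * 2%:R : Zp).
Proof.
move=> i0 hx; have := dv_mulr (bf_pullback8 E i0 hx); set T := (X in bf _ _ _ - X).
move=> h; apply: cong_trans h _; rewrite {}/T.
have /dvP[r rE] := near_cross_next hx.
have [s sE] : exists s : Zp, bbk i.-1 (E *m x) (E *m x) = bbk i (E *m blk i.-1 u) (E *m x) + 2%:R * s.
  case: i i0 hx {rE} => // i _ hx; have /dvP[s sE] := near_cross_prev hx.
  by exists s; rewrite -sE addrC subrK.
have {}rE : bbk i.+1 (E *m x) (E *m x) = bbk i (E *m blk i.+1 u) (E *m x) + 2%:R * r.
  by rewrite -rE addrC subrK.
rewrite rE sE /neighbor_vec bfDl.
set X1 := bbk _ _ _; set X2 := bbk _ _ _; set X3 := bbk _ _ _; set X4 := bbk _ _ _.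
set X5 := bbk _ _ _.
apply/dvP; exists (r + s + X4 + X5).
by padic_ring two_pr.
Qed.

(** In F_5 the element 2 is a primitive fourth root of unity, and powers of 2 are invertible.
    Characters of Z/4 and their Gauss sums can thus live in a finite field. *)
Definition quartic_char (r : Zp) : 'F_5 := 2%:R ^+ residue r 2.

Lemma quartic_charD r s : quartic_char (r + s) = quartic_char r * quartic_char s.
Proof.
have e : (2%:R : 'F_5) ^+ 4 = 1 by apply/eqP.
by rewrite /quartic_char residue_add -[(2 ^ 2)%N]/(4%N) expr_mod // exprD.
Qed.

Lemma quartic_char_eq1 r : (quartic_char r == 1) = (r \in dv (2%:R * 2%:R : Zp)).
Proof.
rewrite -expr2; apply/idP/dvXP; last by rewrite /quartic_char => ->.
rewrite /quartic_char; have := residue_lt r 2.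
by case: (residue r 2) => [|[|[|[|]]]].
Qed.

Lemma quartic_char_cong r s : r - s \in dv (2%:R * 2%:R : Zp) ->
  quartic_char r = quartic_char s.
Proof.
rewrite -quartic_char_eq1 => /eqP h.
by rewrite -[r](subrK s) quartic_charD h mul1r.
Qed.

Lemma quartic_char_neq0 r : quartic_char r != 0.
Proof. by rewrite expf_neq0. Qed.

(** Preservation modulo 4 equates the Gauss sum of the block with that of its translate by w, which
    forces b_i(w, w) to vanish modulo 4. *)
Lemma near_gauss i : (0 < i)%N ->
    (forall a, lam a = i -> P E a a - B a a \in dv (2%:R * 2%:R : Zp)) ->
  bbk i (neighbor_vec i) (neighbor_vec i) \in dv (2%:R * 2%:R : Zp).
Proof.
move=> i0 E_diag; set w := neighbor_vec i.
have Drel x : bbk i (diag_blk *m x) (diag_blk *m x) + 2%:R * bbk i (diag_blk *m x) w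
    - bbk i x x \in dv (2%:R * 2%:R : Zp).
  have hx : supp i (blk i x) by apply: blk_supp.
  have bb y : bbk i (diag_blk *m x) y = bbk i (E *m blk i x) y.
    rewrite -bbk_blkl -[RHS]bbk_blkl; congr bf; apply/matrixP => c o.
    rewrite !(ord1 o) [LHS]mxE [RHS]mxE; case: ifP => // /eqP ci.
    by rewrite (diag_blkE _ ci).
  have -> : bbk i (diag_blk *m x) (diag_blk *m x) = bbk i (E *m blk i x) (E *m blk i x).
    by rewrite bb bbk_sym bb.
  have -> : bbk i (diag_blk *m x) w = bbk i w (E *m blk i x) by rewrite bb bbk_sym.
  apply: cong_trans (cong_sym (bf_pullback4 i0 hx)) _.
  rewrite -(bbk_blkl G i x) -(bbk_blkr G i _ x) -(bf_gm_blk _ hx) -bfBX.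
  apply: (bf_diag_dv _ hx) => [|a b ai bi ab|a ai]; last first.
  - by have := E_diag a ai; rewrite !mxE.
  - exact: E_near.
  rewrite linearB /= (gm_sym G); congr (_ - _); apply/matrixP => a b; rewrite mxE.
  by rewrite (pullback_sym (gm_sym G) (@gm_block _ _ _ G)).
(* The sum runs over all of F_2^n, so the coordinates outside block i form the radical of [beta];
   [chi] is 1 there, as [gauss_isotropic] demands. *)
pose lift (x : 'cV['F_2]_n) : vec := \col_c (x c 0 : nat)%:R.
pose red (y : vec) : 'cV['F_2]_n := map_mx (@to_Fp 2 two_pr) y.
have liftK (s : 'cV['F_2]_n) : red (lift s) = s.
  by apply/matrixP => c o; rewrite !mxE (ord1 o); apply: to_Fp_lift.
have redP y : forall c, even (lift (red y) c 0 - y c 0).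
  move=> c; rewrite -to_Fp_eq0 raddfB /= subr_eq0; apply/eqP.
  by rewrite [lift _ c 0]mxE to_Fp_lift mxE.
pose chi (x : 'cV['F_2]_n) := quartic_char (bbk i (lift x) (lift x)).
pose beta (x y : 'cV['F_2]_n) := quartic_char (2%:R * bbk i (lift x) (lift y)).
have chiE y : chi (red y) = quartic_char (bbk i y y).
  by apply: quartic_char_cong; apply: bbk_sq_cong => c _; apply: redP.
have betaE y z : beta (red y) (red z) = quartic_char (2%:R * bbk i y z).
  apply: quartic_char_cong; rewrite -mulrBr dvM ?dv_refl //.
  apply: cong_trans (bbk_cong2 _ _) _; first by move=> c _; apply: redP.
  rewrite bbk_sym [X in _ - X]bbk_sym; apply: bbk_cong2.
  by move=> c _; apply: redP.
pose g (s : 'cV['F_2]_n) := red (diag_blk *m lift s).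
have : chi (red w) = 1.
  apply: (@gauss_isotropic _ _ chi beta g).
  - by rewrite card_mx muln1 card_Fp // natrX expf_neq0.
  - by move=> x; apply: quartic_char_neq0.
  - move=> x y; rewrite -(liftK x) -(liftK y) -map_mxD !chiE betaE -!quartic_charD.
    congr quartic_char; rewrite bbk_sqrD; move: (bbk i _ _) (bbk i _ _) (bbk i _ _) => q1 q2 q3.
    by padic_ring two_pr.
  - move=> x x' y; rewrite -(liftK x) -(liftK x') -(liftK y) -map_mxD !betaE -quartic_charD.
    by congr quartic_char; rewrite bfDl mulrDr.
  - by move=> x y; rewrite /beta bbk_sym.
  - move=> z zP; apply/eqP; rewrite quartic_char_eq1 -[X in X \in _]subr0.
    have z_even c : lam c = i -> even (lift z c 0 - (0 : vec) c 0).
      move=> ci; rewrite [X in _ - X]mxE subr0 -(bbk_coord _ ci) bbk_sym.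
      have := zP (red (iB *m delta_mx c 0)); rewrite -[z in beta _ z]liftK betaE.
      by move/eqP; rewrite quartic_char_eq1 dvMcancel ?two_Zp_neq0.
    have := bbk_sq_cong z_even; rewrite [bbk i 0 _](_ : _ = 0) //.
    by rewrite /bf trmx0 !mul0mx mxE.
  - move=> x y; rewrite /g /red !map_mxM /=.
    have := diag_blk_inv => h.
    have h2 : map_mx (@to_Fp 2 two_pr) (iB *m diag_blk^T *m B)
        *m map_mx (@to_Fp 2 two_pr) diag_blk = 1%:M.
      apply/eqP; rewrite -map_mxM -subr_eq0 -(map_mx1 (@to_Fp 2 two_pr)) -map_mxB.
      apply/eqP/matrixP => a b; rewrite mxE [RHS]mxE; apply/eqP.
      by rewrite to_Fp_eq0; apply: h.
    move/(congr1 (mulmx (map_mx (@to_Fp 2 two_pr) (iB *m diag_blk^T *m B)))).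
    rewrite !mulmxA h2 !mul1mx => e.
    by rewrite -(liftK x) -(liftK y) /red e.
  move=> x; rewrite /g chiE betaE -quartic_charD -[x in RHS]liftK chiE.
  exact/quartic_char_cong/Drel.
by rewrite chiE => /eqP; rewrite quartic_char_eq1.
Qed.

End NearE.
End Near.

(** * Reductions of the diagonal blocks *)

Section Base.
Variables (p : nat) (p_pr : prime p) (n M : nat) (G : jordan_gram p_pr n).
Variable fr : nat -> bool.
Local Notation Zp := (padic_int p_pr).
Local Notation pe := (p%:R : Zp).
Local Notation mat := 'M[Zp]_n.
Local Notation lam := (lam G).
Local Notation B := (gm G).
Local Notation P := (pullback lam B).
Local Notation bbk i := (bf (gm_blk G i)).
Local Notation dens := (@density p p_pr n M).
Implicit Types (E X Z : mat) (a b c d x y : 'I_n).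

Hypothesis M_large : forall a, (lam a + 3 <= M)%N.

Definition block_gram E a b := bbk (lam a) (E *m delta_mx a 0) (E *m delta_mx b 0).

Lemma mulmx_delta E a c : (E *m delta_mx a 0 : 'cV_n) c 0 = E c a.
Proof.
rewrite mxE (bigD1 a) //= big1 => [|d da].
  by rewrite !mxE !eqxx mulr1 addr0.
by rewrite !mxE (negPf da) mulr0.
Qed.

Lemma pullback_block E a b : lam a = lam b -> P E a b - block_gram E a b \in dv pe.
Proof.
move=> ab; rewrite /block_gram bfE pullbackE -sumrB rpred_sum // => c _.
rewrite -sumrB rpred_sum // => d _; rewrite !mulmx_delta !mxE.
have [cj|cj] := eqVneq (lam c) (lam a).
  rewrite (_ : gap lam a c b = 0%N); last by rewrite /gap cj ab; lia.
  by rewrite expr0 !mul1r subrr rpred0.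
rewrite mul0r mulr0 mul0r subr0 -!mulrA; apply: dvp_expl.
by rewrite /gap; lia.
Qed.

(** The diagonal modulus 2 p appears because q_j is half of b_j(x, x) and is taken modulo p. [fr]
    marks the blocks where q_j, and not only b_j, is to be preserved. *)
Definition base_block j E := forall a b, lam a = j -> lam b = j ->
  block_gram E a b - B a b \in dv pe /\
  (a = b -> fr j -> block_gram E a b - B a b \in dv (2%:R * pe)).

Definition base E := forall j, base_block j E.

Lemma base_block_cong j E E' :
  (forall a b, lam a = j -> lam b = j -> E' a b - E a b \in dv pe) ->
  base_block j E -> base_block j E'.
Proof.
move=> h hE a b aj bj; have [h1 h2] := hE a b aj bj.
have hc d : lam d = j -> forall c, lam c = lam a ->
    (E' *m delta_mx d 0 : 'cV_n) c 0 - (E *m delta_mx d 0 : 'cV_n) c 0 \in dv pe.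
  by move=> dj c ca; rewrite !mulmx_delta h // ca.
split=> [|ab frj].
  apply: cong_trans h1; rewrite /block_gram.
  apply: cong_trans (bbk_cong _ (hc _ aj)) _; rewrite bbk_sym [X in _ - X]bbk_sym.
  exact: bbk_cong _ (hc _ bj).
apply: cong_trans (h2 ab frj); rewrite -ab.
exact: bbk_sq_cong (hc _ aj).
Qed.

Lemma base_defect E a b : base E -> lam a = lam b -> defect G E a b \in dv pe.
Proof.
move=> h ab; apply: cong_trans (pullback_block E ab) _.
by have [] := h (lam a) a b erefl (esym ab).
Qed.

Lemma base_move E E' :
  (forall a b, lam a = lam b -> E' a b - E a b \in dv pe) -> base E -> base E'.
Proof.
move=> h hE j; apply: base_block_cong (hE j) => a b aj bj.
by apply: h; rewrite aj bj.
Qed.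

Lemma base_stable : stable (fun _ _ => M) base.
Proof.
move=> E E' h; apply: base_move => a b _; rewrite -opprB rpredN -[pe]expr1.
by apply: dvX (h a b); have := M_large a; lia.
Qed.

Definition base_off E :=
  base E /\ forall a b, lam a != lam b -> defect G E a b \in dv pe.

Lemma density_base_off :
  dens base_off = dens base / p%:R ^+ size (offblock_pairs G).
Proof.
apply: density_offblock => //; first exact: base_stable.
- exact: base_defect.
- exact: base_move.
Qed.

Lemma base_off_near E : base_off E -> mdv pe (P E - B).
Proof.
move=> [h1 h2] a b.
have -> : (P E - B) a b = defect G E a b by rewrite mxE [X in _ + X]mxE.
by have [/(base_defect h1)//|/h2//] := eqVneq (lam a) (lam b).
Qed.

Lemma base_off_stable : stable (fun _ _ => M) base_off.
Proof.
move=> E E' h [h1 h2]; split; first exact: base_stable h1.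
move=> a b ab; apply: (defect_stable h) (h2 _ _ ab).
by rewrite -[pe ^+ M]mulr1; apply: dvp_expl; have := M_large a; lia.
Qed.

Lemma base_off_level1 E : p <> 2%N -> (forall a, fr (lam a)) ->
  base_off E <-> level G 0 1 E.
Proof.
move=> p2 frT; have minE k : (0 < k)%N -> minn k 1 = 1%N by lia.
split=> [h|h]; last first.
  have near : mdv pe (P E - B) by apply: (level_near (tau := 0)) h.
  have nearE a b : defect G E a b \in dv pe.
    by have := near a b; rewrite mxE [X in _ + X]mxE.
  split=> // j a b aj bj.
  have e : block_gram E a b - B a b \in dv pe.
    apply: cong_trans (nearE a b); apply: cong_sym; apply: pullback_block.
    by rewrite aj bj.
  by split=> // _ _; apply: dv2_odd.
have near := base_off_near h.
have nearE a b : defect G E a b \in dv pe.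
  by have := near a b; rewrite mxE [X in _ + X]mxE.
split=> [a b ab|a].
  by rewrite minE ?expr1 // /minlam leq_min !lam_gt0.
by rewrite subn0 minE ?lam_gt0 // expr1; apply: dv2_odd.
Qed.

End Base.

(** * The diagonal modulo 4 *)

Section PairMove.
Variables (two_pr : prime 2) (n M : nat) (G : jordan_gram two_pr n).
Local Notation Zp := (padic_int two_pr).
Local Notation mat := 'M[Zp]_n.
Local Notation vec := 'cV[Zp]_n.
Local Notation lam := (lam G).
Local Notation B := (gm G).
Local Notation iB := (gmV G).
Local Notation P := (pullback lam B).
Local Notation star := (star lam).
Local Notation quad := (quad_star lam).
Local Notation supp := (supp G).
Local Notation even x := (x \in dv (2%:R : Zp)).
Local Notation defect := (defect G).
Add Ring Z2_ring : (padic_ring_theory two_pr).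

Variables (i j : nat) (a1 : 'I_n) (s : vec).
Hypothesis a1i : lam a1 = i.
Hypothesis s_supp : supp j s.
Hypothesis ij : i != j.

(* To first order the move along this matrix changes P by a skew-symmetric matrix, so that
   only the quadratic term matters on the diagonal. *)
Definition pair_mx : mat :=
  delta_mx a1 0 *m s^T - (iB *m s) *m (B *m delta_mx a1 0 : vec)^T.

Local Notation Z := pair_mx.
Local Notation d := (i - j + (j - i))%N.

Lemma outer_mxE (v w : vec) x y : (v *m w^T) x y = v x 0 * w y 0.
Proof. by rewrite mxE big_ord1 [w^T _ _]mxE. Qed.

Lemma pair_mxE c e : Z c e = (c == a1)%:R * s e 0 - (iB *m s) c 0 * B e a1.
Proof.
have eB (X Y : mat) x y : (X - Y) x y = X x y - Y x y by rewrite !mxE.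
by rewrite eB !outer_mxE mulmx_delta [delta_mx _ _ _ _]mxE eqxx andbT.
Qed.

Lemma gmV_supp : supp j (iB *m s).
Proof.
move=> c ck; rewrite mxE big1 // => e _.
have [ej|/s_supp ->] := eqVneq (lam e) j; last by rewrite mulr0.
by rewrite gmV_block ?mul0r // ej.
Qed.

Lemma pair_mx_supp c e : Z c e != 0 ->
  (lam c = i /\ lam e = j) \/ (lam c = j /\ lam e = i).
Proof.
rewrite pair_mxE; have [ej|ej] := eqVneq (lam e) j.
  have [ca|ca] := eqVneq c a1; first by rewrite ca a1i ej; left.
  rewrite mul0r sub0r gm_block ?mulr0 ?oppr0 ?eqxx //.
  by rewrite ej a1i eq_sym.
rewrite (s_supp ej) mulr0 sub0r oppr_eq0 mulf_eq0 negb_or => /andP[cj ea].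
right; split; apply/eqP; first by apply: contraNT cj => /gmV_supp ->.
by rewrite -a1i; apply: contraNT ea => /gm_block ->.
Qed.

Lemma pair_admissible : admissible M (fun E => E + star E Z).
Proof.
apply: admissible_star => x y; rewrite starE rpred_sum // => c _.
have [->|xc] := eqVneq (Z x c) 0; first by rewrite mulr0 mul0r rpred0.
have [->|cy] := eqVneq (Z c y) 0; first by rewrite mulr0 rpred0.
rewrite -mulrA; apply: dvp_expl; rewrite /gap.
by case: (pair_mx_supp xc) (pair_mx_supp cy) ij => -[-> ->] [] [] //=; lia.
Qed.

Variable E : mat.
Hypothesis E_near : mdv (2%:R : Zp) (P E - B).

Let nearE a b : even (defect E a b).
Proof. by have := E_near a b; rewrite mxE [X in _ + X]mxE. Qed.

Lemma pair_block a b : lam a = lam b -> even ((E + star E Z) a b - E a b).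
Proof.
move=> ab; have -> : (E + star E Z) a b - E a b = star E Z a b.
  by move: (star E Z) => X; rewrite mxE; padic_ring two_pr.
rewrite starE rpred_sum // => c _.
have [->|cb] := eqVneq (Z c b) 0; first by rewrite mulr0 rpred0.
rewrite -mulrA; apply: dvp_expl; rewrite /gap.
by case: (pair_mx_supp cb) ij; rewrite ab => -[-> ->]; lia.
Qed.

Lemma gm_pair_mx a b : (B *m Z) a b + (B *m Z) b a = 0.
Proof.
have eB (X Y : mat) x y : (X - Y) x y = X x y - Y x y by rewrite !mxE.
have e x y : (B *m Z) x y = B x a1 * s y 0 - s x 0 * B y a1.
  by rewrite mulmxBr !mulmxA gmK mul1mx eB !outer_mxE !mulmx_delta.
by rewrite !e; padic_ring two_pr.
Qed.

Lemma pair_quad a b : (Z^T *m B *m Z) a b =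
  B a1 a1 * s a 0 * s b 0 + bf iB s s * B a a1 * B b a1.
Proof.
have e : (Z^T *m B *m Z) a b = bf B (Z *m delta_mx a 0) (Z *m delta_mx b 0).
  by rewrite bf_mulmx bf_delta.
have ZE x : Z *m delta_mx x 0 = s x 0 *: (delta_mx a1 0 : vec) + (- B x a1) *: (iB *m s).
  have eD (v w : vec) y : (v + w) y 0 = v y 0 + w y 0 by rewrite mxE.
  have eZ (k : Zp) (v : vec) y : (k *: v) y 0 = k * v y 0 by rewrite mxE.
  apply/matrixP => y o; rewrite (ord1 o) mulmx_delta pair_mxE eD !eZ.
  by rewrite [delta_mx _ _ _ _]mxE eqxx andbT; padic_ring two_pr.
rewrite e !ZE !(bfDl, bfDr, bfZl, bfZr) bf_delta.
have sa1 : s a1 0 = 0 by apply: s_supp; rewrite a1i.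
have e1 : bf B (delta_mx a1 0) (iB *m s) = 0.
  by rewrite /bf -mulmxA (mulmxA B) gmK mul1mx trmx_delta -rowE mxE.
rewrite e1 (bf_tr B (iB *m s)) (gm_sym G) e1.
have -> : bf B (iB *m s) (iB *m s) = bf iB s s.
  by rewrite bf_mulmx gmV_sym gmVK mul1mx.
by padic_ring two_pr.
Qed.

(** The linear terms pass through entries of P(E) between different blocks, which are even, with
    weight 2^d for d the distance of the blocks; only the quadratic term is left modulo 2^(d+1). *)
Lemma pair_same a b : lam a = lam b ->
  defect (E + star E Z) a b - defect E a b
    - 2%:R ^+ d * (B a1 a1 * s a 0 * s b 0 + bf iB s s * B a a1 * B b a1)
  \in dv (2%:R * 2%:R ^+ d : Zp).
Proof.
move=> ab; rewrite defect_star -pair_quad.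
have hs x y : lam x = lam y -> star (P E) Z x y \in dv (2%:R * 2%:R ^+ d : Zp).
  move=> xy; rewrite starE rpred_sum // => c _.
  have [->|cy] := eqVneq (Z c y) 0; first by rewrite mulr0 rpred0.
  have xc : lam x != lam c.
    by case: (pair_mx_supp cy) ij; rewrite xy => -[-> ->]; lia.
  apply: dvMr; rewrite mulrC; apply: dvM.
    by have := nearE x c; rewrite !defect_diff (gm_block xc) subr0.
  rewrite (_ : gap lam x c y = d) ?dv_refl // /gap.
  by case: (pair_mx_supp cy) ij; rewrite xy => -[-> ->]; lia.
have hq : quad (P E) Z a b - 2%:R ^+ d * (Z^T *m B *m Z) a b \in dv (2%:R * 2%:R ^+ d : Zp).
  rewrite quad_starE [(Z^T *m B *m Z) a b]mxE mulr_sumr exchange_big /= -sumrB.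
  rewrite rpred_sum // => e _.
  rewrite [(Z^T *m B) a e]mxE mulr_suml mulr_sumr -sumrB rpred_sum // => c _.
  rewrite [Z^T a c]mxE; have [->|ca] := eqVneq (Z c a) 0.
    by rewrite !(mulr0, mul0r) subrr rpred0.
  have [->|eb] := eqVneq (Z e b) 0; first by rewrite !mulr0 subrr rpred0.
  rewrite (_ : gap2 lam a c e b = d); last first.
    rewrite /gap2.
    by case: (pair_mx_supp ca) (pair_mx_supp eb) ij; rewrite ab => -[-> ->] [] [-> ?]; lia.
  have -> : 2%:R ^+ d * Z c a * P E c e * Z e b - 2%:R ^+ d * (Z c a * B c e * Z e b)
    = defect E c e * 2%:R ^+ d * (Z c a * Z e b) by rewrite !defect_diff; padic_ring two_pr.
  by rewrite dvMr // dvM ?dv_refl.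
have -> : defect E a b + star (P E) Z a b + star (P E) Z b a + quad (P E) Z a b
    - defect E a b - 2%:R ^+ d * (Z^T *m B *m Z) a b
  = star (P E) Z a b + star (P E) Z b a
    + (quad (P E) Z a b - 2%:R ^+ d * (Z^T *m B *m Z) a b).
  move: (star (P E) Z) (quad (P E) Z) (Z^T *m B *m Z) => X Y W.
  by padic_ring two_pr.
by rewrite rpredD // rpredD // hs.
Qed.

(** For entries between different blocks the linear terms are, modulo 2, B Z and its transpose,
    which cancel because B Z is skew-symmetric. *)
Lemma pair_even a b : even (defect (E + star E Z) a b - defect E a b).
Proof.
have d_gt0 : (0 < d)%N by move: ij; lia.
have [ab|ab] := eqVneq (lam a) (lam b).
  have := dv_mull (pair_same ab) => h; apply: cong0 h _.
  exact: dvp_expl.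
rewrite defect_star.
have hq : even (quad (P E) Z a b).
  rewrite quad_starE rpred_sum // => c _; rewrite rpred_sum // => e _.
  have [->|ca] := eqVneq (Z c a) 0; first by rewrite mulr0 !mul0r rpred0.
  have [->|eb] := eqVneq (Z e b) 0; first by rewrite mulr0 rpred0.
  have ce : lam c != lam e.
    by case: (pair_mx_supp ca) (pair_mx_supp eb) ij ab => -[-> ->] [] [-> ->]; lia.
  apply: dvMr; apply: dvMl.
  by have := nearE c e; rewrite !defect_diff (gm_block ce) subr0.
have h1 := star_near Z a b E_near; have h2 := star_near Z b a E_near.
have e0 := gm_pair_mx a b.
move: h1 h2 hq e0; move: (star (P E) Z) (quad (P E) Z) (B *m Z) => X Y W h1 h2 hq e0.
have -> : defect E a b + X a b + X b a + Y a b - defect E a b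
  = (X a b - W a b) + (X b a - W b a) + Y a b + (W a b + W b a) by padic_ring two_pr.
by rewrite e0 addr0 rpredD // rpredD.
Qed.

End PairMove.

Section DiagonalLevel.
Variables (two_pr : prime 2) (n M : nat) (G : jordan_gram two_pr n).
Local Notation Zp := (padic_int two_pr).
Local Notation mat := 'M[Zp]_n.
Local Notation vec := 'cV[Zp]_n.
Local Notation lam := (lam G).
Local Notation B := (gm G).
Local Notation iB := (gmV G).
Local Notation P := (pullback lam B).
Local Notation star := (star lam).
Local Notation bbk i := (bf (gm_blk G i)).
Local Notation blk := (blk G).
Local Notation supp := (supp G).
Local Notation par := (par G).
Local Notation u := (char_vec G).
Local Notation even x := (x \in dv (2%:R : Zp)).
Local Notation defect := (defect G).
Local Notation dens := (@density 2 two_pr n M).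
Implicit Types (E X : mat) (x y z w v : vec) (a b c d : 'I_n) (i j k : nat).
Add Ring Z2_ring : (padic_ring_theory two_pr).

Variable tau : nat.
Hypothesis M_large : forall a, (lam a + 3 <= M)%N.

(** Block 0 contributes no indices, so [par 0] is false; the parity of L_0 comes in for j = 1
    through [tau]. *)
Definition free_block j :=
  [&& ~~ par j.-1, ~~ par j.+1 & ~~ ((j == 1%N) && (tau == 1%N))].

Lemma free_block_def j :
  free_block j = [&& ~~ par j.-1, ~~ par j.+1 & ~~ ((j == 1%N) && (tau == 1%N))].
Proof. by []. Qed.

(** One index per odd block, the first at which the characteristic vector has an odd coordinate. The
    value on the characteristic vector can replace the diagonal entry at this index. *)
Definition special a := (iB a a \notin dv (2%:R : Zp)) &&
  [forall c, (lam c == lam a) && (iB c c \notin dv (2%:R : Zp)) ==> (a <= c)%N].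

Lemma special_odd a : special a -> iB a a \notin dv (2%:R : Zp).
Proof. by case/andP. Qed.

Lemma special_exists j : par j -> exists2 a, lam a = j & special a.
Proof.
move=> /parP[a0 a0j a0odd].
pose Q a := (lam a == j) && (iB a a \notin dv (2%:R : Zp)).
have Q0 : Q a0 by rewrite /Q a0j eqxx.
case: (@arg_minnP _ a0 Q (fun a : 'I_n => a : nat) Q0) => a /andP[/eqP aj aodd] amin.
exists a => //; rewrite /special aodd /=; apply/forallP => c; apply/implyP => h.
by apply: amin; rewrite /Q -aj.
Qed.

Lemma special_uniq a b : special a -> special b -> lam a = lam b -> a = b.
Proof.
move=> /andP[ao /forallP ha] /andP[bo /forallP hb] ab; apply/val_inj/eqP.
rewrite eqn_leq; have := ha b; rewrite ab eqxx bo /= => ->.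
by have := hb a; rewrite ab eqxx ao.
Qed.

Lemma special_par a : special a -> par (lam a).
Proof.
move=> /special_odd ao; apply: contrapT => /negP h.
by rewrite (par_char h erefl) in ao.
Qed.

Lemma blk_char_even j : ~~ par j -> exists t, blk j u = 2%:R *: t.
Proof.
move=> pj; have h c : exists r : Zp, blk j u c 0 = 2%:R * r.
  rewrite mxE; case: eqVneq => [cj|_]; last by exists 0; rewrite mulr0.
  by apply/dvP; rewrite char_vecE (par_char pj).
exists (\col_c projT1 (cid (h c))); apply/matrixP => c o.
by rewrite (ord1 o) !mxE; case: (cid (h c)) => r /= <-; rewrite !mxE.
Qed.

(* The value on the characteristic vector decides the last diagonal entry once all the other
   entries are small. *)
Lemma recover_special (k : Zp) X j a0 : X^T = X -> lam a0 = j -> k != 0 ->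
    iB a0 a0 \notin dv (2%:R : Zp) ->
    (forall a b, lam a = j -> lam b = j -> a != b -> X a b \in dv k) ->
    (forall a, lam a = j -> a != a0 -> X a a \in dv (2%:R * k)) ->
    X a0 a0 \in dv k ->
    bf X (blk j u) (blk j u) \in dv (2%:R * k) ->
  X a0 a0 \in dv (2%:R * k).
Proof.
move=> Xs a0j k0 odd0 hoff hdiag /dvP[r rE] hu.
pose Y : mat := \matrix_(a, b) (if (a == a0) && (b == a0) then 0 else X a b).
have Ys : Y^T = Y.
  by apply/matrixP => a b; rewrite !mxE andbC; case: ifP => // _; rewrite -{1}Xs mxE.
have hY : bf Y (blk j u) (blk j u) \in dv (2%:R * k).
  apply: (bf_diag_dv Ys (@blk_supp _ _ _ G j u)) => [a b aj bj ab|a aj]; rewrite mxE.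
    by case: ifP => _; rewrite ?rpred0 ?hoff.
  by have [->|aa0] := eqVneq a a0; rewrite ?rpred0 //= hdiag.
have XE : bf X (blk j u) (blk j u) = bf Y (blk j u) (blk j u)
    + iB a0 a0 * iB a0 a0 * (k * r).
  have XD : X = Y + X a0 a0 *: (delta_mx a0 0 *m (delta_mx a0 0 : vec)^T).
    apply/matrixP => a b; rewrite [RHS]mxE [X in _ = _ + X]mxE outer_mxE !mxE !eqxx !andbT.
    by case: eqVneq => [->|_]; case: eqVneq => [->|_]; rewrite /= ?mulr1 ?mulr0 ?mul0r ?mulr0 ?addr0 ?add0r.
  rewrite {1}XD bfDX bfZX rE [RHS]addrC [LHS]addrC; congr (_ + _); rewrite mulrC; congr (_ * _).
  rewrite /bf !mulmxA -mulmxA mxE big_ord1 -colE mxE trmx_delta -rowE.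
  by rewrite !mxE a0j eqxx.
have : iB a0 a0 * iB a0 a0 * r \in dv 2%:R.
  rewrite -(dvMcancel _ _ k0); have := rpredB hu hY; rewrite XE addrC addKr.
  by rewrite mulrCA [k * 2%:R]mulrC.
rewrite rE [2%:R * k]mulrC dvMcancel // !dvpM.
by rewrite (negPf odd0).
Qed.

(** Blocks are handled from the top index downwards, since the automatic congruence at the start of
    a run is deduced from those of all higher blocks. *)
Definition dlevel j E := base_off G free_block E /\
  forall a, (j <= lam a)%N -> (tau < lam a)%N -> defect E a a \in dv (2%:R * 2%:R).

Lemma M_dv8 a : 2%:R ^+ M \in dv (2%:R * (2%:R * 2%:R) : Zp).
Proof.
have M3 : (3 <= M)%N by have := M_large a; lia.
by rewrite -(subnKC M3) exprD dvMr // !exprS expr0 mulr1 dv_refl.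
Qed.

Lemma dlevel_stable j : stable (fun _ _ => M) (dlevel j).
Proof.
move=> E E' h [h1 h2]; split; first exact: (base_off_stable M_large h).
move=> a ja ta; apply: (defect_stable h) (h2 _ ja ta).
exact: dv_mulr (M_dv8 a).
Qed.

Lemma dlevel_near j E : dlevel j E -> mdv (2%:R : Zp) (P E - B).
Proof. by case=> h _; apply: base_off_near h. Qed.

Lemma defectE E a b : (P E - B) a b = defect E a b.
Proof. by rewrite mxE [X in _ + X]mxE. Qed.

Lemma defect_tr E : (P E - B)^T = P E - B.
Proof. by apply/matrixP => a b; rewrite mxE !defectE defect_sym. Qed.

Lemma base_off_pair i j a1 (s : vec) E : lam a1 = i -> supp j s -> i != j ->
  base_off G free_block E ->
  base_off G free_block (E + star E (pair_mx G a1 s)).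
Proof.
move=> a1i hs ij hE; have near := base_off_near hE; case: hE => h1 h2; split.
  by apply: base_move h1 => a b ab; apply: (pair_block a1i hs ij).
move=> a b ab; apply: cong0 (pair_even a1i hs ij near a b) _; exact: h2.
Qed.

(** Pairing block j with an adjacent odd block shifts the diagonal of block j by 2 s_c^2, hence by 2
    s_c, modulo 4. The partner block moves by multiples of 2 [bf iB s s]; this must be even when the
    partner is j + 1, whose congruences are already imposed. *)
Lemma density_diag_moves j i a1 (s0 : seq 'I_n) : uniq s0 ->
    lam a1 = i -> B a1 a1 \notin dv (2%:R : Zp) -> (i.+1 = j \/ i = j.+1) ->
    (forall a, a \in s0 -> lam a = j) ->
    (forall a (v : Zp), a \in s0 -> exists s : vec,
       [/\ supp j s, forall c, c \in s0 -> even (s c 0 - v * (c == a)%:R)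
         & i = j.+1 -> even (bf iB s s)]) ->
  dens (fun E => dlevel j.+1 E /\ forall a, a \in s0 -> defect E a a \in dv (2%:R * 2%:R))
  = dens (dlevel j.+1) / 2%:R ^+ size s0.
Proof.
move=> s0u a1i oddB adj s0j mv; have ij : i != j by case: adj; lia.
have d1 : (i - j + (j - i) = 1)%N by case: adj; lia.
rewrite -(@density_seq 2 two_pr n M _ s0 (dlevel j.+1)
  (fun a E => defect E a a) (fun=> 2%:R)) //.
- by move=> _; apply: two_Zp_neq0.
- by move=> a _; apply: dv_mulr (M_dv8 a).
- exact: dlevel_stable.
- by move=> a E E' h; apply: defect_cont.
- by move=> E a _ /dlevel_near/(_ a a); rewrite defectE.
move=> s1 a s2 sE v; have as0 : a \in s0 by rewrite sE mem_cat inE eqxx orbT.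
have [s [hs sv qs]] := mv a v as0.
pose Z := pair_mx G a1 s; exists (fun E => E + star E Z).
  exact: (pair_admissible a1i hs ij).
move=> E hE _; have near := dlevel_near hE.
have dE c : defect (E + star E Z) c c - defect E c c
    - 2%:R * (B a1 a1 * s c 0 * s c 0 + bf iB s s * B c a1 * B c a1)
    \in dv (2%:R * 2%:R : Zp).
  by have := pair_same a1i hs ij near (erefl (lam c)); rewrite d1 expr1.
have dj c : c \in s0 -> defect (E + star E Z) c c - defect E c c
    - 2%:R * (v * (c == a)%:R) \in dv (2%:R * 2%:R : Zp).
  move=> cs0; apply: cong_trans (dE c) _.
  have -> : B c a1 = 0 by apply: gm_block; rewrite (s0j c cs0) a1i eq_sym.
  rewrite mulr0 addr0.
  rewrite -mulrBr dvM ?dv_refl //; apply: cong_trans (sv c cs0).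
  have -> : B a1 a1 * s c 0 * s c 0 - s c 0 = (B a1 a1 - 1) * (s c 0 * s c 0)
    + (s c 0 * s c 0 - s c 0) by padic_ring two_pr.
  by rewrite rpredD ?dv2_sqr // dvMr // -dv2N.
split.
- case: hE => h1 h2; split; first exact: (base_off_pair a1i hs ij).
  move=> c jc tc; apply: cong0 (h2 c jc tc); apply: cong0 (dE c) _.
  rewrite (hs c) ?mulr0 ?add0r; last by lia.
  have [ci|ci] := eqVneq (lam c) i; last first.
    have -> : B c a1 = 0 by apply: gm_block; rewrite a1i.
    by rewrite !mulr0 rpred0.
  rewrite dvM ?dv_refl // !dvMr // qs //.
  by case: adj => // adj; move: jc; rewrite ci -adj; lia.
- move=> c cs1; have cs0 : c \in s0 by rewrite sE mem_cat cs1.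
  have ca : c != a.
    move: s0u; rewrite sE cat_uniq /= negb_or => /and3P[_ /andP[nac _] _].
    by apply: contraNneq nac => <-.
  by have := dj c cs0; rewrite (negPf ca) !mulr0 subr0.
by have := dj a as0; rewrite eqxx mulr1.
Qed.

Section Automatic.
Variable E : mat.
Hypothesis E_near : mdv (2%:R : Zp) (P E - B).

(** The neighbours are even lattices, so their weight-2 contributions vanish modulo 4, and the
    congruence is the one already contained in [base]. *)
Lemma free_defect a : base G free_block E -> free_block (lam a) ->
  defect E a a \in dv (2%:R * 2%:R : Zp).
Proof.
move=> h fa; have [_ /(_ erefl fa) h2] := h _ a a erefl erefl.
apply: cong_trans h2; have := dv_mulr (bf_pullback8 E (lam_gt0 G a) (@delta_supp _ _ _ G a)).
rewrite bf_delta -/(block_gram G E a a) => h8.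
case/and3P: fa => p1 p2 _.
have /dvP[r1 e1] := par_even (E *m delta_mx a 0) p1.
have /dvP[r2 e2] := par_even (E *m delta_mx a 0) p2.
rewrite e1 e2 in h8; apply: cong_trans h8 _.
set q1 := bf _ _ _; set q2 := bf _ _ _; set q3 := block_gram _ _ _ _.
apply/dvP; exists (r1 + r2 + q1 + q2).
by padic_ring two_pr.
Qed.

(* The mod 2 values of the adjacent off-diagonal blocks of [E] on the        *)
(* characteristic vectors.                                                  *)
Definition char_prev k := bbk k (E *m blk k.-1 u) (E *m blk k.-1 u).
Definition char_next k := bbk k (E *m blk k.+1 u) (E *m blk k.+1 u).

Lemma bbk_char_fix k x : even (bbk k x (E *m blk k u) - bbk k x x).
Proof.
apply: cong_trans (cong_sym (char_vecP G k x)); rewrite bbk_sym.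
by apply: bbk_cong2 => c; apply: near_char.
Qed.

(** The image of u_k under the diagonal block is again characteristic, so the products with
    [neighbor_vec] become the squares [char_prev] and [char_next] modulo 2. *)
Lemma char_defect4 k : (0 < k)%N ->
  bf (P E - B) (blk k u) (blk k u) - 2%:R * (char_prev k + char_next k)
    \in dv (2%:R * 2%:R : Zp).
Proof.
move=> k0; have hs := @blk_supp _ _ _ G k u.
have h1 := bf_pullback4 E_near k0 hs; have h2 := dv_mulr (near_ublk E_near k).
rewrite bfBX (bf_gm_blk _ hs) bbk_blkl bbk_blkr.
have /dvP[r1 e1] := bbk_char_fix k (E *m blk k.-1 u).
have /dvP[r2 e2] := bbk_char_fix k (E *m blk k.+1 u).
rewrite /neighbor_vec bfDl in h1; have h3 := rpredD h1 h2.
apply: cong0 (_ : _ - (r1 + r2) * (2%:R * 2%:R) \in _) _; last by rewrite dvMl ?dv_refl.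
move: e1 e2 h3; rewrite /char_prev /char_next.
set q1 := bf _ _ _; set q2 := bf _ _ _; set q3 := bf _ _ _; set q4 := bf _ _ _.
set q5 := bf _ _ _; set q6 := bf _ _ _; set q7 := bf _ _ _ => e1 e2 h3.
have -> : q5 - q7 - 2%:R * (q2 + q4) - (r1 + r2) * (2%:R * 2%:R)
  = q5 - (q6 + 2%:R * (q1 + q3)) + (q6 - q7) + 2%:R * ((q1 - q2) + (q3 - q4))
    - (r1 + r2) * (2%:R * 2%:R) by padic_ring two_pr.
rewrite e1 e2.
have -> : 2%:R * (2%:R * r1 + 2%:R * r2) = (r1 + r2) * (2%:R * 2%:R) by padic_ring two_pr.
by rewrite addrK.
Qed.

Lemma char_prev_next k : even (char_prev k.+1 - char_next k).
Proof.
apply: cong_trans (near_cross_next E_near (@blk_supp _ _ _ G k u)) _.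
exact: bbk_char_fix.
Qed.

Lemma char_next_large k : (M <= k)%N -> char_next k = 0.
Proof.
move=> Mk; rewrite /char_next bfE big1 // => c _; rewrite big1 // => d _.
rewrite [gm_blk _ _ _ _]mxE (_ : (lam c == k) = false) ?mul0r ?mulr0 ?mul0r //.
by apply: ltn_eqF; have := M_large c; lia.
Qed.

Lemma diag_defect4 k : (forall a, lam a = k -> defect E a a \in dv (2%:R * 2%:R : Zp)) ->
  bf (P E - B) (blk k u) (blk k u) \in dv (2%:R * 2%:R : Zp).
Proof.
move=> h; apply: (bf_diag_dv (defect_tr E) (@blk_supp _ _ _ G k u)).
  by move=> a b _ _ _; apply: E_near.
by move=> a ak; rewrite defectE h.
Qed.

(** Going down from infinity: the congruence on u_(j+1) equates [char_prev j.+1] with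
    [char_next j.+1] modulo 2, and the former agrees with [char_next j]. *)
Lemma char_next_even j :
    (forall a, (j < lam a)%N -> defect E a a \in dv (2%:R * 2%:R : Zp)) ->
  even (char_next j).
Proof.
move=> h; have [m jm] : exists m, (M <= j + m)%N by exists M; rewrite leq_addl.
elim: m j jm h => [|m IHm] j jm h.
  by rewrite char_next_large ?rpred0 // -[j]addn0.
have hn : even (char_next j.+1).
  by apply: IHm => [|a ja]; [rewrite addSnnS|apply: h; apply: ltnW].
have h1 := char_defect4 (ltn0Sn j).
have h2 : bf (P E - B) (blk j.+1 u) (blk j.+1 u) \in dv (2%:R * 2%:R : Zp).
  by apply: diag_defect4 => a aj; apply: h; rewrite aj.
have : even (char_prev j.+1 + char_next j.+1).
  rewrite -(dvMcancel _ _ (two_Zp_neq0 two_pr)).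
  have := rpredB h2 h1; rewrite opprB addrC -addrA.
  by rewrite addNr addr0.
move=> hs; apply: cong0 (cong_sym (char_prev_next j)) _.
by have := rpredB hs hn; rewrite addrK.
Qed.

(** Below an even block [char_prev] is even because u_(j-1) is divisible by 2, and [char_next] is
    even by the congruences above; nothing is left modulo 4. *)
Lemma run_start_defect j : (0 < j)%N -> ~~ par j.-1 ->
    (forall a, (j < lam a)%N -> defect E a a \in dv (2%:R * 2%:R : Zp)) ->
  bf (P E - B) (blk j u) (blk j u) \in dv (2%:R * 2%:R : Zp).
Proof.
move=> j0 pj h; apply: cong0 (char_defect4 j0) _; rewrite dvM ?dv_refl // rpredD //.
  have [t tE] := blk_char_even pj; rewrite /char_prev tE -scalemxAr bfZl.
  by rewrite dvMr ?dv_refl.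
exact: char_next_even.
Qed.

End Automatic.
End DiagonalLevel.

Section FirstLevel.
Variables (two_pr : prime 2) (n M : nat) (G : jordan_gram two_pr n).
Local Notation Zp := (padic_int two_pr).
Local Notation mat := 'M[Zp]_n.
Local Notation vec := 'cV[Zp]_n.
Local Notation lam := (lam G).
Local Notation B := (gm G).
Local Notation iB := (gmV G).
Local Notation P := (pullback lam B).
Local Notation supp := (supp G).
Local Notation par := (par G).
Local Notation defect := (defect G).
Local Notation dens := (@density 2 two_pr n M).
Implicit Types (E X : mat) (x y z w v : vec) (a b c d : 'I_n) (i j k : nat).
Add Ring Z2_ring : (padic_ring_theory two_pr).

Variable tau : nat.
Hypothesis tau_le1 : (tau <= 1)%N.
Hypothesis M_large : forall a, (lam a + 3 <= M)%N.
Local Notation free_block := (free_block G tau).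
Local Notation dlevel := (dlevel G tau).
Local Notation level := (level G tau).

Definition run_start j := [&& ~~ par j.-1, par j & par j.+1].

(* In a free block the congruence modulo 4 is part of [base]; at the start of a run of odd
   blocks the one at the special index follows from the others. *)
Definition diag_list j : seq 'I_n :=
  [seq a <- enum 'I_n | [&& lam a == j, (tau < j)%N, ~~ free_block j
                          & ~~ (run_start j && special G a)]].

Lemma scaled_delta_supp a (v : Zp) : supp (lam a) (v *: (delta_mx a 0 : vec)).
Proof. by move=> c ca; rewrite mxE (@delta_supp _ _ _ G) ?mulr0. Qed.

Lemma scaled_deltaE a (v : Zp) c : (v *: (delta_mx a 0 : vec)) c 0 = v * (c == a)%:R.
Proof. by rewrite !mxE eqxx andbT. Qed.

(** A bound block has an odd neighbour from which its diagonal can be moved, except for the special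
    entry at the start of a run. For j <= [tau] no congruence modulo 4 is required. *)
Lemma density_dlevel j : (0 < j)%N ->
  dens (dlevel j) = dens (dlevel j.+1) / 2%:R ^+ size (diag_list j).
Proof.
move=> j0.
have -> : dens (dlevel j) = dens (fun E => dlevel j.+1 E /\
    forall a, a \in diag_list j -> defect E a a \in dv (2%:R * 2%:R)).
  apply: density_ext => E; split=> [[h1 h2]|[[h1 h2] h3]].
    split; first by split=> // a ja; apply: h2; apply: ltnW.
    move=> a; rewrite mem_filter => /andP[/and4P[/eqP aj tj _ _] _].
    by apply: h2; rewrite aj.
  split=> // a ja ta; have near := base_off_near h1.
  have [ja'|aj] := ltnP j (lam a); first exact: h2.
  have {ja} aj : lam a = j by apply/eqP; rewrite eqn_leq aj ja.
  have [fj|fj] := boolP (free_block j).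
    by apply: free_defect; [exact: h1.1|rewrite aj].
  have in_list b : lam b = j -> ~~ (run_start j && special G b) -> b \in diag_list j.
    by move=> bj hb; rewrite mem_filter bj eqxx -{1}aj ta fj hb mem_enum.
  have [/andP[rj sa]|ha] := boolP (run_start j && special G a); last exact/h3/in_list.
  rewrite -defectE; apply: (recover_special (defect_tr G E) aj) => //.
  - exact: two_Zp_neq0.
  - exact: special_odd.
  - move=> b bj ba; rewrite defectE; apply/h3/in_list => //; rewrite rj /=.
    by apply: contraNN ba => sb; rewrite (special_uniq sa sb) // aj bj.
  - case/and3P: rj => pj _ _; apply: (run_start_defect M_large near j0 pj) => b jb.
    by apply: h2 => //; move: jb ta; rewrite aj => jb /ltn_trans; apply.
have [tj|tj] := boolP ((tau < j)%N && ~~ free_block j); last first.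
  have -> : diag_list j = [::].
    apply/eqP; rewrite -[_ == _]negbK -has_filter; apply/hasPn => a _.
    by apply: contra tj => /and4P[_ -> ->].
  by rewrite expr0 divr1; apply: density_ext => E; split=> [[]|].
have s_uniq : uniq (diag_list j) by rewrite filter_uniq ?enum_uniq.
have s_lam a : a \in diag_list j -> lam a = j.
  by rewrite mem_filter => /andP[/and4P[/eqP]].
case/andP: tj => tj fj.
(* An odd block below carries no diagonal congruence modulo 4 in [dlevel j.+1], so pairing with it
   has no side condition. *)
have [pj|pj] := boolP (par j.-1).
  have /existsP[a1 /andP[/eqP a1j oddB]] := pj.
  apply: (density_diag_moves tau M_large s_uniq a1j oddB) => //.
    by left; rewrite prednK.
  move=> a v /s_lam aj; exists (v *: delta_mx a 0); split.
  - by rewrite -aj; apply: scaled_delta_supp.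
  - by move=> c _; rewrite scaled_deltaE subrr rpred0.
  - by lia.
have pj1 : par j.+1.
  move: fj; rewrite free_block_def pj /= negb_and !negbK => /orP[//|/andP[/eqP e1 /eqP e2]].
  by move: tj; rewrite e1 e2.
have /existsP[a1 /andP[/eqP a1j oddB]] := pj1.
apply: (density_diag_moves tau M_large s_uniq a1j oddB) => //; first by right.
move=> a v as0; have aj := s_lam a as0.
have [pj0|pj0] := boolP (par j); last first.
  exists (v *: delta_mx a 0); split.
  - by rewrite -aj; apply: scaled_delta_supp.
  - by move=> c _; rewrite scaled_deltaE subrr rpred0.
  - by move=> _; rewrite bfZl bfZr bf_delta !dvMl // (par_char pj0 aj).
have [a0 a0j sa0] := special_exists pj0.
have nspec c : c \in diag_list j -> c != a0.
  rewrite mem_filter /run_start pj pj0 pj1 /= => /andP[/and4P[_ _ _ nc] _].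
  by apply: contraNneq nc => ->.
(* The correction at the special index makes [bf iB s s] congruent to v^2 (iB_aa + iB_aa^2), which
   is even; it only disturbs the entry at [a0], which is not in the list. *)
exists (v *: delta_mx a 0 + (v * iB a a) *: delta_mx a0 0); split.
- move=> c cj; rewrite mxE !scaled_delta_supp ?addr0 //; first by rewrite a0j.
  by rewrite aj.
- move=> c /nspec ca0; rewrite mxE !scaled_deltaE (negPf ca0) mulr0 addr0.
  by rewrite subrr rpred0.
move=> _; rewrite !(bfDl, bfDr) !(bfZl, bfZr) !bf_delta (gmV_symE G a0 a).
rewrite [X in X \in _](_ : _ = 2%:R * (v * v * iB a a * iB a a0)
   + v * v * (iB a a * iB a a * (iB a0 a0 - 1) + (iB a a * iB a a - iB a a)
      + 2%:R * iB a a)); last by padic_ring two_pr.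
apply: rpredD; first by rewrite dvMr ?dv_refl.
apply: dvMl; apply: rpredD; last by rewrite dvMr ?dv_refl.
apply: rpredD; last exact: dv2_sqr.
by apply: dvMl; rewrite -dv2N special_odd.
Qed.

Lemma density_dlevel1 :
  dens (dlevel 1) = dens (base_off G free_block)
    / 2%:R ^+ (\sum_(1 <= j < M) size (diag_list j)).
Proof.
suff h m : (0 < m)%N -> dens (dlevel 1) = dens (dlevel m)
    / 2%:R ^+ (\sum_(1 <= j < m) size (diag_list j)).
  have [M0|M0] := posnP M.
    rewrite M0 big_geq // expr0 divr1; apply: density_ext => E.
    by split=> [[]//|h1]; split=> // a; have := M_large a; rewrite M0; lia.
  rewrite (h M) //; congr (_ / _); apply: density_ext => E.
  by split=> [[]//|h1]; split=> // a; have := M_large a; lia.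
elim: m => // m IHm _; have [->|m0] := posnP m.
  by rewrite big_geq // expr0 divr1.
rewrite IHm // density_dlevel // big_nat_recr //= exprD invfM.
by rewrite -[LHS]mulrA; congr (_ * _); rewrite mulrC.
Qed.

Lemma dlevel1 E : dlevel 1 E -> level 1 E.
Proof.
move=> h; have near := dlevel_near h; case: h => h1 h2; split=> [a b ab|a].
  rewrite (_ : minn _ 1 = 1%N); last by have := lam_gt0 G a; have := lam_gt0 G b; rewrite /minlam; lia.
  by rewrite expr1 -defectE near.
have [ta|ta] := ltnP tau (lam a).
  rewrite (_ : minn _ 1 = 1%N) ?expr1; last by lia.
  by apply: h2; rewrite ?lam_gt0.
rewrite (_ : minn _ 1 = 0%N) ?expr0 ?mulr1; last by lia.
by rewrite -defectE near.
Qed.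

(** In a free block the congruence modulo 4 on the whole pullback gives back the one on the diagonal
    block alone. Hence [level 1] and [dlevel 1] coincide. *)
Lemma level1_base E : level 1 E -> base_off G free_block E.
Proof.
move=> h; have near := level_near tau_le1 (fun e => match e erefl with end) (ltn0Sn 0) h.
split=> [j a b aj bj|a b _]; last by rewrite -defectE near.
have h1 : block_gram G E a b - B a b \in dv (2%:R : Zp).
  apply: cong_trans (_ : _ - P E a b \in _) _; last by rewrite -[_ - _]defectE near.
  by apply: cong_sym; apply: pullback_block; rewrite aj bj.
split=> // ab fj; rewrite -ab.
have tj : (tau < lam a)%N.
  have := lam_gt0 G a; rewrite aj; case/and3P: fj => _ _.
  by case: (tau) tau_le1 => [|[|]] //; case: (j) => [|[|]].
have hd : defect E a a \in dv (2%:R * 2%:R : Zp).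
  by have := h.2 a; rewrite (_ : minn _ 1 = 1%N) ?expr1 //; lia.
apply: cong_trans hd.
have h8 := dv_mulr (bf_pullback8 E (lam_gt0 G a) (@delta_supp _ _ _ G a)).
rewrite bf_delta -/(block_gram G E a a) in h8.
case/and3P: fj; rewrite -aj => p1 p2 _.
have /dvP[r1 e1] := par_even (E *m delta_mx a 0) p1.
have /dvP[r2 e2] := par_even (E *m delta_mx a 0) p2.
rewrite e1 e2 in h8; apply: cong_trans (cong_sym h8).
set q1 := bf _ _ _; set q2 := bf _ _ _; set q3 := block_gram _ _ _ _.
apply/dvP; exists (- (r1 + r2 + q1 + q2)).
by padic_ring two_pr.
Qed.

Lemma dlevel1E E : dlevel 1 E <-> level 1 E.
Proof.
split=> [|h]; first exact: dlevel1.
split; first exact: level1_base.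
by move=> a _ ta; have := h.2 a; rewrite (_ : minn _ 1 = 1%N) ?expr1 //; lia.
Qed.

Lemma density_level1 : dens (level 1) = dens (base_off G free_block)
    / 2%:R ^+ (\sum_(1 <= j < M) size (diag_list j)).
Proof. by rewrite -density_dlevel1; apply: density_ext => E; rewrite dlevel1E. Qed.

End FirstLevel.

(** * The diagonal modulo 8 *)

Section OddityLevel.
Variables (two_pr : prime 2) (n M : nat) (G : jordan_gram two_pr n).
Local Notation Zp := (padic_int two_pr).
Local Notation mat := 'M[Zp]_n.
Local Notation vec := 'cV[Zp]_n.
Local Notation lam := (lam G).
Local Notation B := (gm G).
Local Notation iB := (gmV G).
Local Notation P := (pullback lam B).
Local Notation star := (star lam).
Local Notation bbk i := (bf (gm_blk G i)).
Local Notation blk := (blk G).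
Local Notation supp := (supp G).
Local Notation par := (par G).
Local Notation u := (char_vec G).
Local Notation even x := (x \in dv (2%:R : Zp)).
Local Notation defect := (defect G).
Local Notation dens := (@density 2 two_pr n M).
Implicit Types (E X : mat) (x y z w v : vec) (a b c d : 'I_n) (i j k : nat).
Add Ring Z2_ring : (padic_ring_theory two_pr).

Variable tau : nat.
Hypothesis tau_le1 : (tau <= 1)%N.
Hypothesis M_large : forall a, (lam a + 3 <= M)%N.
Local Notation level := (level G tau).
Local Notation cdef E k := (bf (P E - B) (blk k u) (blk k u)).

(** The congruences modulo 8 are first imposed on characteristic vectors only, since these values
    cannot be changed by moves congruent to the identity modulo 2. The bound on k selects the blocks
    whose diagonal must hold modulo 8 in the end. *)
Definition clevel j E := level 1 E /\
  forall k, (j <= k)%N -> (tau.+1 < k)%N -> cdef E k \in dv (2%:R * (2%:R * 2%:R)).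

Lemma level1_near E : level 1 E -> mdv (2%:R : Zp) (P E - B).
Proof. exact: (level_near tau_le1 (fun e => match e erefl with end) (ltn0Sn 0)). Qed.

Lemma level1_diag E a : level 1 E -> (tau < lam a)%N ->
  defect E a a \in dv (2%:R * 2%:R).
Proof. by move=> h ta; have := h.2 a; rewrite (_ : minn _ 1 = 1%N) ?expr1 //; lia. Qed.

Section Telescope.
Variable E : mat.
Hypothesis E_level : level 1 E.

Let E_near : mdv (2%:R : Zp) (P E - B). Proof. exact: level1_near. Qed.

Local Notation W := (char_next G E).
Local Notation V := (char_prev G E).
Definition char_next2 k := bbk k (E *m blk k.+2 u) (E *m blk k.+2 u).
Local Notation th := char_next2.
(** Half the contribution of the blocks k + 1 and k to the pulled-back square of u_(k+2). *)
Definition char_pot k := W k.+1 + 2%:R * th k.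
Local Notation X k := (bbk k (E *m blk k.-1 u) (E *m blk k.+1 u)).

Lemma level1_gauss k : (tau < k)%N ->
  V k + 2%:R * X k + W k \in dv (2%:R * 2%:R : Zp).
Proof.
move=> tk; have k0 : (0 < k)%N by apply: leq_ltn_trans tk.
have h a : lam a = k -> P E a a - B a a \in dv (2%:R * 2%:R : Zp).
  by move=> ak; apply: (level1_diag E_level); rewrite ak.
have := near_gauss E_near k0 h; rewrite /neighbor_vec bbk_sqrD.
by rewrite -[bf _ _ _ *+ 2]mulr_natl.
Qed.

Lemma char_prev2 k :
  even (bbk k.+2 (E *m blk k u) (E *m blk k u) - (th k + X k.+1)).
Proof.
have h1 := near_adjacent2 E_near (@blk_supp _ _ _ G k u) (@blk_supp _ _ _ G k.+2 u).
have h2 := near_cross_char E_near k.+2 (E *m blk k u).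
have h2' : even (bbk k.+2 (E *m blk k u) (E *m blk k u)
  - bbk k.+2 (E *m blk k u) (E *m blk k.+2 u)).
  by apply: cong_sym; apply: bbk_char_fix.
have h3 : even (bbk k (E *m blk k u) (E *m blk k.+2 u) - th k).
  by rewrite bbk_sym; apply: bbk_char_fix.
move: h1 h2' h3; rewrite /char_next2 /=.
set q1 := bf _ _ _; set q2 := bf _ _ _; set q3 := bf _ _ _; set q4 := bf _ _ _.
set q5 := bf _ _ _ => h1 h2' h3.
have -> : q4 - (q5 + q2) = (q1 + q2 + q3) + (q4 - q3) - (q1 - q5) - 2%:R * (q5 + q2).
  by padic_ring two_pr.
by rewrite rpredB ?dvMr ?dv_refl // rpredB // rpredD.
Qed.

(** The lower blocks contribute 2 [char_pot j.-2] by definition. For the upper ones, the Gauss sum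
    relation at j + 1 replaces [char_prev j.+1], and [char_prev2] the square in block j + 2; the
    mixed terms X cancel, leaving -2 [char_pot j]. *)
Lemma char_defect8 j : (1 < j)%N ->
  cdef E j - 2%:R * (char_pot j.-2 - char_pot j) \in dv (2%:R * (2%:R * 2%:R)).
Proof.
move=> j1; have j0 := ltnW j1; have hs := @blk_supp _ _ _ G j u.
have h1 := bf_pullback8 E j0 hs; have h2 := near_ublk E_near j.
have h3 := level1_gauss (leq_ltn_trans tau_le1 (ltnW j1 : (1 < j.+1)%N)).
have h4 := char_prev2 j.
rewrite bfBX (bf_gm_blk _ hs) bbk_blkl bbk_blkr /char_pot.
have e1 : bbk j.-2 (E *m blk j u) (E *m blk j u) = th j.-2.
  by rewrite /char_next2 !prednK // -ltnS prednK.
have e2 : bbk j.-1 (E *m blk j u) (E *m blk j u) = W j.-2.+1.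
  by rewrite /char_next !prednK // -ltnS prednK.
have e3 : bbk j.+1 (E *m blk j u) (E *m blk j u) = V j.+1 by [].
rewrite e1 e2 e3 in h1; move: h1 h2 h3 h4.
move: (th j) (th j.-2) (W j.-2.+1) (W j.+1) (V j.+1) => t1 t2 w1 w2 v1.
set q1 := bf _ _ _; set q2 := bf _ _ _; set q3 := bf _ _ _; set q4 := bf _ _ _.
set q5 := bf _ _ _ => h1 h2 h3 /dvP[r h4].
have {}h4 : q3 = t1 + q5 + 2%:R * r by rewrite -h4 addrC subrK.
have /dvP[r3 {}h3] := h3.
have -> : q1 - q4 - 2%:R * (w1 + 2%:R * t2 - (w2 + 2%:R * t1))
  = (q1 - (q2 + 2%:R * (w1 + v1) + 4%:R * (t2 + q3))) + (q2 - q4)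
    + 2%:R * (v1 + 2%:R * q5 + w2) + (2%:R * (2%:R * 2%:R)) * (t1 + r).
  by rewrite h4; padic_ring two_pr.
rewrite h3; apply: rpredD; last by rewrite dvMr ?dv_refl.
apply: rpredD; first exact: rpredD.
by rewrite mulrA dvMr ?dv_refl.
Qed.

Lemma char_pot_large k : (M <= k)%N -> char_pot k = 0.
Proof.
move=> Mk; have bbk0 i x y : (M <= i)%N -> bbk i x y = 0.
  move=> Mi; rewrite bfE big1 // => c _; rewrite big1 // => d _.
  rewrite [gm_blk _ _ _ _]mxE (_ : (lam c == i) = false) ?mul0r ?mulr0 ?mul0r //.
  by apply: ltn_eqF; have := M_large c; lia.
by rewrite /char_pot /char_next /char_next2 !bbk0 ?mulr0 ?addr0 // leqW.
Qed.

(** Telescoping in steps of two from infinity, where the potential is 0. *)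
Lemma char_pot_dv4 j : (tau <= j)%N ->
    (forall k, (j < k)%N -> (tau.+1 < k)%N -> cdef E k \in dv (2%:R * (2%:R * 2%:R))) ->
  char_pot j \in dv (2%:R * 2%:R).
Proof.
move=> tj h; have [m jm] : exists m, (M <= j + m)%N by exists M; rewrite leq_addl.
elim/ltn_ind: m j jm tj h => m IHm j jm tj h.
have [m0|m0] := posnP m; first by rewrite char_pot_large ?rpred0 //; move: jm; rewrite m0 addn0.
have hn : char_pot j.+2 \in dv (2%:R * 2%:R).
  have [m1|m1] := leqP m 1; first by rewrite char_pot_large ?rpred0 //; move: jm m1; lia.
  apply: (IHm m.-2); [lia|move: jm; lia|by do 2 apply: leqW|].
  by move=> k jk; apply: h; apply: ltn_trans jk.
have h1 := @char_defect8 j.+2 isT.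
have h2 := h j.+2 (leqnSn _) tj.
have : char_pot j - char_pot j.+2 \in dv (2%:R * 2%:R).
  rewrite -(dvMcancel _ _ (two_Zp_neq0 two_pr)).
  by have := rpredB h2 h1; rewrite opprB addrC subrK.
by move=> h3; apply: cong0 h3 hn.
Qed.

(** If L_j is even then u_j is divisible by 2. If L_(j-2) is even, then so is the square [th] taken
    in block j - 2; and as u_(j-2) is divisible by 2, the Gauss relation at j - 1 gives that [W] is
    0 modulo 4. So [char_pot j.-2] vanishes modulo 4. *)
Lemma clevel_auto j : (tau.+1 < j)%N -> ~~ (par j && par j.-2) ->
    (forall k, (j < k)%N -> (tau.+1 < k)%N -> cdef E k \in dv (2%:R * (2%:R * 2%:R))) ->
  cdef E j \in dv (2%:R * (2%:R * 2%:R)).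
Proof.
move=> tj; have j1 : (1 < j)%N by apply: leq_ltn_trans tj.
have [pj /= pj2|pj _ _] := boolP (par j); last first.
  have [t tE] := blk_char_even pj; rewrite tE bfZl bfZr dvM ?dv_refl // dvM ?dv_refl //.
  by apply: bf_mdv.
move=> h; apply: cong0 (char_defect8 j1) _; rewrite dvM ?dv_refl // rpredB //; last first.
  by apply: char_pot_dv4 h; apply: ltnW; apply: ltnW.
have [t tE] := blk_char_even pj2.
have [i ji] : exists i, j = i.+2 by exists j.-2; lia.
rewrite ji /= in tj pj2 tE *.
have hg := level1_gauss (tj : tau < i.+1)%N.
rewrite /char_pot rpredD //; last by rewrite dvM ?dv_refl // par_even.
apply: cong0 (_ : W i.+1 - (V i.+1 + 2%:R * X i.+1 + W i.+1) \in _) hg.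
rewrite /char_prev /= tE -scalemxAr !(bfZl, bfZr).
set q1 := bf _ _ _; set q2 := bf _ _ _; set q3 := W _.
apply/dvP; exists (- (q1 + q2)).
by padic_ring two_pr.
Qed.

End Telescope.

Lemma clevel_stable j : stable (fun _ _ => M) (clevel j).
Proof.
move=> E E' h [h1 h2]; split; first exact: (level_stable M_large tau_le1 (fun e => match e erefl with end) h h1).
move=> k jk tk; have -> : cdef E' k = cdef E k - bf (P E - P E') (blk k u) (blk k u).
  by rewrite !bfBX; padic_ring two_pr.
rewrite rpredB ?h2 //; apply: bf_mdv => a b.
apply: (dv_trans (M_dv8 M_large a)).
by apply: (pullback_cont lam B h).
Qed.

Lemma density_clevel j :
  dens (clevel j) = dens (clevel j.+1)
    / 2%:R ^+ [&& (tau.+1 < j)%N, par j & par j.-2].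
Proof.
have [/and3P[tj pj pj2]|] := boolP [&& (tau.+1 < j)%N, par j & par j.-2]; last first.
  move=> nj; rewrite expr0 divr1; apply: density_ext => E.
  split=> [[h1 h2]|[h1 h2]]; split=> //; first by move=> k jk; apply: h2; apply: ltnW.
  move=> k jk tk; move: jk; rewrite leq_eqVlt => /orP[/eqP jk|jk]; last exact: h2.
  rewrite -jk in tk *; apply: clevel_auto => //.
  by apply: contra nj => /andP[-> ->]; rewrite tk.
have j1 : (1 < j)%N by apply: leq_ltn_trans tj.
have -> : dens (clevel j) =
    dens (fun E => clevel j.+1 E /\ cdef E j \in dv (2%:R * 2%:R * 2%:R)).
  apply: density_ext => E; rewrite -mulrA; split=> [[h1 h2]|[[h1 h2] h3]].
    by split; [split=> // k jk; apply: h2; apply: ltnW|apply: h2].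
  split=> // k jk tk; move: jk; rewrite leq_eqVlt => /orP[/eqP <- //|jk]; exact: h2.
have /existsP[a1 /andP[/eqP a1j oddB]] := pj2.
have [a aj oddu] := parP pj.
rewrite expr1; apply: density_step.
- by rewrite mulf_neq0 ?two_Zp_neq0.
- by rewrite -mulrA; apply: (M_dv8 M_large a).
- exact: clevel_stable.
- move=> E E' h.
  have -> : cdef E j - cdef E' j = bf (P E - P E') (blk j u) (blk j u).
    by rewrite !bfBX; padic_ring two_pr.
  by apply: bf_mdv => x y; apply: (pullback_cont lam B h).
- move=> E [h1 _]; apply: (diag_defect4 (level1_near h1)) => b bj.
  by apply: level1_diag => //; rewrite bj ltnW.
(* The blocks j - 2 and j are at distance 2, so the pair move shifts the value on u_j by 4 B_(a1 a1)
   (v iB_aa)^2. Both matrix entries are odd, and this is 4 v modulo 8. *)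
move=> v; pose s : vec := v *: delta_mx a 0.
have hs : supp j s by rewrite -aj; apply: scaled_delta_supp.
have ij : j.-2 != j by lia.
have d2 : (j.-2 - j + (j - j.-2) = 2)%N by lia.
exists (fun E => E + star E (pair_mx G a1 s)); first exact: (pair_admissible a1j hs ij).
move=> E [h1 h2]; have near := level1_near h1.
set E' := E + _.
have dE (x y : 'I_n) : lam x = lam y -> defect E' x y - defect E x y
    - 2%:R * 2%:R * (B a1 a1 * s x 0 * s y 0 + bf iB s s * B x a1 * B y a1)
    \in dv (2%:R * (2%:R * 2%:R) : Zp).
  by move=> xy; have := pair_same a1j hs ij near xy; rewrite d2 expr2.
split; first split.
- split=> [x y xy|x].
    apply: cong0 (h1.1 x y xy).
    have := pair_even a1j hs ij near x y; apply: dv_trans.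
    rewrite -[X in X \in _]mulr1; have -> : (2%:R : Zp) = 2%:R ^+ 1 by rewrite expr1.
    by rewrite dvXr // geq_minr.
  have := h1.2 x; apply: cong0.
  have h4 : defect E' x x - defect E x x \in dv (2%:R * 2%:R : Zp).
    apply: cong0 (dv_mulr (dE x x erefl)) _.
    by rewrite dvMr ?dv_refl.
  apply: dv_trans h4; rewrite dvM ?dv_refl //.
  rewrite -[X in X \in _]mulr1; have -> : (2%:R : Zp) = 2%:R ^+ 1 by rewrite expr1.
  by rewrite dvXr // geq_minr.
- move=> k jk tk; apply: cong0 (h2 k jk tk).
  rewrite -bfBX; have -> : P E' - B - (P E - B) = P E' - P E.
    by rewrite opprB addrA subrK.
  apply: (bf_supp_dv (@blk_supp _ _ _ G k u) (@blk_supp _ _ _ G k u)) => x y xk yk.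
  have := dE x y; rewrite xk yk => /(_ erefl).
  rewrite (hs x) ?xk ?gtn_eqF // mulr0 mul0r add0r.
  have -> : B x a1 = 0 by apply: gm_block; rewrite xk a1j; lia.
  rewrite mulr0 mul0r mulr0 subr0.
  have -> : defect E' x y - defect E x y = (P E' - P E) x y.
    by rewrite !defect_diff; move: (P E') (P E) => Y Y'; rewrite !mxE; padic_ring two_pr.
  by [].
have -> : cdef E' j - cdef E j = bf (P E' - P E) (blk j u) (blk j u).
  by rewrite !bfBX; padic_ring two_pr.
have hB : even (B a1 a1 * iB a a * iB a a - 1).
  by rewrite -dv2N !dvpM (negPf oddB) (negPf oddu).
have hS : bf (P E' - P E - 2%:R * 2%:R *: (B a1 a1 *: (s *m s^T))) (blk j u) (blk j u)
    \in dv (2%:R * (2%:R * 2%:R) : Zp).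
  apply: (bf_supp_dv (@blk_supp _ _ _ G j u) (@blk_supp _ _ _ G j u)) => x y xk yk.
  have := dE x y; rewrite xk yk => /(_ erefl).
  have -> : B x a1 = 0 by apply: gm_block; rewrite xk a1j eq_sym.
  rewrite mulr0 mul0r addr0.
  set W := s *m s^T; have WE : W x y = s x 0 * s y 0 by apply: outer_mxE.
  have -> : (P E' - P E - 2%:R * 2%:R *: (B a1 a1 *: W)) x y
     = defect E' x y - defect E x y - 2%:R * 2%:R * (B a1 a1 * s x 0 * s y 0).
    rewrite -[B a1 a1 * _ * _]mulrA -WE.
    by rewrite !defect_diff; move: (P E') (P E) => Y Y'; rewrite !mxE; padic_ring two_pr.
  by [].
have hW : bf (s *m s^T) (blk j u) (blk j u) = v * iB a a * (v * iB a a).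
  rewrite /bf !mulmxA -mulmxA mxE big_ord1.
  have e1 : (s^T *m blk j u) 0 0 = v * iB a a.
    by rewrite /s linearZ /= -scalemxAl mxE trmx_delta -rowE !mxE aj eqxx.
  have e2 : ((blk j u)^T *m s) 0 0 = v * iB a a.
    by rewrite /s -scalemxAr mxE -colE !mxE aj eqxx.
  by rewrite -[X in X * _ = _]/(((blk j u)^T *m s) 0 0) e2 -e1.
rewrite bfBX !bfZX hW in hS.
have -> : 2%:R * 2%:R * 2%:R = 2%:R * (2%:R * 2%:R) :> Zp by rewrite mulrA.
apply: cong_trans hS _.
rewrite (_ : _ - _ = 2%:R * (2%:R * (v * v * (B a1 a1 * iB a a * iB a a - 1) + (v * v - v)))).
  by rewrite dvM ?dv_refl // dvM ?dv_refl // rpredD ?dv2_sqr // dvMl.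
by padic_ring two_pr.
Qed.

Lemma density_clevel0 :
  dens (clevel 0) = dens (level 1)
    / 2%:R ^+ (\sum_(0 <= j < M) [&& (tau.+1 < j)%N, par j & par j.-2]).
Proof.
suff h m : dens (clevel 0) = dens (clevel m)
    / 2%:R ^+ (\sum_(0 <= j < m) [&& (tau.+1 < j)%N, par j & par j.-2]).
  rewrite (h M); congr (_ / _); apply: density_ext => E.
  split=> [[]//|h1]; split=> // k Mk _.
  rewrite (_ : blk k u = 0) ?/bf ?mulmx0 ?mxE ?rpred0 //.
  apply/matrixP => c o; rewrite !mxE (_ : (lam c == k) = false) //.
  by apply: ltn_eqF; have := M_large c; lia.
elim: m => [|m IHm]; first by rewrite big_geq // expr0 divr1.
rewrite IHm density_clevel big_nat_recr //= exprD invfM.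
by rewrite -[LHS]mulrA; congr (_ * _); rewrite mulrC.
Qed.

End OddityLevel.

(** * Passing to modulo 4 off the diagonal and modulo 8 on it, for p = 2 *)

Section SecondLevel.
Variables (two_pr : prime 2) (n M : nat) (G : jordan_gram two_pr n).
Local Notation Zp := (padic_int two_pr).
Local Notation mat := 'M[Zp]_n.
Local Notation vec := 'cV[Zp]_n.
Local Notation lam := (lam G).
Local Notation B := (gm G).
Local Notation iB := (gmV G).
Local Notation P := (pullback lam B).
Local Notation star := (star lam).
Local Notation bbk i := (bf (gm_blk G i)).
Local Notation blk := (blk G).
Local Notation supp := (supp G).
Local Notation par := (par G).
Local Notation u := (char_vec G).
Local Notation even x := (x \in dv (2%:R : Zp)).
Local Notation defect := (defect G).
Local Notation dens := (@density 2 two_pr n M).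
Implicit Types (E X Z : mat) (a b c d x y : 'I_n) (i j k : nat).
Add Ring Z2_ring : (padic_ring_theory two_pr).

Variable tau : nat.
Hypothesis tau_le1 : (tau <= 1)%N.
Hypothesis M_large : forall a, (lam a + 3 <= M)%N.
Local Notation level := (level G tau).
Local Notation clevel := (clevel G tau).
Local Notation quad := (quad_star lam).
Local Notation cdef E k := (bf (P E - B) (blk k u) (blk k u)).

Definition second_pairs : seq ('I_n * 'I_n) :=
  [seq v : 'I_n * 'I_n <- enum [set: 'I_n * 'I_n] | (v.1 < v.2)%N && (1 < minlam G v.1 v.2)%N].

Definition second_diag : seq 'I_n :=
  [seq a <- enum 'I_n | (tau.+1 < lam a)%N && ~~ special G a].

Section Move.
Variables (E Z : mat).
Hypothesis E_clevel : clevel 0 E.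
Let E_near : mdv (2%:R : Zp) (P E - B). Proof. exact: (level1_near tau_le1 E_clevel.1). Qed.

Local Notation Y := (B *m Z).
Local Notation E' := (E + star E (2%:R *: Z)).

Lemma move2_admissible : admissible M (fun E => E + star E (2%:R *: Z)).
Proof.
apply: admissible_star; rewrite starZl starZr => x y.
by rewrite mxE dvMr ?dv_refl.
Qed.

Lemma move2_defect a b : defect E' a b - defect E a b
  = 2%:R * (star (P E) Z a b + star (P E) Z b a) + 2%:R * 2%:R * quad (P E) Z a b.
Proof.
rewrite defect_star starZr quad_starZ.
by move: (star (P E) Z) (quad _ _) => X W; rewrite !mxE; padic_ring two_pr.
Qed.

Lemma quad_same a b : lam a = lam b ->
  even (quad (P E) Z a b - bbk (lam a) (Z *m delta_mx a 0) (Z *m delta_mx b 0)).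
Proof.
move=> ab; rewrite quad_starE bfE -sumrB rpred_sum // => c _.
rewrite -sumrB rpred_sum // => d _; rewrite !mulmx_delta [gm_blk _ _ _ _]mxE.
have [/andP[/eqP ca /eqP da]|h] := boolP ((lam c == lam a) && (lam d == lam a)).
  rewrite ca eqxx mul1r (_ : gap2 lam a c d b = 0%N); last by rewrite /gap2 ca da ab; lia.
  rewrite expr0 mul1r -mulrBl -mulrBr dvMr // dvMl //.
  by rewrite -[_ - _]defectE E_near.
have -> : (lam c == lam a)%:R * B c d = 0 :> Zp.
  have [ca|_] := eqVneq (lam c) (lam a); last by rewrite mul0r.
  rewrite gm_block ?mulr0 //; move: h; rewrite ca eqxx /= eq_sym //.
rewrite mulr0 mul0r subr0 -!mulrA; apply: dvp_expl; rewrite /gap2.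
by move: h; rewrite negb_and; move: ab; lia.
Qed.

Lemma move2_off a b : defect E' a b - defect E a b - 2%:R * (Y a b + Y b a)
  \in dv (2%:R * 2%:R : Zp).
Proof.
rewrite move2_defect; have := star_near Z a b E_near; have := star_near Z b a E_near.
move: (star (P E) Z) (quad _ _) (B *m Z) => X W T /dvP[r1 e1] /dvP[r2 e2].
have -> : X a b = T a b + 2%:R * r2 by rewrite -e2 addrC subrK.
have -> : X b a = T b a + 2%:R * r1 by rewrite -e1 addrC subrK.
apply/dvP; exists (r1 + r2 + W a b).
by padic_ring two_pr.
Qed.

Lemma move2_diag a : defect E' a a - defect E a a
    - 2%:R * 2%:R * (Y a a + bbk (lam a) (Z *m delta_mx a 0) (Z *m delta_mx a 0))
  \in dv (2%:R * (2%:R * 2%:R) : Zp).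
Proof.
rewrite move2_defect; have := star_near Z a a E_near; have := quad_same (erefl (lam a)).
set q := bf _ _ _; move: (star (P E) Z) (quad _ _) (B *m Z) => X W T /dvP[r1 e1] /dvP[r2 e2].
have -> : X a a = T a a + 2%:R * r2 by rewrite -e2 addrC subrK.
have -> : W a a = q + 2%:R * r1 by rewrite -e1 addrC subrK.
apply/dvP; exists (r1 + r2).
by padic_ring two_pr.
Qed.

(** The change is 4 times the sum of b(u, Z u_k) and b(Z u_k, Z u_k) in block k, up to multiples of
    8; the sum is even because u is characteristic. *)
Lemma move2_char k : cdef E' k - cdef E k \in dv (2%:R * (2%:R * 2%:R) : Zp).
Proof.
have hs := @blk_supp _ _ _ G k u; set v := blk k u in hs *.
pose S := star (P E) Z; pose Q := quad (P E) Z.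
have XE : P E' - B - (P E - B) = 2%:R *: (S + S^T) + (2%:R * 2%:R) *: Q.
  apply/matrixP => a b.
  have -> : (P E' - B - (P E - B)) a b = defect E' a b - defect E a b.
    by rewrite !defect_diff; move: (P E') (P E) => T T'; rewrite !mxE.
  by rewrite move2_defect -/S -/Q; move: S Q => S Q; rewrite !mxE.
rewrite -bfBX XE bfDX !bfZX bfDX -(bf_tr S v v).
have hS : even (bf S v v - bf B v (Z *m v)).
  have -> : bf B v (Z *m v) = bf Y v v by rewrite /bf !mulmxA.
  rewrite -bfBX; apply: bf_mdv => a b; have := star_near Z a b E_near.
  by rewrite -/S; move: (S) Y => S' T; rewrite !mxE.
have hQ : even (bf Q v v - bbk k (Z *m v) (Z *m v)).
  have -> : bbk k (Z *m v) (Z *m v) = bf (Z^T *m gm_blk G k *m Z) v v by rewrite bf_mulmx.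
  rewrite -bfBX; apply: (bf_supp_dv hs hs) => a b ak bk.
  have := quad_same (etrans ak (esym bk)); rewrite -/Q ak.
  have -> : bbk k (Z *m delta_mx a 0) (Z *m delta_mx b 0) = (Z^T *m gm_blk G k *m Z) a b.
    by rewrite bf_mulmx bf_delta.
  by move: (Q) (_ *m Z) => Q' T; rewrite !mxE.
have hu := char_vecP G k (Z *m v).
have hB : bf B v (Z *m v) = bbk k u (Z *m v) by rewrite (bf_gm_blk _ hs) bbk_blkl.
rewrite hB in hS; move: hS hQ hu => /dvP[r1 e1] /dvP[r2 e2] /dvP[r3 e3].
set q0 := bbk k u _ in e1 e3 *; set q1 := bbk k _ _ in e2 e3 *.
have -> : bf S v v = q0 + 2%:R * r1 by rewrite -e1 addrC subrK.
have -> : bf Q v v = q0 + 2%:R * r3 + 2%:R * r2.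
  by rewrite -e2 -e3; padic_ring two_pr.
apply/dvP; exists (q0 + r1 + r2 + r3).
by padic_ring two_pr.
Qed.

Lemma move2_clevel : clevel 0 E'.
Proof.
have [h1 h2] := E_clevel; split; first split.
- move=> a b ab; apply: cong0 (h1.1 a b ab).
  have h : even (defect E' a b - defect E a b).
    by apply: cong0 (dv_mull (move2_off a b)) _; rewrite dvMr ?dv_refl.
  apply: dv_trans h; rewrite -[X in X \in _]mulr1.
  have -> : (2%:R : Zp) = 2%:R ^+ 1 by rewrite expr1.
  by rewrite dvXr // geq_minr.
- move=> a; apply: cong0 (h1.2 a).
  have h : defect E' a a - defect E a a \in dv (2%:R * 2%:R : Zp).
    by apply: cong0 (dv_mulr (move2_diag a)) _; rewrite dvMr ?dv_refl.
  apply: dv_trans h; rewrite dvM ?dv_refl // -[X in X \in _]mulr1.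
  have -> : (2%:R : Zp) = 2%:R ^+ 1 by rewrite expr1.
  by rewrite dvXr // geq_minr.
by move=> k k0 tk; apply: cong0 (move2_char k) (h2 k k0 tk).
Qed.

End Move.

Lemma M_dv4 a : 2%:R ^+ M \in dv (2%:R * 2%:R : Zp).
Proof. exact: dv_mulr (M_dv8 M_large a). Qed.

Definition clevel_off E := clevel 0 E /\
  forall v, v \in second_pairs -> defect E v.1 v.2 \in dv (2%:R * 2%:R).

Lemma density_clevel_off :
  dens clevel_off = dens (clevel 0) / 2%:R ^+ size second_pairs.
Proof.
apply: density_seq.
- by move=> _; apply: two_Zp_neq0.
- by move=> v _; apply: M_dv4 v.1.
- exact: (clevel_stable tau_le1 M_large).
- by move=> v E E' h; apply: defect_cont.
- move=> E [a b] _ h; have := level1_near tau_le1 h.1 a b.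
  by rewrite defectE.
move=> s1 [a b] s2 sE v.
have lt_pair t : t \in second_pairs -> (t.1 < t.2)%N.
  by rewrite mem_filter => /andP[/andP[]].
have ab_in : (a, b) \in second_pairs by rewrite sE mem_cat inE eqxx orbT.
have lt_ab := lt_pair _ ab_in; rewrite /= in lt_ab.
pose Z : mat := v *: (iB *m delta_mx a b).
have YE x y : (B *m Z) x y = v * ((x == a) && (y == b))%:R.
  by rewrite -scalemxAr mulmxA gmK mul1mx !mxE.
exists (fun E => E + star E (2%:R *: Z)); first exact: move2_admissible.
move=> E hE _.
have dE t : t \in second_pairs -> defect (E + star E (2%:R *: Z)) t.1 t.2
    - defect E t.1 t.2 - 2%:R * (v * (t == (a, b))%:R) \in dv (2%:R * 2%:R : Zp).
  case: t => x y /lt_pair /= xy; have := move2_off Z hE x y.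
  rewrite !YE; have -> : ((y == a) && (x == b)) = false.
    by apply/negP => /andP[/eqP ya /eqP xb]; move: xy; rewrite ya xb ltnNge ltnW.
  by rewrite mulr0 addr0 xpair_eqE.
split; first exact: move2_clevel.
- move=> t ts1; have t_in : t \in second_pairs by rewrite sE mem_cat ts1.
  have s_uniq : uniq second_pairs by rewrite filter_uniq ?enum_uniq.
  have tn : t != (a, b).
    move: s_uniq; rewrite sE cat_uniq /= negb_or => /and3P[_ /andP[nab _] _].
    by apply: contraNneq nab => <-.
  by have := dE t t_in; rewrite (negPf tn) mulr0 mulr0 subr0.
by have := dE _ ab_in; rewrite eqxx mulr1.
Qed.

Lemma clevel_off_stable : stable (fun _ _ => M) clevel_off.
Proof.
move=> E E' h [h1 h2]; split; first exact: (clevel_stable tau_le1 M_large h).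
by move=> v vs; apply: (defect_stable h (M_dv4 v.1)); apply: h2.
Qed.

(** With the values on characteristic vectors fixed by [clevel], the special diagonal entry of each
    odd block follows from the others, and the others can be moved freely. *)
Lemma density_second : dens (level 2) =
  dens clevel_off / 2%:R ^+ size second_diag.
Proof.
have -> : dens (level 2) = dens (fun E => clevel_off E /\
    forall a, a \in second_diag -> defect E a a \in dv (2%:R * 2%:R * 2%:R)).
  apply: density_ext => E; split=> [h|[[h1 h2] h3]].
    have near := level_near tau_le1 (fun e => match e erefl with end) (ltn0Sn 1) h.
    have h8 a : (tau.+1 < lam a)%N -> defect E a a \in dv (2%:R * (2%:R * 2%:R)).
      move=> ta; have := h.2 a; rewrite (_ : minn _ 2 = 2%N) ?expr2 //; lia.
    have h4 a b : a != b -> (1 < minlam G a b)%N -> defect E a b \in dv (2%:R * 2%:R).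
      by move=> ab m1; have := h.1 a b ab; rewrite (minn_idPr m1) expr2.
    split; first split; first split; first split.
    - by move=> a b ab; apply: dvX (h.1 a b ab); lia.
    - move=> a; apply: dv_trans (h.2 a); rewrite dvM ?dv_refl //.
      by rewrite -[X in X \in _]mulr1 dvXr //; lia.
    - move=> k _ tk; apply: (bf_diag_dv (defect_tr G E) (@blk_supp _ _ _ G k u)).
        move=> a b ak bk ab; rewrite defectE h4 // /minlam ak bk minnn.
        by apply: leq_ltn_trans tk.
      by move=> a ak; rewrite defectE h8 // ak.
    - move=> [a b]; rewrite mem_filter /= => /andP[/andP[ab m1] _].
      by apply: h4 => //; rewrite neq_ltn ab.
    by move=> a; rewrite mem_filter => /andP[/andP[ta _] _]; rewrite -mulrA h8.
  have h4 a b : a != b -> (1 < minlam G a b)%N -> defect E a b \in dv (2%:R * 2%:R).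
    rewrite neq_ltn => /orP[] ab m1.
      by apply: (h2 (a, b)); rewrite mem_filter /= ab m1 mem_enum inE.
    rewrite defect_sym; apply: (h2 (b, a)).
    by rewrite mem_filter /= ab /minlam minnC m1 mem_enum inE.
  split=> [a b ab|a].
    have [m1|m1] := ltnP 1 (minlam G a b); first by rewrite (minn_idPr m1) expr2 h4.
    by have := h1.1.1 a b ab; rewrite (minn_idPl m1) (minn_idPl (leqW m1)).
  have [ta|ta] := ltnP tau.+1 (lam a); last first.
    have := h1.1.2 a; rewrite (minn_idPl _) ?(minn_idPl _) //; lia.
  rewrite (_ : minn _ 2 = 2%N) ?expr2; last by lia.
  have in_list b : (tau.+1 < lam b)%N -> ~~ special G b -> b \in second_diag.
    by move=> tb nb; rewrite mem_filter tb nb mem_enum.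
  have [sa|na] := boolP (special G a); last by rewrite mulrA h3 // in_list.
  rewrite -defectE; apply: (recover_special (defect_tr G E) (erefl (lam a))) => //.
  - by rewrite mulf_neq0 ?two_Zp_neq0.
  - exact: special_odd.
  - move=> b c ba ca bc; rewrite defectE h4 // /minlam ba ca minnn.
    by apply: leq_ltn_trans ta.
  - move=> b ba bna; rewrite defectE mulrA h3 // in_list ?ba //.
    by apply: contraNN bna => sb; rewrite (special_uniq sb sa).
  - by rewrite defectE (level1_diag tau_le1 h1.1) // ltnW.
  - exact: h1.2.
apply: density_seq.
- by move=> _; rewrite mulf_neq0 ?two_Zp_neq0.
- by move=> a _; rewrite -mulrA (M_dv8 M_large a).
- exact: clevel_off_stable.
- by move=> a E E' h; apply: defect_cont.
- move=> E a; rewrite mem_filter => /andP[/andP[ta _] _] [h _].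
  by apply: (level1_diag tau_le1 h.1); apply: ltnW.
move=> s1 a s2 sE v.
have a_in : a \in second_diag by rewrite sE mem_cat inE eqxx orbT.
suff [Z [Zoff Zdiag]] : exists Z : mat,
    (forall x y, x != y -> even ((B *m Z) x y + (B *m Z) y x)) /\
    (forall c, c \in second_diag -> even ((B *m Z) c c
        + bbk (lam c) (Z *m delta_mx c 0) (Z *m delta_mx c 0) - v * (c == a)%:R)).
  exists (fun E => E + star E (2%:R *: Z)); first exact: move2_admissible.
  move=> E [hE hoff] _.
  have dE c : c \in second_diag -> defect (E + star E (2%:R *: Z)) c c - defect E c c
      - 2%:R * 2%:R * (v * (c == a)%:R) \in dv (2%:R * 2%:R * 2%:R : Zp).
    move=> cs; rewrite -[X in dv X]mulrA; apply: cong_trans (move2_diag Z hE c) _.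
    rewrite -mulrBr -[2%:R * 2%:R * (_ - _)]mulrA.
    by rewrite dvM ?dv_refl // dvM ?dv_refl // Zdiag.
  split.
  - split; first exact: move2_clevel.
    move=> [x y] xy; apply: cong0 (hoff _ xy); apply: cong0 (move2_off Z hE x y) _.
    rewrite dvM ?dv_refl // Zoff //.
    by move: xy; rewrite mem_filter => /andP[/andP[/= xy _] _]; rewrite neq_ltn xy.
  - move=> c cs1; have c_in : c \in second_diag by rewrite sE mem_cat cs1.
    have s_uniq : uniq second_diag by rewrite filter_uniq ?enum_uniq.
    have ca : c != a.
      move: s_uniq; rewrite sE cat_uniq /= negb_or => /and3P[_ /andP[nac _] _].
      by apply: contraNneq nac => <-.
    by have := dE c c_in; rewrite (negPf ca) mulr0 mulr0 subr0.
  by have := dE a a_in; rewrite eqxx mulr1.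
have bbkE (Y : mat) c : supp (lam c) (Y *m delta_mx c 0) ->
    bbk (lam c) (iB *m Y *m delta_mx c 0) (iB *m Y *m delta_mx c 0)
    = bf iB (Y *m delta_mx c 0) (Y *m delta_mx c 0).
  move=> hs; rewrite -mulmxA -bf_gm_blk ?bf_mulmx ?gmV_sym ?gmVK ?mul1mx //.
  exact: gmV_supp.
(* For B Z = v times the elementary matrix at (a, a), the shift divided by 4 is v + v^2 iB_aa. This
   is v modulo 2 only when iB_aa is even. *)
have [ea|oa] := boolP (iB a a \in dv (2%:R : Zp)).
  pose Y : mat := v *: delta_mx a a; exists (iB *m Y).
  have YE x y : (B *m (iB *m Y)) x y = v * ((x == a) && (y == a))%:R.
    by rewrite mulmxA gmK mul1mx !mxE.
  have Yc c : Y *m delta_mx c 0 = (v * (c == a)%:R) *: delta_mx a 0 :> vec.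
    apply/matrixP => x o; rewrite (ord1 o) mulmx_delta !mxE eqxx andbT.
    by case: (x == a); case: (c == a); rewrite ?mulr0 ?mulr1 ?mul0r.
  split=> [x y xy|c _].
    have na x' y' : x' != y' -> (x' == a) && (y' == a) = false.
      by move=> xy'; apply: contraNF xy' => /andP[/eqP -> /eqP ->].
    by rewrite !YE !na ?mulr0 ?addr0 ?rpred0 // eq_sym.
  rewrite bbkE ?Yc; last first.
    have [->|_] := eqVneq c a; first exact: scaled_delta_supp.
    by rewrite mulr0 scale0r => x _; rewrite mxE.
  rewrite YE andbb bfZl bfZr bf_delta addrAC subrr add0r.
  by rewrite !dvMl.
have pa : par (lam a).
  by apply: contrapT => /negP h; rewrite (par_char h erefl) in oa.
have [a0 a0a sa0] := special_exists pa.
have nspec c : c \in second_diag -> c == a0 = false.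
  by rewrite mem_filter => /andP[/andP[_ nc] _]; apply: contraNF nc => /eqP ->.
(* For odd iB_aa the quadratic term does the work: Y_aa is 0, and v^2 iB_(a0 a0) is congruent to v.
   Off the diagonal the symmetric Y contributes only multiples of 4. *)
pose Y : mat := v *: (delta_mx a a0 + delta_mx a0 a); exists (iB *m Y).
have YE x y : (B *m (iB *m Y)) x y
    = v * (((x == a) && (y == a0))%:R + ((x == a0) && (y == a))%:R).
  by rewrite mulmxA gmK mul1mx !mxE.
split=> [x y _|c cs].
  rewrite !YE [(y == a) && _]andbC [(y == a0) && _]andbC.
  by apply/dvP; eexists; rewrite [X in _ + v * X]addrC -mulr2n -[_ *+ 2]mulr_natl.
have ca0 := nspec c cs.
have Yc : Y *m delta_mx c 0 = (v * (c == a)%:R) *: delta_mx a0 0 :> vec.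
  apply/matrixP => x o; rewrite (ord1 o) mulmx_delta !mxE eqxx ca0 andbT andbF add0r.
  by case: (x == a0); case: (c == a); rewrite ?mulr0 ?mulr1 ?mul0r.
rewrite bbkE ?Yc; last first.
  have [->|_] := eqVneq c a; first by rewrite -a0a; apply: scaled_delta_supp.
  by rewrite mulr0 scale0r => x _; rewrite mxE.
rewrite YE ca0 andbF addr0 mulr0 add0r bfZl bfZr bf_delta.
have [_|_] := eqVneq c a; last by rewrite mulr0 !mul0r subrr rpred0.
have -> : v * 1 * (v * 1 * iB a0 a0) - v * 1 = v * v * (iB a0 a0 - 1) + (v * v - v).
  by padic_ring two_pr.
by rewrite rpredD ?dv2_sqr // dvMl // -dv2N special_odd.
Qed.

End SecondLevel.

(** * Endomorphisms of finite abelian p-groups *)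

Lemma card_set_image (T0 : finType) (T : choiceType) (S : {set T0}) (g : T0 -> T)
    (A : classical_sets.set T) :
    {in S &, injective g} -> (forall y, A y <-> exists2 x, x \in S & g x = y) ->
  finite_set A /\ card_set A = #|S|.
Proof.
move=> g_inj AP; pose F : {fset T} := seq_fset tt [seq g x | x <- enum S].
have FA : A = [set` F]%classic.
  apply/seteqP; split=> y /=.
    by move=> /AP[x xS <-]; rewrite seq_fsetE map_f // mem_enum.
  by rewrite seq_fsetE => /mapP[x xS ->]; apply/AP; exists x; rewrite ?mem_enum // in xS *.
split; first by rewrite FA; apply: finite_fset.
rewrite /card_set FA set_fsetK /F size_seq_fset undup_id ?size_map -?cardE //.
rewrite map_inj_in_uniq ?enum_uniq // => x y; rewrite !mem_enum; exact: g_inj.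
Qed.

Section Endomorphisms.
Variables (p : nat) (p_pr : prime p) (n M : nat) (lam : 'I_n -> nat).
Local Notation Zp := (padic_int p_pr).
Local Notation pe := (p%:R : Zp).
Local Notation vec := 'cV[Zp]_n.
Local Notation mat := 'M[Zp]_n.
Variables (Q : zmodType) (psi : vec -> Q).
Hypothesis psiB : forall x y, psi (x - y) = psi x - psi y.
Hypothesis psi_surj : forall q, exists x, psi x = q.
Hypothesis psi_ker : forall x, psi x = 0 <-> forall a, x a 0 \in dv (pe ^+ lam a).
Hypothesis M_large : forall a, (lam a <= M)%N.
Implicit Types (E : mat) (x y : vec) (a b : 'I_n) (q : Q).
Add Ring Zp_ring : (padic_ring_theory p_pr).

Definition min_exp a b := minn (lam a) (lam b).

Definition endo_mx E : mat := \matrix_(a, b) (pe ^+ (lam a - lam b) * E a b).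

Definition preim q : vec := projT1 (cid (psi_surj q)).

Lemma preimK q : psi (preim q) = q. Proof. by rewrite /preim; case: (cid _). Qed.

Definition endo E q : Q := psi (endo_mx E *m preim q).

Lemma psi_eq x y : psi x = psi y <-> forall a, x a 0 - y a 0 \in dv (pe ^+ lam a).
Proof.
have e : psi x = psi y <-> psi (x - y) = 0.
  by rewrite psiB; split=> [->|/eqP]; rewrite ?subrr // subr_eq0 => /eqP.
rewrite e psi_ker; split=> h a; have := h a; rewrite !mxE //.
Qed.

Lemma psi0 : psi 0 = 0. Proof. by have := psiB 0 0; rewrite !subrr. Qed.

Lemma psiN x : psi (- x) = - psi x. Proof. by have := psiB 0 x; rewrite psi0 !sub0r. Qed.

Lemma psiD x y : psi (x + y) = psi x + psi y.
Proof. by have := psiB x (- y); rewrite opprK psiN opprK. Qed.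

Lemma psiMn x k : psi (x *+ k) = psi x *+ k.
Proof. by elim: k => [|k IHk]; rewrite ?mulr0n ?psi0 // !mulrS psiD IHk. Qed.

Lemma psi_sum (I : Type) (r : seq I) (F : I -> vec) :
  psi (\sum_(i <- r) F i) = \sum_(i <- r) psi (F i).
Proof. exact: (big_morph psi psiD psi0). Qed.

Lemma endo_psi E x : endo E (psi x) = psi (endo_mx E *m x).
Proof.
apply/psi_eq => a; have h := (psi_eq _ _).1 (preimK (psi x)).
rewrite !mxE -sumrB rpred_sum // => b _; rewrite !mxE -mulrBr -mulrA.
have [la|lb] := leqP (lam a) (lam b).
  by rewrite !dvMl // (dvX la).
have -> : pe ^+ lam a = pe ^+ (lam a - lam b) * pe ^+ lam b.
  by rewrite -exprD subnK // ltnW.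
by rewrite dvM ?dv_refl // dvMl.
Qed.

Lemma endoD E : {morph endo E : q r / q + r}.
Proof.
move=> q r; rewrite -(preimK q) -(preimK r) -psiD !endo_psi.
by rewrite mulmxDr psiD.
Qed.

Lemma endo_entry E b : endo E (psi (delta_mx b 0)) = psi (col b (endo_mx E)).
Proof. by rewrite endo_psi colE. Qed.

Lemma endo_cong E E' : mxcong min_exp E E' -> endo E = endo E'.
Proof.
move=> h; apply/funext => q; apply/psi_eq => a.
rewrite !mxE -sumrB rpred_sum // => b _; rewrite !mxE -mulrBl -mulrBr dvMr //.
rewrite (dvX (_ : _ <= lam a - lam b + min_exp a b)%N) //.
  by rewrite /min_exp; lia.
by rewrite exprD dvM ?dv_refl // h.
Qed.

Lemma endo_inj E E' : endo E = endo E' -> mxcong min_exp E E'.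
Proof.
move=> e a b; have := congr1 (fun f => f (psi (delta_mx b 0))) e.
rewrite !endo_entry => /psi_eq/(_ a); rewrite !mxE -mulrBr.
have -> : pe ^+ lam a = pe ^+ (lam a - lam b) * pe ^+ min_exp a b.
  by rewrite -exprD; congr (_ ^+ _); rewrite /min_exp; lia.
by rewrite dvMcancel // peX_neq0.
Qed.

(** The image of the generator of index b is killed by p^(lam b), which makes its coordinate a
    divisible by p^(lam a - lam b). *)
Lemma endo_surj (f : Q -> Q) : {morph f : q r / q + r} -> exists E, f = endo E.
Proof.
move=> fD; have f0 : f 0 = 0 by apply: (addrI (f 0)); rewrite -fD !addr0.
have fMn q k : f (q *+ k) = f q *+ k.
  by elim: k => [|k IHk]; rewrite ?mulr0n // !mulrS fD IHk.
have fsum (F : 'I_n -> Q) : f (\sum_i F i) = \sum_i f (F i).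
  exact: (big_morph f fD f0).
pose y b := preim (f (psi (delta_mx b 0))).
have yP b : psi (y b) = f (psi (delta_mx b 0)) by apply: preimK.
have hy a b : exists r : Zp, y b a 0 = pe ^+ (lam a - lam b) * r.
  apply/dvP; have : psi (y b *+ p ^ lam b) = 0.
    rewrite psiMn yP -fMn -psiMn (_ : psi _ = 0) //; apply/psi_ker => c.
    rewrite mulmxnE mxE; case: (eqVneq c b) => [->|_]; last by rewrite mul0rn rpred0.
    by rewrite -[_ *+ (p ^ _)]mulr_natl natrX dvMr ?dv_refl.
  move=> /psi_ker/(_ a); rewrite mulmxnE -[_ *+ (p ^ _)]mulr_natl natrX.
  have [la|lb] := leqP (lam a) (lam b).
    by rewrite (eqP la) expr0 dv1.
  have -> : pe ^+ lam a = pe ^+ lam b * pe ^+ (lam a - lam b).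
    by rewrite -exprD subnKC // ltnW.
  by rewrite dvMcancel // peX_neq0.
exists (\matrix_(a, b) projT1 (cid (hy a b))); apply/funext => q.
rewrite -(preimK q) endo_psi; move: (preim q) => x.
have xE : psi x = \sum_b psi (delta_mx b 0) *+ residue (x b 0) M.
  under eq_bigr => b _ do rewrite -psiMn.
  rewrite -psi_sum; apply/psi_eq => a; rewrite summxE (bigD1 a) //= big1 => [|b ba].
    rewrite mulmxnE mxE !eqxx addr0; apply: cong_sym.
    by apply: (dvX (M_large a)); rewrite residueK.
  by rewrite mulmxnE mxE eq_sym (negPf ba) mul0rn.
rewrite xE fsum; under eq_bigr => b _ do rewrite fMn -yP -psiMn.
rewrite -psi_sum; apply/psi_eq => a; rewrite summxE mxE -sumrB rpred_sum // => b _.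
rewrite mulmxnE !mxE; case: (cid (hy a b)) => r /= ->.
apply: (dvX (M_large a)).
have -> : pe ^+ (lam a - lam b) * r *+ residue (x b 0) M - pe ^+ (lam a - lam b) * r * x b 0
  = pe ^+ (lam a - lam b) * r * ((residue (x b 0) M)%:R - x b 0).
  by rewrite -[_ *+ residue _ _]mulr_natr; padic_ring p_pr.
by rewrite dvMl // residueK.
Qed.

Local Notation T := {ffun 'I_n -> 'I_(p ^ M)}.

Definition coords q : T := [ffun a => Ordinal (leq_trans
  (residue_lt (preim q a 0) (lam a)) (leq_pexp2l (prime_gt0 p_pr) (M_large a)))].

Lemma coords_inj : injective coords.
Proof.
move=> q r e; rewrite -(preimK q) -(preimK r); apply/psi_eq => a.
by apply/residue_eqP; have := congr1 (fun f : T => val (f a)) e; rewrite !ffunE.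
Qed.

(** Q is a bare [zmodType]; its finiteness is used through [coords], by transporting f to a set of
    digit vectors. *)
Lemma injective_surjective (f : Q -> Q) : injective f -> forall r, exists q, f q = r.
Proof.
move=> f_inj r; pose c2q (c : T) : Q := psi (\col_a (c a : nat)%:R).
have coordsK q : c2q (coords q) = q.
  rewrite -[RHS]preimK; apply/psi_eq => a; rewrite mxE ffunE /=; exact: residueK.
(* The digit vectors that are the code of an element: exactly one for each element of Q. *)
pose J := [set c | coords (c2q c) == c].
pose h c := coords (f (c2q c)).
have hJ : h @: J \subset J.
  by apply/fintype.subsetP => _ /imsetP[c _ ->]; rewrite inE /h coordsK.
have h_inj : {in J &, injective h}.
  move=> c d; rewrite !inE => /eqP cJ /eqP dJ /coords_inj/f_inj e.
  by rewrite -cJ -dJ e.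
have hJE : h @: J = J by apply/eqP; rewrite eqEcard hJ (card_in_imset h_inj) leqnn.
have : coords r \in h @: J by rewrite hJE inE coordsK.
by move=> /imsetP[c _ /coords_inj ->]; exists (c2q c).
Qed.

Lemma injective_bijective (f : Q -> Q) : injective f -> bijective f.
Proof.
move=> f_inj; have surj := injective_surjective f_inj.
exists (fun r => projT1 (cid (surj r))) => q; last by case: (cid _).
by apply: f_inj; case: (cid _).
Qed.

Lemma endo_stable (R : (Q -> Q) -> Prop) : stable min_exp (fun E => R (endo E)).
Proof. by move=> E E' /endo_cong ->. Qed.

(** Endomorphisms correspond to matrices with entry (a, b) modulo p^[min_exp a b], so their number
    is a density times the size of this box. Bijectivity comes for free from injectivity. *)
Lemma card_endo (R : (Q -> Q) -> Prop) (A : classical_sets.set (Q -> Q)) :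
    (forall f, A f <-> [/\ bijective f, {morph f : q r / q + r} & R f]) ->
    (forall E, R (endo E) -> injective (endo E)) ->
  finite_set A /\ (card_set A)%:R
    = density M (fun E => R (endo E)) * p%:R ^+ (\sum_a \sum_b min_exp a b) :> rat.
Proof.
move=> AE R_inj.
have min_le a b : (min_exp a b <= M)%N by rewrite (leq_trans (geq_minl _ _)).
rewrite (density_box min_le (endo_stable (R := R))) divfK; last first.
  by rewrite expf_neq0 // pnatr_eq0 -lt0n prime_gt0.
set S := [set A0 | _ & _].
have [||fA cA] := @card_set_image _ _ S (fun C => endo (digits_mx p_pr C)) A.
- move=> C D; rewrite !inE => /andP[/forallP hC _] /andP[/forallP hD _] /endo_inj h.
  apply/ffunP => -[a b]; apply: val_inj; have := h a b; rewrite !mxE.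
  by move/residue_eqP; rewrite !residue_nat !modn_small //.
- move=> f; rewrite AE; split=> [[fb fD Rf]|[C]]; last first.
    rewrite inE => /andP[_ /asboolW RC] <-; split=> //; last exact: endoD.
    exact/injective_bijective/R_inj.
  have [E fE] := endo_surj fD.
  have pgt0 k : (0 < p ^ k)%N by rewrite expn_gt0 prime_gt0.
  have lt_C ab : (residue (E ab.1 ab.2) (min_exp ab.1 ab.2) < p ^ M)%N.
    apply: leq_trans (residue_lt _ _) _.
    by rewrite leq_pexp2l ?prime_gt0.
  pose C : {ffun 'I_n * 'I_n -> 'I_(p ^ M)} := [ffun ab => Ordinal (lt_C ab)].
  have CE : endo (digits_mx p_pr C) = f.
    rewrite fE; apply: endo_cong => a b; rewrite mxE ffunE /=; exact: residueK.
  exists C => //; rewrite inE CE; apply/andP; split; last exact: asboolT.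
  by apply/forallP => ab; rewrite ffunE /= residue_lt.
by split=> //; rewrite cA.
Qed.

End Endomorphisms.

(** * From blocks to one matrix: independence and the global Gram matrix *)

Lemma density_base (p : nat) (p_pr : prime p) (n M N : nat) (G : jordan_gram p_pr n)
    (fr : nat -> bool) : (forall a, lam G a < N)%N ->
  density M (base G fr) = \prod_(1 <= j < N) density M (base_block G fr j).
Proof.
move=> lamN.
suff h m : density M (fun E => forall j, (0 < j < m)%N -> base_block G fr j E)
    = \prod_(1 <= j < m) density M (base_block G fr j).
  rewrite -h; apply: density_ext => E; split=> [h1 j _|h1 j a b aj bj]; first exact: h1.
  by apply: h1 => //; rewrite -aj lam_gt0 lamN.
elim: m => [|m IHm].
  rewrite big_geq // -(density_setT p_pr n M); apply: density_ext => E.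
  by split=> // _ j; rewrite ltn0 andbF.
have [->|m0] := posnP m.
  rewrite big_geq // -(density_setT p_pr n M); apply: density_ext => E.
  by split=> // _ j; case: j.
rewrite big_nat_recr //= -IHm.
rewrite -(@density_indep _ _ _ _ [pred ab | (lam G ab.1 == m) && (lam G ab.2 == m)]).
- apply: density_ext => E; split=> [h|[h1 h2] j /andP[j0]].
    split=> [j /andP[j0 jm]|]; first by apply: h; rewrite j0 ltnW.
    by apply: h; rewrite m0 ltnSn.
  by rewrite ltnS leq_eqVlt => /orP[/eqP ->//|jm]; apply: h1; rewrite j0.
- move=> E E' hEE' h j jm; apply: base_block_cong (h j jm) => a b aj bj.
  rewrite hEE' ?subrr ?rpred0 //= aj bj andbb.
  by case/andP: jm => _ /ltn_eqF ->.
move=> E E' hEE'; apply: base_block_cong => a b am bm.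
by rewrite hEE' ?subrr ?rpred0 //= am bm eqxx.
Qed.

Section TaggedGram.
Variables (p : nat) (p_pr : prime p) (N : nat) (r : nat -> nat).
Local Notation Zp := (padic_int p_pr).
Variable g : forall i, 'M[Zp]_(r i).
Hypothesis g_sym : forall i, (g i)^T = g i.
Hypothesis g_unit : forall i, g i \in unitmx.

(** The tag i stands for block i + 1; the shift removes the unimodular block 0. *)
Definition jindex := {i : 'I_N.-1 & 'I_(r i.+1)}.
Implicit Types (v w : jindex).

Definition tag_mx (h : forall i, 'M[Zp]_(r i)) v w : Zp :=
  if tag v == tag w then h (tag v).+1 (tagged v) (tagged_as v w) else 0.

Lemma tag_mxE h (i : 'I_N.-1) (x y : 'I_(r i.+1)) :
  tag_mx h (Tagged (fun i : 'I_N.-1 => 'I_(r i.+1)) x)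
    (Tagged (fun i : 'I_N.-1 => 'I_(r i.+1)) y) = h i.+1 x y.
Proof. by rewrite /tag_mx /= eqxx tagged_asE. Qed.

Lemma tag_mx_sym h v w : (forall i, (h i)^T = h i) -> tag_mx h v w = tag_mx h w v.
Proof.
move=> hs; case: v w => i x [j y]; have [ij|ij] := eqVneq i j.
  by move: x y; rewrite ij => x y; rewrite !tag_mxE -{1}(hs j.+1) mxE.
by rewrite /tag_mx /= (negPf ij) eq_sym (negPf ij).
Qed.

Definition full_mx h : 'M[Zp]_#|{: jindex}| :=
  \matrix_(a, b) tag_mx h (enum_val a) (enum_val b).

Definition jlam (a : 'I_#|{: jindex}|) : nat := (tag (enum_val a)).+1.

Lemma jlam_gt0 a : (0 < jlam a)%N. Proof. by []. Qed.

Lemma full_mx_block h a b : jlam a != jlam b -> full_mx h a b = 0.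
Proof. by rewrite mxE /tag_mx /jlam eqSS => /negPf; rewrite val_eqE => ->. Qed.

Lemma full_mx_sym h : (forall i, (h i)^T = h i) -> (full_mx h)^T = full_mx h.
Proof. by move=> hs; apply/matrixP => a b; rewrite !mxE tag_mx_sym. Qed.

Lemma full_mxK : full_mx g *m full_mx (fun i => invmx (g i)) = 1%:M.
Proof.
apply/matrixP => a b; rewrite !mxE -(inj_eq enum_val_inj).
under eq_bigr => c _ do rewrite !mxE.
pose tg i x : jindex := Tagged (fun i : 'I_N.-1 => 'I_(r i.+1)) (i := i) x.
pose F w := tag_mx g (enum_val a) w * tag_mx (fun i => invmx (g i)) w (enum_val b).
have -> : \sum_(c < #|{: jindex}|) tag_mx g (enum_val a) (enum_val c)
    * tag_mx (fun i => invmx (g i)) (enum_val c) (enum_val b)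
  = \sum_i \sum_z F (tg i z).
  rewrite -(big_enum_val F) (eq_bigl xpredT) // sig_big_dep /=.
  by apply: eq_bigr => -[].
rewrite /F {F}; case: (enum_val a) (enum_val b) => i x [k y].
rewrite (bigD1 i) //= [X in _ + X]big1 => [|j ji]; last first.
  by rewrite big1 // => z _; rewrite {1}/tag_mx /= eq_sym (negPf ji) mul0r.
rewrite addr0; have [ik|ik] := eqVneq i k; last first.
  rewrite big1 => [|z _]; last by rewrite {2}/tag_mx /= (negPf ik) mulr0.
  by rewrite -tag_eqE /tag_eq /= (negPf ik).
move: x y; rewrite ik => x y; under eq_bigr => z _ do rewrite !tag_mxE.
have := mulmxV (g_unit k.+1) => /matrixP/(_ x y); rewrite !mxE => ->.
by rewrite -tag_eqE /tag_eq /= eqxx tagged_asE.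
Qed.

Definition tagged_gram : jordan_gram p_pr #|{: jindex}| :=
  JordanGram jlam_gt0 (full_mx_sym g_sym)
    (@full_mx_block g) (@full_mx_block (fun i => invmx (g i))) full_mxK.

End TaggedGram.

(** * Preservation of the discriminant form as congruences on matrices *)

Section DiscForm.
Variables (p : nat) (p_pr : prime p) (n M : nat) (G : jordan_gram p_pr n).
Local Notation Zp := (padic_int p_pr).
Local Notation pe := (p%:R : Zp).
Local Notation mat := 'M[Zp]_n.
Local Notation vec := 'cV[Zp]_n.
Local Notation lam := (lam G).
Local Notation B := (gm G).
Local Notation iB := (gmV G).
Local Notation P := (pullback lam B).
Local Notation F E := (endo_mx lam E).
Local Notation defect := (defect G).
Implicit Types (E X : mat) (x y : vec) (a b c d : 'I_n).
Add Ring Zp_ring : (padic_ring_theory p_pr).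

Hypothesis M_large : forall a, (lam a + 3 <= M)%N.

Let lamM a : (lam a <= M)%N. Proof. by have := M_large a; lia. Qed.

(* p^M times the Gram matrix p^(- lam b) B_ab of the discriminant form. *)
Definition disc_mx : mat := \matrix_(a, b) (B a b * pe ^+ (M - lam b)).

Definition disc_diff E : mat := (F E)^T *m disc_mx *m F E - disc_mx.

(** The powers of p in the endomorphism and in the discriminant form combine to M - min(lam a, lam
    b) plus the [gap] of the pullback. So preservation modulo p^M is a congruence on [defect] modulo
    p^min. *)
Lemma disc_diffE E a b : disc_diff E a b = pe ^+ (M - minlam G a b) * defect E a b.
Proof.
have eB : disc_mx a b = pe ^+ (M - minlam G a b) * B a b.
  rewrite mxE /minlam; have [->|ab] := eqVneq (lam a) (lam b).
    by rewrite minnn mulrC.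
  by rewrite gm_block // mul0r mulr0.
have eP : ((F E)^T *m disc_mx *m F E) a b = pe ^+ (M - minlam G a b) * P E a b.
  rewrite pullbackE mxE exchange_big mulr_sumr /=; apply: eq_bigr => d _.
  rewrite mxE mulr_suml mulr_sumr; apply: eq_bigr => c _.
  rewrite !mxE; have [cd|cd] := eqVneq (lam c) (lam d); last first.
    by rewrite gm_block // !(mul0r, mulr0).
  have e1 : pe ^+ (lam c - lam a) * pe ^+ (M - lam d) * pe ^+ (lam d - lam b)
      = pe ^+ (M - minlam G a b) * pe ^+ gap lam a c b.
    rewrite -!exprD; congr (_ ^+ _); rewrite /minlam /gap.
    by have := lamM a; have := lamM b; have := lamM c; lia.
  transitivity (pe ^+ (lam c - lam a) * pe ^+ (M - lam d) * pe ^+ (lam d - lam b)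
      * (E c a * B c d * E d b)); first by padic_ring p_pr.
  by rewrite e1; padic_ring p_pr.
by rewrite mxE eP [X in _ + X]mxE eB -mulrBr.
Qed.

Lemma disc_diff_tr E : (disc_diff E)^T = disc_diff E.
Proof.
by apply/matrixP => a b; rewrite mxE !disc_diffE defect_sym /minlam minnC.
Qed.

Lemma disc_diff_dv E a b (k : Zp) : disc_diff E a b \in dv (k * pe ^+ M)
  <-> defect E a b \in dv (k * pe ^+ minlam G a b).
Proof.
rewrite disc_diffE; have -> : k * pe ^+ M = pe ^+ (M - minlam G a b) * (k * pe ^+ minlam G a b).
  rewrite mulrCA -exprD subnK // /minlam.
  by rewrite (leq_trans (geq_minl _ _)).
by rewrite dvMcancel ?peX_neq0.
Qed.

Definition sol_polar E := forall a b, defect E a b \in dv (pe ^+ minlam G a b).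

Definition sol_form E := (forall a b, a != b -> defect E a b \in dv (pe ^+ minlam G a b))
  /\ forall a, defect E a a \in dv (2%:R * pe ^+ lam a).

Lemma sol_form_polar E : sol_form E -> sol_polar E.
Proof.
move=> [h1 h2] a b; have [<-|] := eqVneq a b; last exact: h1.
by rewrite /minlam minnn; apply: dv_mulr (h2 a).
Qed.

Lemma bf_disc_diff E x y : bf (disc_diff E) x y
  = bf disc_mx (F E *m x) (F E *m y) - bf disc_mx x y.
Proof. by rewrite bfBX bf_mulmx. Qed.

Lemma sol_polarP E : sol_polar E <->
  forall x y, bf disc_mx (F E *m x) (F E *m y) - bf disc_mx x y \in dv (pe ^+ M).
Proof.
split=> [h x y|h a b].
  rewrite -bf_disc_diff; apply: bf_mdv => a b; rewrite -[pe ^+ M]mul1r.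
  by apply/disc_diff_dv; rewrite mul1r.
have := h (delta_mx a 0) (delta_mx b 0); rewrite -bf_disc_diff bf_delta.
by rewrite -[pe ^+ M]mul1r => /disc_diff_dv; rewrite mul1r.
Qed.

Lemma sol_formP E : sol_form E <->
  forall x, bf disc_mx (F E *m x) (F E *m x) - bf disc_mx x x \in dv (2%:R * pe ^+ M).
Proof.
split=> [[h1 h2] x|h].
  rewrite -bf_disc_diff; apply: (@bf_diag_dv_on _ _ _ predT) => //.
  - exact: disc_diff_tr.
  - move=> a b _ _ ab; rewrite -[pe ^+ M]mul1r.
    by apply/disc_diff_dv; rewrite mul1r h1.
  - by move=> a _; apply/disc_diff_dv; rewrite /minlam minnn.
have hd a : disc_diff E a a \in dv (2%:R * pe ^+ M).
  by rewrite -bf_delta bf_disc_diff.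
split=> [a b ab|a]; last first.
  by have /disc_diff_dv := hd a; rewrite /minlam minnn.
have := h (delta_mx a 0 + delta_mx b 0); rewrite -bf_disc_diff bfDl !bfDr !bf_delta.
have e : disc_diff E b a = disc_diff E a b by rewrite -{1}disc_diff_tr mxE.
rewrite e => h2; have : 2%:R * disc_diff E a b \in dv (2%:R * pe ^+ M).
  have -> : 2%:R * disc_diff E a b = disc_diff E a a + disc_diff E a b
     + (disc_diff E a b + disc_diff E b b) - disc_diff E a a - disc_diff E b b.
    by move: (disc_diff E) => X; padic_ring p_pr.
  by rewrite rpredB // rpredB.
rewrite dvMcancel ?two_Zp_neq0 // -[pe ^+ M]mul1r => /disc_diff_dv.
by rewrite mul1r.
Qed.

Lemma gm_kernel x : (forall b, (B *m x) b 0 \in dv (pe ^+ lam b)) ->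
  forall a, x a 0 \in dv (pe ^+ lam a).
Proof.
move=> h a; have -> : x = iB *m (B *m x) by rewrite mulmxA gmVK mul1mx.
rewrite mxE rpred_sum // => b _.
have [ab|ab] := eqVneq (lam a) (lam b); last by rewrite gmV_block // mul0r rpred0.
by rewrite dvMl // ab h.
Qed.

Lemma bf_disc_delta x b : bf disc_mx x (delta_mx b 0)
  = pe ^+ (M - lam b) * (B *m x) b 0.
Proof.
rewrite /bf -mulmxA -colE mxE mxE mulr_sumr; apply: eq_bigr => a _.
by rewrite !mxE (gm_symE G b a); padic_ring p_pr.
Qed.

Lemma disc_nondegenerate x :
  (forall y, bf disc_mx x y \in dv (pe ^+ M)) -> forall a, x a 0 \in dv (pe ^+ lam a).
Proof.
move=> h; apply: gm_kernel => b; have := h (delta_mx b 0); rewrite bf_disc_delta.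
have -> : pe ^+ M = pe ^+ (M - lam b) * pe ^+ lam b by rewrite -exprD subnK.
by rewrite dvMcancel ?peX_neq0.
Qed.

Lemma disc_radical x y : (forall a, x a 0 \in dv (pe ^+ lam a)) ->
  bf disc_mx x y \in dv (pe ^+ M).
Proof.
move=> h; rewrite bfE rpred_sum // => c _; rewrite rpred_sum // => d _.
rewrite mxE; have [cd|cd] := eqVneq (lam c) (lam d); last first.
  by rewrite gm_block // mul0r mulr0 mul0r rpred0.
have -> : pe ^+ M = pe ^+ lam c * pe ^+ (M - lam d) by rewrite -exprD cd subnKC.
apply: dvMr; rewrite [B c d * _]mulrC mulrA; apply: dvMr.
by apply: dvM; rewrite ?dv_refl.
Qed.

(** The discriminant form is nondegenerate, so an endomorphism preserving it is injective. *)
Lemma sol_polar_kernel E x : sol_polar E ->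
  (forall a, (F E *m x) a 0 \in dv (pe ^+ lam a)) -> forall a, x a 0 \in dv (pe ^+ lam a).
Proof.
move=> /sol_polarP h hx; apply: disc_nondegenerate => y.
by apply: cong0 (cong_sym (h x y)) (disc_radical _ hx).
Qed.

Lemma sol_form_level E : sol_form E <-> level G 0 M E.
Proof.
have mE a b : minn (minlam G a b) M = minlam G a b.
  by apply/minn_idPl; rewrite /minlam (leq_trans (geq_minl _ _)).
have lE a : minn (lam a - 0) M = lam a by rewrite subn0; apply/minn_idPl.
split=> -[h1 h2]; split=> [a b ab|a].
- by rewrite mE h1.
- by rewrite lE.
- by have := h1 a b ab; rewrite mE.
by have := h2 a; rewrite lE.
Qed.

(** For p = 2 the diagonal modulus 2^(lam a) equals 2 * 2^(lam a - 1), which is the case [tau] =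
    1. *)
Lemma sol_polar_level E : p = 2%N -> sol_polar E <-> level G 1 M E.
Proof.
move=> p2.
have mE a b : minn (minlam G a b) M = minlam G a b.
  by apply/minn_idPl; rewrite /minlam (leq_trans (geq_minl _ _)).
have lE a : 2%:R * pe ^+ minn (lam a - 1) M = pe ^+ lam a.
  rewrite -(pe_two p_pr p2) -exprS; congr (_ ^+ _).
  by have := lamM a; have := lam_gt0 G a; lia.
split=> [h|[h1 h2] a b].
  split=> [a b ab|a]; first by rewrite mE h.
  by have := h a a; rewrite lE /minlam minnn.
have [<-|ab] := eqVneq a b; last by have := h1 a b ab; rewrite mE.
by rewrite /minlam minnn -lE.
Qed.

End DiscForm.

Section BlockForm.
Variables (p : nat) (p_pr : prime p) (n M : nat) (G : jordan_gram p_pr n) (j : nat).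
Local Notation Zp := (padic_int p_pr).
Local Notation pe := (p%:R : Zp).
Local Notation mat := 'M[Zp]_n.
Local Notation vec := 'cV[Zp]_n.
Local Notation bbk := (bf (gm_blk G j)).
Local Notation blam := (fun a : 'I_n => (lam G a == j) : nat).
Local Notation F E := (endo_mx blam E).
Implicit Types (E X : mat) (x y : vec) (a b c d : 'I_n).
Add Ring Zp_ring : (padic_ring_theory p_pr).

(** Exponent 1 on block j and 0 elsewhere presents L_j / p L_j as a quotient of the full coordinate
    space, so that the results on endomorphisms apply to it with the same matrices. *)
Lemma blam_dv a (k : Zp) : (lam G a = j -> k \in dv pe) <-> k \in dv (pe ^+ blam a).
Proof.
have [aj|aj] := eqVneq (lam G a) j; first by rewrite expr1; split=> // h; apply: h.
by rewrite expr0; split=> [_|_ /eqP]; rewrite ?dv1 // (negPf aj).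
Qed.

Lemma endo_mx_delta E a : lam G a = j -> F E *m delta_mx a 0 = E *m delta_mx a 0 :> vec.
Proof.
move=> aj; apply/matrixP => c o; rewrite (ord1 o) !mulmx_delta mxE aj eqxx.
by rewrite (_ : (_ - 1)%N = 0%N) ?expr0 ?mul1r //; case: (_ == _).
Qed.

Lemma endo_mx_blk E x c : lam G c = j ->
  (F E *m x) c 0 - (F E *m blk G j x) c 0 \in dv pe.
Proof.
move=> cj; rewrite !mxE -sumrB rpred_sum // => d _; rewrite !mxE cj eqxx.
have [dj|dj] := eqVneq (lam G d) j; first by rewrite subrr rpred0.
by rewrite mulr0 subr0 subn0 expr1 -mulrA dvMr ?dv_refl.
Qed.

Let bdiff E : mat := (F E)^T *m gm_blk G j *m F E - gm_blk G j.

Let bdiffE E x y : bf (bdiff E) x y = bbk (F E *m x) (F E *m y) - bbk x y.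
Proof. by rewrite bfBX bf_mulmx. Qed.

Let bdiff_gram E a b : lam G a = j -> lam G b = j ->
  bdiff E a b = block_gram G E a b - gm G a b.
Proof.
move=> aj bj; rewrite -bf_delta bdiffE !endo_mx_delta // /block_gram aj.
by rewrite bf_delta mxE aj eqxx mul1r.
Qed.

Lemma block_polarP E : base_block G (fun=> false) j E <->
  forall x y, bbk (F E *m x) (F E *m y) - bbk x y \in dv pe.
Proof.
split=> [h x y|h a b aj bj]; last first.
  by split=> //; rewrite -bdiff_gram // -bf_delta bdiffE.
have h1 := bbk_cong (F E *m y) (fun c => @endo_mx_blk E x c).
have h2 := bbk_cong (F E *m blk G j x) (fun c => @endo_mx_blk E y c).
rewrite bbk_sym [X in _ - X]bbk_sym in h2.
apply: cong_trans h1 _; apply: cong_trans h2 _.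
rewrite -(bbk_blkl G j x) -(bbk_blkr G j (blk G j x)) -bdiffE.
apply: (bf_supp_dv (@blk_supp _ _ _ G j x) (@blk_supp _ _ _ G j y)) => a b aj bj.
by rewrite bdiff_gram //; have [] := h a b aj bj.
Qed.

Lemma block_formP E : base_block G (fun=> true) j E <->
  forall x, bbk (F E *m x) (F E *m x) - bbk x x \in dv (2%:R * pe).
Proof.
have bs : (bdiff E)^T = bdiff E.
  by rewrite linearB /= !trmx_mul trmxK gm_blk_sym mulmxA.
split=> [h x|h a b aj bj]; last first.
  have hd c : lam G c = j -> bdiff E c c \in dv (2%:R * pe).
    by move=> cj; rewrite -bf_delta bdiffE.
  have e : bdiff E b a = bdiff E a b by rewrite -{1}bs mxE.
  rewrite -bdiff_gram //; split=> [|<- _]; last exact: hd.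
  have := h (delta_mx a 0 + delta_mx b 0); rewrite -bdiffE bfDl !bfDr !bf_delta e => h2.
  have : 2%:R * bdiff E a b \in dv (2%:R * pe).
    have -> : 2%:R * bdiff E a b = bdiff E a a + bdiff E a b
       + (bdiff E a b + bdiff E b b) - bdiff E a a - bdiff E b b.
      by move: (bdiff E) => X; padic_ring p_pr.
    by rewrite rpredB ?hd // rpredB ?hd.
  by rewrite dvMcancel ?two_Zp_neq0.
apply: cong_trans (bbk_sq_cong (fun c => @endo_mx_blk E x c)) _.
rewrite -(bbk_blkl G j x) -(bbk_blkr G j (blk G j x)) -bdiffE.
apply: (bf_diag_dv bs (@blk_supp _ _ _ G j x)) => [a b aj bj _|a aj].
  by rewrite bdiff_gram //; have [] := h a b aj bj.
by rewrite bdiff_gram //; have [_ ->] := h a a aj aj.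
Qed.

Lemma block_kernel E x : (forall x y, bbk (F E *m x) (F E *m y) - bbk x y \in dv pe) ->
  (forall a, (F E *m x) a 0 \in dv (pe ^+ blam a)) -> forall a, x a 0 \in dv (pe ^+ blam a).
Proof.
move=> h hx a; apply/blam_dv => aj; rewrite -(bbk_coord _ aj).
apply: cong0 (cong_sym (h x _)) _.
rewrite bfE rpred_sum // => c _; rewrite rpred_sum // => d _; rewrite [gm_blk _ _ _ _]mxE.
have [cj|_] := eqVneq (lam G c) j; last by rewrite mul0r mulr0 mul0r rpred0.
by rewrite !dvMr //; move: cj; apply/blam_dv.
Qed.

End BlockForm.

(** * Reductions and discriminants of lattices *)

Section LatticeGram.
Variables (p : nat) (p_pr : prime p).
Local Notation Zp := (padic_int p_pr).
Local Notation Qp := (padic_rat p_pr).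
Local Notation "x %:F" := (@tofrac Zp x).
Local Notation pe := (p%:R : Zp).
Implicit Types (L : lattice p_pr).

Lemma mulZpP (c x : Zp) : (x%:F \in mulZp c%:F) = (x \in dv c).
Proof.
apply/asboolP/dvP => -[y e]; exists y; last by rewrite e tofracM.
by apply/eqP; rewrite -tofrac_eq tofracM e.
Qed.

Lemma mulZp1P (y : Qp) : y \in mulZp 1 -> exists a : Zp, y = a%:F.
Proof. by move=> /asboolP[a ->]; exists a; rewrite mul1r. Qed.

Lemma mulZpMcancel (c y d : Qp) : c != 0 -> (c * y \in mulZp (c * d)) = (y \in mulZp d).
Proof.
move=> c0; apply/asboolP/asboolP => -[a e]; exists a; last by rewrite e mulrA.
by apply: (mulfI c0); rewrite e mulrA.
Qed.

Lemma polar_lin L (I : finType) (c : I -> Zp) (x : I -> L) z :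
  polar (@Defs.form p p_pr L) (\sum_i c i *: x i) z = \sum_i (c i)%:F * polar (@Defs.form p p_pr L) (x i) z.
Proof.
elim/big_rec2: _ => [|i y1 y2 _ <-]; first exact: polar0.
exact: polarP.
Qed.

Lemma polar_lin2 L (I J : finType) (c : I -> Zp) (d : J -> Zp) (x : I -> L) (y : J -> L) :
  polar (@Defs.form p p_pr L) (\sum_i c i *: x i) (\sum_j d j *: y j)
  = \sum_i \sum_j (c i)%:F * polar (@Defs.form p p_pr L) (x i) (y j) * (d j)%:F.
Proof.
rewrite polar_lin; apply: eq_bigr => i _; rewrite polarC polar_lin mulr_sumr.
by apply: eq_bigr => j _; rewrite polarC -mulrA [_%:F * polar _ _ _]mulrC.
Qed.

Lemma unimodular_gram L : unimodular L -> exists g : 'M[Zp]_(lattice_rank L),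
  [/\ g^T = g, g \in unitmx & map_mx (@tofrac Zp) g = gram L].
Proof.
move=> [intL [e e_unit detE]].
have gz i j : exists a : Zp, gram L i j = a%:F by rewrite mxE; apply: mulZp1P.
pose g : 'M[Zp]_(lattice_rank L) := \matrix_(i, j) projT1 (cid (gz i j)).
have gE : map_mx (@tofrac Zp) g = gram L.
  by apply/matrixP => i j; rewrite [LHS]mxE [in X in X%:F]mxE; case: (cid _).
exists g; split=> //.
  apply/matrixP => i j; apply/eqP; rewrite -tofrac_eq [g^T _ _]mxE.
  have gEij k l : (g k l)%:F = gram L k l by rewrite -gE [RHS]mxE.
  by rewrite !gEij !mxE polarC.
rewrite unitmxE; suff -> : \det g = e by [].
by apply/eqP; rewrite -tofrac_eq -detE -gE det_map_mx.
Qed.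

Lemma lin_entry L (c : 'I_(lattice_rank L) -> Zp) i :
  v2r (\sum_j c j *: lattice_basis j) 0 i = c i.
Proof.
rewrite linear_sum summxE (bigD1 i) //= linearZ /= mxE /lattice_basis r2vK mxE !eqxx mulr1.
rewrite big1 ?addr0 // => j ji.
by rewrite linearZ /= mxE r2vK mxE eqxx eq_sym (negPf ji) mulr0.
Qed.

Lemma lin_p_multiple L (c : 'I_(lattice_rank L) -> Zp) :
  (\sum_j c j *: lattice_basis j \in @p_multiple _ _ L) <-> forall j, c j \in dv pe.
Proof.
split=> [/asboolP[y e] j|h].
  by rewrite -lin_entry e linearZ /= mxE dvMr ?dv_refl.
apply/asboolP; have hj j := elimT (dvP pe (c j)) (h j).
exists (\sum_j projT1 (cid (hj j)) *: lattice_basis j); rewrite scaler_sumr.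
by apply: eq_bigr => j _; rewrite scalerA; case: (cid _) => y /= <-.
Qed.

Lemma gram_polar L (g : 'M[Zp]_(lattice_rank L)) i j : map_mx (@tofrac Zp) g = gram L ->
  polar (@Defs.form p p_pr L) (lattice_basis i) (lattice_basis j) = (g i j)%:F.
Proof. by move=> /matrixP/(_ i j); rewrite !mxE. Qed.

Lemma evenP L : even_lattice L <-> forall x : L, Defs.form x \in mulZp 1.
Proof.
split=> h x; have := h x; rewrite polarxx -[_ *+ 2]mulr_natl.
  by rewrite -{2}[2%:R]mulr1 mulZpMcancel ?two_neq0.
by move=> hx; rewrite -[X in mulZp X]mulr1 mulZpMcancel ?two_neq0.
Qed.

Lemma odd_prime_form L (x : L) : p <> 2%N -> integral L -> Defs.form x \in mulZp 1.
Proof.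
move=> p2 intL; have /mulZp1P[a e] := intL x x; rewrite polarxx in e.
have p_odd : odd p by case: (even_prime p_pr).
have [y y2] := padic_half p_pr p_odd.
suff -> : Defs.form x = (y * a)%:F by apply: mulZp1.
apply: (mulfI (two_neq0 p_pr)); rewrite mulr_natl e -(rmorph_nat (@tofrac Zp)).
by rewrite -tofracM mulrA [_ * y]mulrC y2 mul1r.
Qed.

Lemma clear_denominators n (u : 'rV[Qp]_n) :
  exists2 d : Zp, d != 0 & exists z : 'rV[Zp]_n, d%:F *: u = map_mx (@tofrac Zp) z.
Proof.
have frac1 (x : Qp) : exists2 d : Zp, d != 0 & exists z : Zp, d%:F * x = z%:F.
  elim/quotW: x => x; exists (frac x).2; first exact: denom_ratioP.
  exists (frac x).1; apply/eqP; rewrite !piE FracField.equivfE /FracField.mulf /=.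
  by rewrite !numden_Ratio ?mul1r ?mulr1 ?oner_neq0 ?denom_ratioP.
have frac_seq (s : seq Qp) : exists2 d : Zp, d != 0 & forall x, x \in s -> exists z : Zp, d%:F * x = z%:F.
  elim: s => [|x s [d d0 IHs]]; first by exists 1; rewrite ?oner_neq0.
  have [e e0 [z ez]] := frac1 x; exists (e * d); first by rewrite mulf_neq0.
  move=> y; rewrite in_cons => /orP[/eqP ->|/IHs[t yt]].
    by exists (d * z); rewrite !tofracM -ez mulrCA mulrA.
  by exists (e * t); rewrite !tofracM -yt mulrA.
have [d d0 h] := frac_seq [seq u 0 i | i <- enum 'I_n].
exists d => //; have hi i : exists z : Zp, d%:F * u 0 i = z%:F.
  by apply: h; apply: map_f; rewrite mem_enum.
exists (\row_i projT1 (cid (hi i))); apply/matrixP => o i; rewrite (ord1 o) !mxE.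
by case: (cid (hi i)).
Qed.

Lemma polarVZl L a (u v : 'rV[Qp]_(lattice_rank L)) :
  polarV (a *: u) v = a * polarV u v.
Proof. by rewrite /polarV -!scalemxAl mxE. Qed.

Lemma polarV_suml L (I : finType) (c : I -> Qp) (u : I -> 'rV[Qp]_(lattice_rank L)) v :
  polarV (\sum_i c i *: u i) v = \sum_i c i * polarV (u i) v.
Proof.
elim/big_rec2: _ => [|i y1 y2 _ <-]; first by rewrite /polarV !mul0mx mxE.
by rewrite polarVD polarVZl.
Qed.

Lemma polarV_nondegenerate L (u : 'rV[Qp]_(lattice_rank L)) :
  (forall x : L, polarV u (embed x) = 0) -> u = 0.
Proof.
move=> h; have [d d0 [z zE]] := clear_denominators u.
have dF : d%:F != 0 :> Qp by rewrite tofrac_eq0.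
have zu : d%:F *: u = embed (@r2v Zp L z) by rewrite zE /embed r2vK.
suff z0 : (@r2v Zp L z) = 0.
  apply: (scalerI dF); rewrite zu z0 scaler0.
  by rewrite /embed linear0 map_mx0.
apply: (@form_nondegenerate _ _ L) => y.
by rewrite -polarV_embed -zu polarVZl h mulr0.
Qed.

Lemma embed_lin L (I : finType) (c : I -> Zp) (x : I -> L) :
  embed (\sum_i c i *: x i) = \sum_i (c i)%:F *: embed (x i).
Proof.
rewrite /embed linear_sum /= raddf_sum; apply: eq_bigr => i _.
by rewrite linearZ /= map_mxZ.
Qed.

End LatticeGram.

Section JordanReductions.
Variables (p : nat) (p_pr : prime p) (N : nat) (L_ : nat -> lattice p_pr).
Local Notation Zp := (padic_int p_pr).
Local Notation "x %:F" := (@tofrac Zp x).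
Local Notation pe := (p%:R : Zp).
Local Notation r := (fun i => lattice_rank (L_ i)).
Local Notation polarL L := (polar (@Defs.form p p_pr L)).
Variable g : forall i, 'M[Zp]_(r i).
Hypothesis g_sym : forall i, (g i)^T = g i.
Hypothesis g_unit : forall i, g i \in unitmx.
Hypothesis gE : forall i, map_mx (@tofrac Zp) (g i) = gram (L_ i).
Hypothesis L_int : forall i, integral (L_ i).
Local Notation J := (jindex N r).
Local Notation n := #|{: J}|.
Local Notation G := (tagged_gram N g_sym g_unit).
Local Notation vec := 'cV[Zp]_n.
Local Notation idx i y := (enum_rank (Tagged (fun i : 'I_N.-1 => 'I_(r i.+1)) (i := i) y) : 'I_n).

Lemma jlam_idx (i : 'I_N.-1) (y : 'I_(r i.+1)) : jlam (idx i y) = i.+1.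
Proof. by rewrite /jlam enum_rankK. Qed.

Lemma sum_jindex (V : nmodType) (H : 'I_n -> V) :
  \sum_a H a = \sum_(i < N.-1) \sum_(y < r i.+1) H (idx i y).
Proof.
rewrite (reindex enum_rank) /=; last exact/onW_bij/enum_rank_bij.
by rewrite sig_big_dep /=; apply: eq_bigr => -[].
Qed.

Lemma sum_jblock (V : nmodType) (H : 'I_n -> V) (i : 'I_N.-1) :
  (forall a, jlam a != i.+1 -> H a = 0) -> \sum_a H a = \sum_(y < r i.+1) H (idx i y).
Proof.
move=> h; rewrite sum_jindex (bigD1 i) //= [X in _ + X]big1 ?addr0 // => k ki.
by rewrite big1 // => y _; rewrite h // jlam_idx eqSS.
Qed.

Lemma jblockP a (i : 'I_N.-1) : jlam a = i.+1 -> exists y, a = idx i y.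
Proof.
rewrite /jlam -{2}(enum_valK a) => -[]; case: (enum_val a) => [k y] /= /val_inj ki.
by subst k; exists y.
Qed.

Lemma card_jblock (i : 'I_N.-1) : \sum_(a < n) ((jlam a == i.+1) : nat) = r i.+1.
Proof.
rewrite (@sum_jblock _ _ i) => [|a /negPf -> //].
by under eq_bigr => y _ do rewrite jlam_idx eqxx; rewrite sum1_card card_ord.
Qed.

Section Block.
Variable i : 'I_N.-1.
Local Notation j := i.+1.
Local Notation red := (reduction (L_ j)).
Local Notation bbk := (bf (gm_blk G j)).
Local Notation blam := (fun a : 'I_n => (lam G a == j) : nat).

Definition block_vector (x : vec) : L_ j := \sum_(y < r j) x (idx i y) 0 *: lattice_basis y.

Definition block_class (x : vec) : red := (\pi_red (block_vector x))%qT.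

Lemma block_vectorB x y : block_vector (x - y) = block_vector x - block_vector y.
Proof. by rewrite -sumrB; apply: eq_bigr => z _; rewrite !mxE scalerBl. Qed.

Lemma block_classB x y : block_class (x - y) = block_class x - block_class y.
Proof. by rewrite /block_class block_vectorB Quotient.pi_add Quotient.pi_opp. Qed.

Lemma block_vector_surj (v : L_ j) : exists x, block_vector x = v.
Proof.
exists (\col_a \sum_(y < r j | idx i y == a) v2r v 0 y); rewrite [RHS]lattice_basisE.
apply: eq_bigr => y _; rewrite mxE (big_pred1 y) // => z.
by rewrite (inj_eq enum_rank_inj) -tag_eqE /tag_eq /= eqxx tagged_asE.
Qed.

Lemma block_class_surj (q : red) : exists x, block_class x = q.
Proof.
have [x xE] := block_vector_surj (repr q).
by exists x; rewrite /block_class xE reprK.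
Qed.

Lemma block_class_ker x : block_class x = 0 <-> forall a, x a 0 \in dv (pe ^+ blam a).
Proof.
have -> : (block_class x = 0) <-> (block_vector x \in @p_multiple _ _ (L_ j)).
  have v0 : block_vector 0 = 0 by have := block_vectorB 0 0; rewrite !subrr.
  have <- : block_class 0 = 0 by have := block_classB 0 0; rewrite !subrr.
  by rewrite /block_class -[X in X \in _]subr0 -v0 Quotient.idealrBE; split=> /eqP.
rewrite lin_p_multiple; split=> [h a|h y]; last first.
  by have := h (idx i y); rewrite -[lam G _]/(jlam _) jlam_idx eqxx.
have [aj|_] := eqVneq (lam G a) j; last by rewrite dv1.
by have [y ->] := jblockP aj; rewrite expr1 h.
Qed.

Lemma block_polar x y : polarL (L_ j) (block_vector x) (block_vector y) = (bbk x y)%:F.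
Proof.
rewrite polar_lin2 bfE (@sum_jblock _ _ i) => [|a aj]; last first.
  by rewrite big1 // => b _; rewrite !mxE (negPf aj) mul0r mulr0 mul0r.
rewrite rmorph_sum; apply: eq_bigr => a _.
rewrite (@sum_jblock _ _ i) => [|b bj]; last first.
  by rewrite mxE gm_block ?mulr0 ?mul0r //= jlam_idx eq_sym.
rewrite rmorph_sum; apply: eq_bigr => b _.
rewrite (gram_polar _ _ (gE j)) !rmorphM; congr (_ * _%:F * _).
by rewrite mxE /= jlam_idx eqxx mul1r mxE !enum_rankK tag_mxE.
Qed.

Local Notation endoB := (endo blam block_class_surj).

Let endo_class E x : endoB E (block_class x) = block_class (endo_mx blam E *m x).
Proof. exact: (endo_psi block_classB block_class_surj block_class_ker). Qed.

Lemma block_form x : 2%:R * Defs.form (block_vector x) = (bbk x x)%:F.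
Proof. by rewrite -block_polar polarxx mulr_natl. Qed.

Lemma red_polar_class x y x' y' :
  red_polar (block_class x) (block_class y) = red_polar (block_class x') (block_class y')
  <-> bbk x y - bbk x' y' \in dv pe.
Proof.
rewrite !red_polar_pi // -mulZpP rmorphB /= -!block_polar rmorph_nat Quotient.idealrBE.
by split=> /eqP.
Qed.

Lemma red_form_class x x' :
  red_form (block_class x) = red_form (block_class x')
  <-> bbk x x - bbk x' x' \in dv (2%:R * pe).
Proof.
rewrite !red_form_pi // -mulZpP rmorphB rmorphM /= -!block_form -mulrBr !rmorph_nat.
rewrite mulZpMcancel ?two_neq0 // Quotient.idealrBE.
by split=> /eqP.
Qed.

Lemma endo_red_polar E : (forall x y, red_polar (endoB E x) (endoB E y) = red_polar x y)
  <-> base_block G (fun=> false) j E.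
Proof.
rewrite block_polarP; split=> [h x y|h q q'].
  by apply/red_polar_class; rewrite -!endo_class h.
have [x <-] := block_class_surj q; have [y <-] := block_class_surj q'.
by rewrite !endo_class; apply/red_polar_class/h.
Qed.

Lemma endo_red_form E : (forall x, red_form (endoB E x) = red_form x)
  <-> base_block G (fun=> true) j E.
Proof.
rewrite block_formP; split=> [h x|h q].
  by apply/red_form_class; rewrite -!endo_class h.
have [x <-] := block_class_surj q.
by rewrite !endo_class; apply/red_form_class/h.
Qed.

Lemma base_block_injective fr E : base_block G fr j E -> injective (endoB E).
Proof.
move=> h; have {}h : base_block G (fun=> false) j E.
  by move=> a b aj bj; split=> //; have [] := h a b aj bj.
move/block_polarP: h => h q q'.
have [x <-] := block_class_surj q; have [y <-] := block_class_surj q' => e.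
have e0 : block_class (endo_mx blam E *m (x - y)) = 0.
  by rewrite mulmxBr block_classB -!endo_class e subrr.
move/block_class_ker/(block_kernel h)/block_class_ker: e0.
by rewrite block_classB => /eqP; rewrite subr_eq0 => /eqP.
Qed.

(** Every additive map comes from a p-adic matrix, so linearity is no restriction and the orthogonal
    groups of the reductions fit [card_endo]. *)
Lemma reduction_additive_linear (f : red -> red) : {morph f : q q' / q + q'} -> linear f.
Proof.
move=> fD.
have [E ->] := endo_surj block_classB block_class_surj block_class_ker (M := 1)
  (fun a => leq_b1 _) fD.
move=> a q q'; rewrite (endoD block_classB block_class_surj block_class_ker); congr (_ + _); have [x <-] := block_class_surj q.
have scale_class c z : c *: block_class z = block_class (c *: z).
  rewrite -[LHS]/(reduction_scale c _) pi_reduction_scale; congr (\pi_red _)%qT.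
  by rewrite scaler_sumr; apply: eq_bigr => y _; rewrite !mxE scalerA.
by rewrite endo_class !scale_class endo_class scalemxAr.
Qed.

Lemma sum_block_min_exp : \sum_a \sum_b min_exp blam a b = (r j ^ 2)%N.
Proof.
rewrite /= -(card_jblock i) -mulnn big_distrl /=; apply: eq_bigr => a _.
rewrite big_distrr /=; apply: eq_bigr => b _; rewrite /min_exp.
by do 2 case: (_ == _).
Qed.

Variable M : nat.
Hypothesis M_gt0 : (0 < M)%N.

Let blamM a : (blam a <= M)%N. Proof. exact: leq_trans (leq_b1 _) M_gt0. Qed.

Lemma card_red_form : (card_set (O_red_form (L_ j)))%:R
  = density M (base_block G (fun=> true) j) * p%:R ^+ (r j ^ 2) :> rat.
Proof.
rewrite -sum_block_min_exp.
have [||_ ->] := @card_endo _ _ _ M _ _ _ block_classB block_class_surj block_class_ker blamM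
  (fun f => forall x, red_form (f x) = red_form x) (O_red_form (L_ j)).
- move=> f; split=> [[fb [fl fR]]|[fb fD fR]].
    by split=> // x y; have := fl 1 x y; rewrite !scale1r.
  by split=> //; split=> //; apply: reduction_additive_linear.
- by move=> E /endo_red_form; apply: base_block_injective.
by congr (_ * _); apply: density_ext => E; apply: endo_red_form.
Qed.

Lemma card_red_polar : (card_set (O_red_polar (L_ j)))%:R
  = density M (base_block G (fun=> false) j) * p%:R ^+ (r j ^ 2) :> rat.
Proof.
rewrite -sum_block_min_exp.
have [||_ ->] := @card_endo _ _ _ M _ _ _ block_classB block_class_surj block_class_ker blamM
  (fun f => forall x y, red_polar (f x) (f y) = red_polar x y) (O_red_polar (L_ j)).
- move=> f; split=> [[fb [fl fR]]|[fb fD fR]].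
    by split=> // x y; have := fl 1 x y; rewrite !scale1r.
  by split=> //; split=> //; apply: reduction_additive_linear.
- by move=> E /endo_red_polar; apply: base_block_injective.
by congr (_ * _); apply: density_ext => E; apply: endo_red_polar.
Qed.

End Block.

Lemma par_even_lattice (i : 'I_N.-1) :
  (exists a : 'I_n, lam G a = i.+1 /\ gm G a a \notin dv (2%:R : Zp)) <-> ~ even_lattice (L_ i.+1).
Proof.
split=> [[a [/jblockP[y ->]]] h ev|h].
  move: h; rewrite /= mxE enum_rankK tag_mxE -mulZpP -(gram_polar _ _ (gE i.+1)).
  by rewrite rmorph_nat ev.
apply: contrapT => /forallNP h2; apply: h => x; have [v <-] := block_vector_surj x.
rewrite block_polar -(rmorph_nat (@tofrac Zp)) mulZpP -[X in dv X]mulr1.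
rewrite -(bbk_blkl G _ v) -(bbk_blkr G _ (blk G _ v)).
apply: (bf_diag_dv (gm_blk_sym G _) (@blk_supp _ _ _ G i.+1 v)) => [*|a aj]; first exact: dv1.
rewrite mulr1 mxE dvMl //; apply: contrapT => /negP hn.
by apply: (h2 a).
Qed.

End JordanReductions.

(** * The discriminant group of a Jordan decomposition *)

Section JordanDiscriminant.
Variables (p : nat) (p_pr : prime p) (L : lattice p_pr) (N : nat) (L_ : nat -> lattice p_pr).
Variable iota : forall i, {linear L_ i -> L}.
Local Notation Zp := (padic_int p_pr).
Local Notation Qp := (padic_rat p_pr).
Local Notation "x %:F" := (@tofrac Zp x).
Local Notation pe := (p%:R : Zp).
Local Notation r := (fun i => lattice_rank (L_ i)).
Local Notation polarL L := (polar (@Defs.form p p_pr L)).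
Hypothesis L_int : integral L.
Hypothesis L_jordan : jordan_decomposition iota N.
Variable g : forall i, 'M[Zp]_(r i).
Hypothesis g_sym : forall i, (g i)^T = g i.
Hypothesis g_unit : forall i, g i \in unitmx.
Hypothesis gE : forall i, map_mx (@tofrac Zp) (g i) = gram (L_ i).
Local Notation J := (jindex N r).
Local Notation n := #|{: J}|.
Local Notation G := (tagged_gram N g_sym g_unit).
Local Notation lam := (lam G).
Local Notation B := (gm G).
Local Notation iB := (gmV G).
Local Notation vec := 'cV[Zp]_n.
Local Notation V := 'rV[Qp]_(lattice_rank L).
Implicit Types (x y : vec) (a b c : 'I_n).

Let part_int i : integral (L_ i). Proof. by case: L_jordan => /(_ i)[]. Qed.

Lemma peF_neq0 k : (pe ^+ k)%:F != 0 :> Qp.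
Proof. by rewrite tofrac_eq0 peX_neq0. Qed.

Lemma jordan_spans (z : L) : exists u : forall i : 'I_N, L_ i, z = \sum_(i < N) iota i (u i).
Proof. by case: L_jordan => _ _ [f _ fK] _ _; exists (f z); rewrite fK. Qed.

Lemma polar_iota i (x y : L_ i) :
  polarL L (iota i x) (iota i y) = (pe ^+ i)%:F * polarL (L_ i) x y.
Proof.
case: L_jordan => _ _ _ hf _; rewrite /polar -linearD !hf -!mulrBr.
by rewrite tofracXn rmorph_nat.
Qed.

Lemma polar_iota_orth i j (x : L_ i) (y : L_ j) : i != j -> polarL L (iota i x) (iota j y) = 0.
Proof. by case: L_jordan => _ _ _ _; apply. Qed.

Lemma polar_iota_dv i (x : L_ i) (z : L) : polarL L (iota i x) z \in mulZp (pe ^+ i)%:F.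
Proof.
have diag (v : L_ i) : polarL L (iota i v) (iota i x) \in mulZp (pe ^+ i)%:F.
  rewrite polar_iota -[X in _ \in mulZp X]mulr1 mulZpMcancel ?peF_neq0 //.
  exact: part_int.
have [u ->] := jordan_spans z; rewrite polarC.
have -> : polarL L (\sum_(k < N) iota k (u k)) (iota i x)
    = \sum_(k < N) polarL L (iota k (u k)) (iota i x).
  elim/big_rec2: _ => [|k z1 z2 _ <-]; first exact: polar0.
  by have := polarP 1 (iota k (u k)) z2 (iota i x); rewrite scale1r rmorph1 mul1r.
rewrite rpred_sum // => k _; have [ki|ki] := eqVneq (k : nat) i; last first.
  by rewrite polar_iota_orth // rpred0.
move: (u k); rewrite ki; exact: diag.
Qed.

Definition jordan_vector a : L :=
  iota (jlam a) (lattice_basis (tagged (enum_val a))).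

Lemma jordan_vector_polar a b :
  polarL L (jordan_vector a) (jordan_vector b) = (pe ^+ lam a * B a b)%:F.
Proof.
rewrite [gm G]/= mxE /jordan_vector /= /jlam.
case: (enum_val a) (enum_val b) => i x [k y] /=.
have [ik|ik] := eqVneq i k.
  by move: x y; rewrite ik => x y; rewrite tag_mxE polar_iota (gram_polar _ _ (gE _)) -tofracM.
by rewrite /tag_mx /= (negPf ik) mulr0 tofrac0 polar_iota_orth.
Qed.

Definition dual_vector x : V :=
  \sum_a ((x a 0)%:F / (pe ^+ lam a)%:F) *: embed (jordan_vector a).

Lemma dual_vectorP x : dual_vector x \in @in_dual _ _ L.
Proof.
apply/asboolP => z; rewrite polarV_suml rpred_sum // => a _.
rewrite polarV_embed; have /asboolP[e ->] := polar_iota_dv (lattice_basis (tagged (enum_val a))) z.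
by rewrite mulrA divfK ?peF_neq0 // -tofracM mulZp1.
Qed.

Lemma dual_vector_jordan x c : polarV (dual_vector x) (embed (jordan_vector c)) = ((B *m x) c 0)%:F.
Proof.
rewrite polarV_suml mxE rmorph_sum; apply: eq_bigr => a _.
rewrite polarV_embed jordan_vector_polar tofracM mulrA divfK ?peF_neq0 //.
by rewrite -tofracM (gm_symE G) mulrC.
Qed.

Definition disc_class x : discriminant L := (\pi_(discriminant L) (Dual (dual_vectorP x)))%qT.

Lemma dual_vectorB x y : dual_vector (x - y) = dual_vector x - dual_vector y.
Proof.
by rewrite -sumrB; apply: eq_bigr => a _; rewrite !mxE tofracB mulrBl scalerBl.
Qed.

Lemma disc_classB x y : disc_class (x - y) = disc_class x - disc_class y.
Proof.
rewrite /disc_class; have -> : Dual (dual_vectorP (x - y))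
    = Dual (dual_vectorP x) - Dual (dual_vectorP y).
  by apply: val_inj; rewrite raddfB /= dual_vectorB.
by rewrite Quotient.pi_add Quotient.pi_opp.
Qed.

Lemma disc_class_ker x : disc_class x = 0 <-> forall a, x a 0 \in dv (pe ^+ lam a).
Proof.
have -> : disc_class x = 0 <-> exists z : L, dual_vector x = embed z.
  have v0 : Dual (dual_vectorP 0) = 0.
    by apply: val_inj; have := dual_vectorB 0 0; rewrite !subrr.
  have <- : disc_class 0 = 0 by have := disc_classB 0 0; rewrite !subrr.
  have key (d d' : dual L) : d' = 0 ->
      (\pi_(discriminant L) d = \pi_(discriminant L) d')%qT <-> exists z : L, val d = embed z.
    move=> ->; split=> [/eqP|h].
      by rewrite -Quotient.idealrBE subr0 => /asboolP.
    by apply/eqP; rewrite -Quotient.idealrBE subr0; apply/asboolP.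
  exact: key (Dual (dual_vectorP x)) _ v0.
split=> [[z xz]|h].
  apply: (gm_kernel (G := G)) => b; rewrite -mulZpP -dual_vector_jordan xz polarV_embed polarC.
  exact: polar_iota_dv.
have hj a := elimT (dvP _ _) (h a).
exists (\sum_a projT1 (cid (hj a)) *: jordan_vector a); rewrite embed_lin.
apply: eq_bigr => a _; congr (_ *: _); case: (cid _) => y /= ->.
by rewrite tofracM mulrAC divff ?peF_neq0 ?mul1r.
Qed.

(** Pairing a dual vector with the Jordan basis of the positive blocks determines its coordinates
    there; what remains is orthogonal to these blocks and lies in L_0 by unimodularity. *)
Lemma disc_class_surj (q : discriminant L) : exists x, disc_class x = q.
Proof.
pose u := repr q; have /asboolP ud := dual_valP u.
have hz c := mulZp1P (ud (jordan_vector c)).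
pose z : vec := \col_c projT1 (cid (hz c)).
exists (iB *m z); rewrite -[q]reprK; apply/eqP; rewrite -Quotient.idealrBE -/u.
rewrite -rpredN opprB; apply/asboolP; rewrite raddfB /=.
pose w : V := val u - dual_vector (iB *m z).
have w_orth c : polarV w (embed (jordan_vector c)) = 0.
  rewrite polarVD -scaleN1r polarVZl dual_vector_jordan mulmxA gmK mul1mx mxE mulN1r.
  by case: (cid (hz c)) => e /= ->; rewrite subrr.
have w_dual (x : L) : polarV w (embed x) \in mulZp 1.
  by have /asboolP := rpredB (dual_valP u) (dual_vectorP (iB *m z)); apply.
have ht i := mulZp1P (w_dual (iota 0%N (lattice_basis i))).
pose t : 'cV[Zp]_(r 0%N) := \col_i projT1 (cid (ht i)).
(* Coordinates of the vector of L_0 with the same products against L_0 as the remainder w. *)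
pose s := invmx (g 0%N) *m t.
pose l0 : L_ 0%N := \sum_i s i 0 *: lattice_basis i.
have basis_polar m (e : 'I_(r m)) : (m < N)%N ->
    polarV w (embed (iota m (lattice_basis e))) = polarL L (iota 0%N l0) (iota m (lattice_basis e)).
  case: m e => [|m] e mN; last first.
    have mN' : (m < N.-1)%N by rewrite -ltnS prednK // (leq_ltn_trans _ mN).
    rewrite polar_iota_orth //.
    have := w_orth (enum_rank (Tagged (fun i : 'I_N.-1 => 'I_(r i.+1)) (i := Ordinal mN') e)).
    by rewrite /jordan_vector /jlam enum_rankK.
  rewrite polar_iota expr0 tofrac1 mul1r polar_lin.
  transitivity ((t e 0)%:F); first by rewrite mxE; case: (cid (ht e)).
  rewrite -[t](mulKVmx (g_unit 0%N)) -/s mxE rmorph_sum; apply: eq_bigr => i _.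
  rewrite (gram_polar _ _ (gE 0%N)) -tofracM mulrC; congr (_ * _)%:F.
  by rewrite -{1}(g_sym 0%N) mxE.
exists (iota 0%N l0).
apply/eqP; rewrite -subr_eq0; apply/eqP; apply: polarV_nondegenerate => x.
have [v ->] := jordan_spans x; rewrite polarVC.
have -> (y : V) : polarV (embed (\sum_(k < N) iota k (v k))) y
    = \sum_(k < N) polarV (embed (iota k (v k))) y.
  have -> : \sum_(k < N) iota k (v k) = \sum_(k < N) 1 *: iota k (v k).
    by apply: eq_bigr => k _; rewrite scale1r.
  rewrite embed_lin polarV_suml; by apply: eq_bigr => k _; rewrite tofrac1 mul1r.
apply: big1 => k _; rewrite (lattice_basisE (v k)) linear_sum /=.
under eq_bigr => i _ do rewrite linearZ /=.
rewrite embed_lin polarV_suml big1 // => i _; apply/eqP; rewrite mulf_eq0; apply/orP; right.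
rewrite polarVC polarVD -[- embed (iota 0%N l0)]scaleN1r polarVZl polarV_embed mulN1r subr_eq0.
by apply/eqP; apply: basis_polar.
Qed.

Variable M : nat.
Hypothesis M_large : forall a, (lam a + 3 <= M)%N.
Local Notation endoB := (endo lam disc_class_surj).
Local Notation D := (bf (disc_mx M G)).

Let lamM a : (lam a <= M)%N. Proof. by have := M_large a; lia. Qed.

Lemma dual_vector_polar x y :
  (pe ^+ M)%:F * polarV (dual_vector x) (dual_vector y) = (D x y)%:F.
Proof.
have fld (q s X Y Z : Qp) : q != 0 -> s * q * (X / q * (Y / q * (q * Z))) = X * (Z * s) * Y.
  move=> q0; rewrite [Y / q * (q * Z)]mulrA divfK // [X / q]mulrC -[q^-1 * X * _]mulrA.
  rewrite -[s * q * _]mulrA mulVKf // mulrCA -!mulrA; congr (_ * _).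
  by rewrite mulrCA mulrC [s * Z]mulrC mulrA.
rewrite polarV_suml bfE mulr_sumr rmorph_sum; apply: eq_bigr => a _.
rewrite polarVC polarV_suml !mulr_sumr rmorph_sum; apply: eq_bigr => b _.
have -> : disc_mx M G a b = B a b * pe ^+ (M - lam b) by rewrite mxE.
rewrite polarV_embed jordan_vector_polar !rmorphM; move: (lamM a).
have [ab|ab] := eqVneq (lam a) (lam b); last first.
  by rewrite [B b a](gm_symE G) [B a b]gm_block // !(rmorph0, mulr0, mul0r).
rewrite (gm_symE G b a) -ab => /subnK; move: (B a b) (lam a) (peF_neq0 (lam a)) => bb l l0 <-.
rewrite addnK exprD tofracM; exact: fld.
Qed.

Let endo_class E x : endoB E (disc_class x) = disc_class (endo_mx lam E *m x).
Proof. exact: (endo_psi disc_classB disc_class_surj disc_class_ker). Qed.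

Lemma disc_polar_class x y x' y' :
  disc_polar (disc_class x) (disc_class y) = disc_polar (disc_class x') (disc_class y')
  <-> D x y - D x' y' \in dv (pe ^+ M).
Proof.
rewrite !disc_polar_pi //= -mulZpP rmorphB /= -!dual_vector_polar -mulrBr.
rewrite -[X in _ \in mulZp X]mulr1 mulZpMcancel ?peF_neq0 // Quotient.idealrBE.
by split=> /eqP.
Qed.

Lemma disc_form_class x x' : even_lattice L ->
  disc_form (disc_class x) = disc_form (disc_class x')
  <-> D x x - D x' x' \in dv (2%:R * pe ^+ M).
Proof.
move=> evL; rewrite !disc_form_pi //=.
have key (s t : Qp) : (\pi_(Quotient.quot (mulZp (1 : Qp))) s = \pi t)%qT <-> s - t \in mulZp 1.
  by rewrite Quotient.idealrBE; split=> /eqP.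
have two_formV (u : V) : 2%:R * formV u = polarV u u by rewrite mulrC divfK ?two_neq0.
rewrite {}key -(mulZpMcancel _ _ (two_neq0 p_pr)) mulrBr !two_formV.
rewrite -(mulZpMcancel _ _ (peF_neq0 M)) mulrBr !dual_vector_polar mulr1.
by rewrite -(rmorph_nat (@tofrac Zp)) -tofracM -tofracB mulZpP mulrC.
Qed.

Definition disc_invariant (f : discriminant L -> discriminant L) : Prop :=
  if pselect (even_lattice L) then forall q, disc_form (f q) = disc_form q
  else forall q q', disc_polar (f q) (f q') = disc_polar q q'.

Lemma endo_disc_invariant E : disc_invariant (endoB E) <->
  if pselect (even_lattice L) then sol_form G E else sol_polar G E.
Proof.
rewrite /disc_invariant; destruct (pselect (even_lattice L)) as [evL|nev]; rewrite /=.
  rewrite (sol_formP M_large); split=> [h x|h q].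
    by apply/(disc_form_class _ _ evL); rewrite -!endo_class h.
  have [x <-] := disc_class_surj q.
  by rewrite !endo_class; apply/(disc_form_class _ _ evL)/h.
rewrite (sol_polarP M_large); split=> [h x y|h q q'].
  by apply/disc_polar_class; rewrite -!endo_class h.
have [x <-] := disc_class_surj q; have [y <-] := disc_class_surj q'.
by rewrite !endo_class; apply/disc_polar_class/h.
Qed.

Lemma disc_invariant_injective E : disc_invariant (endoB E) -> injective (endoB E).
Proof.
move=> /endo_disc_invariant h; have {}h : sol_polar G E.
  destruct (pselect (even_lattice L)) => //; exact: sol_form_polar.
move=> q q'; have [x <-] := disc_class_surj q; have [y <-] := disc_class_surj q' => e.
have e0 : disc_class (endo_mx lam E *m (x - y)) = 0.
  by rewrite mulmxBr disc_classB -!endo_class e subrr.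
move/disc_class_ker/(sol_polar_kernel M_large h)/disc_class_ker: e0.
by rewrite disc_classB => /eqP; rewrite subr_eq0 => /eqP.
Qed.

Lemma card_disc_sol : finite_set (O_disc L) /\ (card_set (O_disc L))%:R
  = density M (fun E => if pselect (even_lattice L) then sol_form G E else sol_polar G E)
    * p%:R ^+ (\sum_a \sum_b minlam G a b) :> rat.
Proof.
have [||fA ->] := @card_endo _ _ _ M _ _ _ disc_classB disc_class_surj disc_class_ker lamM
  disc_invariant (O_disc L).
- by move=> f; split=> [[fb [fD fR]]|[fb fD fR]].
- exact: disc_invariant_injective.
by split=> //; congr (_ * _); apply: density_ext => E; apply: endo_disc_invariant.
Qed.

(** For i > 0 the form p^i q_i is integral, because p q_i already is; only block 0 can spoil
    evenness. *)
Lemma jordan_even : even_lattice L <-> even_lattice (L_ 0%N).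
Proof.
rewrite !evenP; split=> h x.
  case: L_jordan => _ _ _ hf _; have := h (iota 0%N x).
  by rewrite hf expr0 mul1r.
have hi i (v : L_ i) : Defs.form (iota i v) \in mulZp 1.
  case: L_jordan => _ _ _ -> _; case: i v => [|i] v; first by rewrite expr0 mul1r h.
  have /mulZp1P[a aE] : p%:R * Defs.form v \in mulZp 1 by apply: mulp_form.
  by rewrite exprSr -mulrA aE -(rmorph_nat (@tofrac Zp)) -rmorphXn -tofracM mulZp1.
have [u ->] := jordan_spans x.
elim/big_rec: _ => [|i z _ hz].
  by have := hi 0%N 0; rewrite linear0.
by rewrite Defs.formD rpredD // rpredD //; apply: L_int.
Qed.

End JordanDiscriminant.

(** * Counting the congruences *)

Section Counting.
Local Open Scope nat_scope.

Lemma sum_symmetric_nat n (f : 'I_n -> 'I_n -> nat) : (forall a b, f a b = f b a) ->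
  \sum_(a < n) \sum_(b < n) f a b = 2 * (\sum_(a < n) \sum_(b < n) (a < b) * f a b) + \sum_a f a a.
Proof.
move=> fs; have -> : \sum_(a < n) \sum_(b < n) f a b
    = \sum_(a < n) \sum_(b < n) (a < b) * f a b + \sum_(a < n) \sum_(b < n) (b < a) * f a b + \sum_a f a a.
  rewrite -!big_split; apply: eq_bigr => a _ /=.
  rewrite -(big_pred1_eq addn a (fun b => f a b)) [X in _ + X]big_mkcond -!big_split /=.
  apply: eq_bigr => b _; have [ab|ab] := eqVneq b a; first by rewrite ab ltnn.
  by rewrite addn0 -mulnDl; have : val b != val a by []; case: ltngtP; rewrite ?mul1n.
rewrite mul2n -addnn; congr (_ + _ + _); rewrite exchange_big.
by apply: eq_bigr => a _; apply: eq_bigr => b _; rewrite fs.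
Qed.

Lemma size_filter_sum (T : finType) (Q : pred T) :
  size [seq u <- enum [set: T] | Q u] = \sum_u Q u.
Proof.
rewrite size_filter -sum1_count big_mkcond big_enum /=.
by apply: eq_big => u; rewrite ?inE // => _; case: (Q u).
Qed.

Lemma sum_lt (x M : nat) : x <= M -> \sum_(1 <= k < M) (k < x) = x - 1.
Proof.
move=> xM; elim: M x xM => [|M IHM] x xM; first by rewrite big_geq //; lia.
case: (posnP M) xM => [-> xM|M0 xM]; first by rewrite big_geq //; lia.
rewrite big_nat_recr //=; have [xM'|Mx] := leqP x M; first by rewrite IHM // addn0.
have -> : x = M.+1 by lia.
rewrite (eq_big_nat _ _ (F2 := fun k => ((k < M) : nat))) => [|k /andP[_ kM]].
  by rewrite IHM //; lia.
by rewrite ltnW // kM.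
Qed.

Variables (p : nat) (p_pr : prime p) (n : nat) (G : jordan_gram p_pr n) (N : nat).
Local Notation lam := (lam G).
Hypothesis lamN : forall a, lam a < N.

Definition block_rank j := \sum_a ((lam a == j) : nat).
Local Notation rk := block_rank.

Lemma sum_lam (f : nat -> nat) : \sum_a f (lam a) = \sum_(j < N) rk j * f j.
Proof.
under [RHS]eq_bigr => j _ do rewrite big_distrl.
rewrite exchange_big; apply: eq_bigr => a _ /=.
rewrite (bigD1 (Ordinal (lamN a))) //= eqxx mul1n big1 ?addn0 // => j ja.
by rewrite [_ == _]negbTE // eq_sym; apply: contraNneq ja => ja; apply/eqP/val_inj.
Qed.

Lemma sum_lam2 (F : nat -> nat -> nat) :
  \sum_(a < n) \sum_(b < n) F (lam a) (lam b) = \sum_(i < N) \sum_(j < N) rk i * rk j * F i j.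
Proof.
under eq_bigr => a _ do rewrite (sum_lam (F (lam a))).
rewrite (sum_lam (fun i => \sum_(j < N) rk j * F i j)); apply: eq_bigr => i _.
by rewrite big_distrr; apply: eq_bigr => j _ /=; rewrite mulnA.
Qed.

Lemma block_rank_large j : N <= j -> rk j = 0.
Proof.
by move=> Nj; apply: big1 => a _; rewrite ltn_eqF // (leq_trans (lamN a)).
Qed.

Lemma block_rank0 : rk 0 = 0.
Proof. by apply: big1 => a _; rewrite gtn_eqF ?lam_gt0. Qed.

Definition pair_depth := \sum_(a < n) \sum_(b < n) (a < b) * (minlam G a b - 1).

Lemma sum_level_pairs (tau M : nat) : (forall a, lam a <= M) ->
  \sum_(1 <= k < M) size (level_pairs G tau k) = pair_depth + \sum_a (lam a - tau - 1).
Proof.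
move=> lamM; under eq_bigr => k _ do rewrite size_filter_sum -(pair_bigA _ (fun a b : 'I_n =>
  ((if a == b then k < lam a - tau else (a < b) && (k < minlam G a b)) : nat))).
rewrite exchange_big -big_split; apply: eq_bigr => a _ /=; rewrite exchange_big /=.
rewrite -(big_pred1_eq addn a (fun b => lam b - tau - 1)) [X in _ + X]big_mkcond -big_split.
apply: eq_bigr => b _ /=; rewrite eq_sym; have [->|ab] := eqVneq b a.
  by rewrite ltnn sum_lt // (leq_trans (leq_subr _ _)).
rewrite addn0; case: (a < b); last by rewrite big1.
by rewrite mul1n sum_lt // (leq_trans (geq_minl _ _)).
Qed.

Lemma size_offblock : size (offblock_pairs G) = \sum_(i < N) \sum_(j < N) (i < j) * (rk i * rk j).
Proof.
rewrite size_sort size_filter_sum -(pair_bigA _ (fun a b : 'I_n => (lam a < lam b) : nat)).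
rewrite (sum_lam2 (fun i j => (i < j) : nat)).
by apply: eq_bigr => i _; apply: eq_bigr => j _; rewrite mulnC.
Qed.

(** A pair inside block i has depth i - 1, which gives the first sum of w. A pair from blocks i < j
    has the same depth and one off-block congruence in addition, i altogether. *)
Lemma pair_depth_weight (r : nat -> nat) (w : nat) : (forall j, 0 < j -> r j = rk j) ->
  w = \sum_(1 <= i < N) (i - 1) * ((r i * (r i - 1)) %/ 2)
     + \sum_(0 <= j < N) \sum_(0 <= i < j) i * r i * r j ->
  pair_depth + size (offblock_pairs G) = w.
Proof.
move=> rE ->.
have -> : \sum_(1 <= i < N) (i - 1) * ((r i * (r i - 1)) %/ 2)
    = \sum_(i < N) (i - 1) * ((rk i * (rk i - 1)) %/ 2).
  have [->|N0] := posnP N; first by rewrite big_geq // big_ord0.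
  rewrite -(big_mkord xpredT (fun i => (i - 1) * ((rk i * (rk i - 1)) %/ 2))) [in RHS]big_ltn //.
  rewrite sub0n mul0n add0n; apply: eq_big_nat => i /andP[i0 _]; by rewrite rE.
have -> : \sum_(0 <= j < N) \sum_(0 <= i < j) i * r i * r j
    = \sum_(i < N) \sum_(j < N) (i < j) * (i * (rk i * rk j)).
  rewrite exchange_big big_mkord; apply: eq_bigr => j _ /=.
  rewrite -(big_mkord xpredT (fun i => (i < j) * (i * (rk i * rk j)))).
  rewrite [RHS](big_cat_nat (n := j)) //= ?(ltnW (ltn_ord j)) // [X in _ = _ + X]big_nat_cond.
  rewrite [X in _ = _ + X]big1 ?addn0 => [|i /andP[/andP[ji _] _]]; last by rewrite ltnNge ji.
  apply: eq_big_nat => i /andP[_ ij]; rewrite ij mul1n -mulnA.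
  by case: i ij => // i ij; rewrite !rE // (leq_trans _ ij).
have h1 := sum_symmetric_nat (f := fun a b => minlam G a b - 1).
have {}h1 := h1 (fun a b => congr1 (subn^~ 1) (minnC _ _)).
have h2 := sum_symmetric_nat (f := fun i j : 'I_N => rk i * rk j * (minn i j - 1)).
have {}h2 := h2 (fun i j => congr2 muln (mulnC _ _) (congr1 (subn^~ 1) (minnC _ _))).
rewrite -(sum_lam2 (fun i j => minn i j - 1)) in h2.
have e1 : \sum_a (minlam G a a - 1) = \sum_(j < N) rk j * (j - 1).
  by rewrite -(sum_lam (fun i => i - 1)); apply: eq_bigr => a _; rewrite /minlam minnn.
rewrite {}e1 -/pair_depth in h1.
have h3 : \sum_(i < N) rk i * rk i * (minn i i - 1)
    = 2 * \sum_(i < N) (i - 1) * ((rk i * (rk i - 1)) %/ 2) + \sum_(j < N) rk j * (j - 1).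
  rewrite big_distrr -big_split; apply: eq_bigr => i _ /=; rewrite minnn.
  have -> : rk i * rk i = 2 * (rk i * (rk i - 1) %/ 2) + rk i.
    rewrite [2 * _]mulnC divnK; last by case: (rk i) => // k; rewrite subn1 dvdn2 oddM /= andNb.
    by case: (rk i) => // k; rewrite subn1 /= mulnSr.
  by rewrite mulnDl mulnA [_ * (i - 1)]mulnC mulnCA mulnA.
have h4 : \sum_(i < N) \sum_(j < N) (i < j) * (rk i * rk j * (minn i j - 1))
    + \sum_(i < N) \sum_(j < N) (i < j) * (rk i * rk j)
    = \sum_(i < N) \sum_(j < N) (i < j) * (i * (rk i * rk j)).
  rewrite -big_split; apply: eq_bigr => i _; rewrite -big_split; apply: eq_bigr => j _ /=.
  have [ij|_] := ltnP i j; last by rewrite !mul0n.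
  rewrite !mul1n -mulnSr mulnC subn1.
  by case: (i : nat) => [|k]; [rewrite block_rank0 !muln0|].
have h12 := etrans (esym h2) h1; rewrite size_offblock.
move: pair_depth h12 => D {h1 h2}; rewrite {}h3 -{}h4.
move: (\sum_(i < N) \sum_(j < N) (i < j) * (rk i * rk j * _)) => s1.
move: (\sum_(i < N) \sum_(j < N) (i < j) * (rk i * rk j)) => s2.
move: (\sum_(i < N) (i - 1) * _) => s3.
lia.
Qed.

(** Each minimum is its depth plus 1, and the n^2 ones split into the r_j^2 and twice the off-block
    pairs. After subtracting all congruences and the r_j^2, exactly w is left. *)
Lemma sum_minlam_weight (w : nat) : pair_depth + size (offblock_pairs G) = w ->
  \sum_(a < n) \sum_(b < n) minlam G a b = w + size (offblock_pairs G)
    + (pair_depth + \sum_a (lam a - 1)) + \sum_(1 <= j < N) rk j ^ 2.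
Proof.
move=> <-; have h1 := sum_symmetric_nat (f := fun a b => minlam G a b) (fun a b => minnC _ _).
have e1 : \sum_a minlam G a a = \sum_a (lam a - 1) + \sum_(a < n) 1.
  rewrite -big_split; apply: eq_bigr => a _ /=; rewrite /minlam minnn.
  by have := lam_gt0 G a; lia.
have e2 : \sum_(a < n) \sum_(b < n) (a < b) * minlam G a b
    = pair_depth + \sum_(a < n) \sum_(b < n) (a < b) * 1.
  rewrite -big_split; apply: eq_bigr => a _; rewrite -big_split; apply: eq_bigr => b _ /=.
  have := lam_gt0 G a; have := lam_gt0 G b; rewrite -mulnDr /minlam.
  by move=> *; congr (_ * _); lia.
have h2 := sum_symmetric_nat (n := n) (f := fun a b => 1) (fun a b => erefl).
have h3 := sum_symmetric_nat (f := fun i j : 'I_N => rk i * rk j) (fun i j => mulnC _ _).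
rewrite -size_offblock in h3.
have e3 : \sum_(a < n) \sum_(b < n) 1 = \sum_(i < N) \sum_(j < N) rk i * rk j.
  rewrite (sum_lam2 (fun i j => 1)).
  by apply: eq_bigr => i _; apply: eq_bigr => j _; rewrite muln1.
have e4 : \sum_(1 <= j < N) rk j ^ 2 = \sum_(i < N) rk i * rk i.
  under [RHS]eq_bigr => i _ do rewrite mulnn.
  have [->|N0] := posnP N; first by rewrite big_geq // big_ord0.
  by rewrite -(big_mkord xpredT (fun i => rk i ^ 2)) [in RHS]big_ltn // block_rank0.
rewrite h1 e1 e2 e4; move: h2; rewrite e3 h3.
move: (\sum_(a < n) \sum_(b < n) (a < b) * 1) (\sum_(a < n) 1) => s1 s2.
move: (\sum_(i < N) rk i * rk i) (\sum_a (lam a - 1)) => s3 s4.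
move: pair_depth (size _) => s5 s6.
lia.
Qed.

End Counting.

(** * The exponent of 2 in terms of parities *)

Section ParityExponents.
Variables (t : nat -> bool) (r : nat -> nat).

Definition pos_parity j := (0 < j)%N && t j.

Definition parity_free k := ~~ t k && ~~ t k.+2.

Definition parity_sign (a b c : bool) : int :=
  match a, b, c with
  | true, false, true => 1
  | false, true, true => -1
  | true, true, true => 1
  | _, _, _ => 0
  end.

Definition free_shift k : int :=
  if parity_free k then (t 0%N)%:Z * (r k.+1)%:Z else ((t 0%N)%:Z - 1) * (r k.+1)%:Z.

(** Here k stands for block k + 1. This and the next four count how p = 2 departs from the
    independent case: congruences saved at starts of runs, at special indices and at the top
    diagonal level lost when t_0 = 1; congruences added by bound blocks modulo 4 and by odd blocks
    at distance 2 modulo 8. *)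
Definition run_at k := (t 0%N <= k)%N && ~~ parity_free k && (~~ pos_parity k && t k.+1 && t k.+2).
Definition special_at k := (t 0%N < k)%N && t k.+1.
Definition bound_rank k := (((t 0%N <= k)%N && ~~ parity_free k) * r k.+1)%N.
Definition chain_at k := (t 0%N < k)%N && t k.+1 && pos_parity k.-1.
Definition tail_rank k := ((t 0%N && (0 < k)%N) * r k.+1)%N.

(* The sums of [t (k-1) t (k+1)] coming from the signs and of [t (k-2) t k] coming from the
   chains are shifts of each other, so that only a boundary term remains. *)
Lemma parity_exponent m :
  \sum_(0 <= k < m.+1) ((tail_rank k + run_at k + special_at k)%N%:Z
    - (bound_rank k + chain_at k)%N%:Z)
  = - (t 1%N)%:Z + \sum_(0 <= k < m.+1) (free_shift k + (t k.+1)%:Z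
      - parity_sign (t k) (t k.+1) (t k.+2)) + (t m && t m.+2)%:Z.
Proof.
elim: m => [|m IHm].
  rewrite !big_nat1 /tail_rank /run_at /special_at /bound_rank /chain_at /free_shift.
  rewrite /parity_free /pos_parity /parity_sign /=.
  by case: (t 0%N); case: (t 1%N); case: (t 2%N) => /=; move: (r 1%N) => r1; lia.
rewrite big_nat_recr //= [in RHS]big_nat_recr //= {}IHm.
move: (\sum_(0 <= k < m.+1) _) => S.
rewrite /tail_rank /run_at /special_at /bound_rank /chain_at /free_shift.
rewrite /parity_free /pos_parity /parity_sign /=; move: (r m.+2) => rm.
(* The case m = 0 is apart: the thresholds involving [t 0] are still active and [pos_parity] drops
   block 0. *)
case: m => [|m] /=; last move: (t m.+1) => tm1.
  by case: (t 0%N); case: (t 1%N); case: (t 2%N); case: (t 3) => /=; lia.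
by case: (t 0%N); case: tm1; case: (t m.+2); case: (t m.+3); case: (t m.+4) => /=; lia.
Qed.

Lemma parity_exponent_total N : (forall j, (0 < j)%N -> (N <= j)%N -> ~~ t j) ->
  \sum_(1 <= j < N) ((tail_rank j.-1 + run_at j.-1 + special_at j.-1)%N%:Z
    - (bound_rank j.-1 + chain_at j.-1)%N%:Z)
  = - (t 1%N)%:Z + \sum_(1 <= j < N) (free_shift j.-1 + (t j)%:Z
      - parity_sign (t j.-1) (t j) (t j.+1)).
Proof.
move=> tN; have [N1|N1] := leqP N 1.
  by rewrite !big_geq // (negPf (tN 1%N _ _)).
case: N N1 tN => // -[//|m] _ tN; rewrite !big_add1 /= parity_exponent.
by rewrite (negPf (tN m.+2 _ _)) // andbF addr0.
Qed.

End ParityExponents.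

(** * Assembling the densities *)

Section OddDensity.
Variables (p : nat) (p_pr : prime p) (n M N : nat) (G : jordan_gram p_pr n).
Hypothesis M_large : forall a, (lam G a + 3 <= M)%N.
Hypothesis lamN : forall a, (lam G a < N)%N.
Hypothesis p_neq2 : p <> 2%N.
Hypothesis M_gt0 : (0 < M)%N.

Let pX_neq0 k : p%:R ^+ k != 0 :> rat.
Proof. by rewrite expf_neq0 // pnatr_eq0 -lt0n prime_gt0. Qed.

Lemma density_odd : density M (level G 0 M) = density M (base G (fun=> true))
  / p%:R ^+ (size (offblock_pairs G) + (pair_depth G + \sum_a (lam G a - 1)))%N.
Proof.
have lamM a : (lam G a <= M)%N by have := M_large a; lia.
have sE : (\sum_a (lam G a - 1) = \sum_a (lam G a - 0 - 1))%N.
  by apply: eq_bigr => a _; rewrite subn0.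
rewrite (@density_levels _ _ _ _ _ M_large 0%N _ _ 1%N) // sE -(sum_level_pairs 0 lamM).
have <- : density M (base_off G (fun=> true)) = density M (level G 0 1).
  by apply: density_ext => E; apply: base_off_level1.
by rewrite density_base_off // -mulrA -invfM -exprD.
Qed.

Lemma card_odd w (c : nat -> rat) : (pair_depth G + size (offblock_pairs G) = w)%N ->
  (forall j, (0 < j < N)%N ->
    c j = density M (base_block G (fun=> true) j) * p%:R ^+ (block_rank G j ^ 2)) ->
  density M (level G 0 M) * p%:R ^+ (\sum_a \sum_b minlam G a b)
  = p%:R ^+ w * \prod_(1 <= j < N) c j :> rat.
Proof.
move=> wE cE; rewrite density_odd (density_base _ _ lamN) (sum_minlam_weight lamN wE).
have -> : \prod_(1 <= j < N) c j = \prod_(1 <= j < N) density M (base_block G (fun=> true) j)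
    * p%:R ^+ (\sum_(1 <= j < N) block_rank G j ^ 2)%N.
  by rewrite expr_sum -big_split; apply: eq_big_nat.
move: (\prod_(1 <= j < N) _) => q; set e := (size _ + (_ + _))%N.
rewrite (_ : (_ + _)%N = e + (w + \sum_(1 <= j < N) block_rank G j ^ 2))%N; last first.
  by rewrite /e; lia.
by rewrite exprD mulrA divfK // exprD mulrCA.
Qed.

End OddDensity.

Section TwoDensity.
Variables (two_pr : prime 2) (n M N : nat) (G : jordan_gram two_pr n) (t : nat -> bool).
Hypothesis M_large : forall a, (lam G a + 3 <= M)%N.
Hypothesis N_large : (N <= M)%N.
Hypothesis M_gt1 : (1 < M)%N.
Hypothesis lamN : forall a, (lam G a < N)%N.
Hypothesis t_par : forall j, (0 < j)%N -> t j = par G j.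
Local Notation rk := (block_rank G).
Local Notation tau := (nat_of_bool (t 0%N)).
Local Notation fr := (free_block G tau).

Let tau_le1 : (tau <= 1)%N. Proof. by case: (t 0%N). Qed.

Lemma par0 : par G 0 = false.
Proof. by apply/existsP => -[a /andP[/eqP h _]]; have := lam_gt0 G a; rewrite h. Qed.

Lemma par_large j : (N <= j)%N -> par G j = false.
Proof.
move=> Nj; apply/existsP => -[a /andP[/eqP h _]].
by have := leq_trans (lamN a) Nj; rewrite h ltnn.
Qed.

Lemma pos_parityE j : pos_parity t j = par G j.
Proof. by rewrite /pos_parity; case: (posnP j) => [->|/t_par ->]; rewrite ?par0. Qed.

Lemma free_blockE j : (0 < j)%N -> fr j = parity_free t j.-1.
Proof.
case: j => // j _; rewrite /free_block /parity_free /= -(t_par (ltn0Sn j.+1)).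
case: j => [|j] /=; last by rewrite -t_par // andbT.
by rewrite par0 /= andbC; case: (t 0%N).
Qed.

Lemma card_special j : (\sum_a ((lam G a == j) && special G a) = par G j)%N.
Proof.
have [pj|npj] := boolP (par G j).
  have [a aj sa] := special_exists pj; rewrite (bigD1 a) //= aj eqxx sa big1 // => b ba.
  apply/eqP; rewrite eqb0; apply/negP => /andP[/eqP bj sb]; case/eqP: ba.
  exact: (special_uniq sb sa (etrans bj (esym aj))).
rewrite big1 // => a _; apply/eqP; rewrite eqb0; apply/negP => /andP[/eqP aj /special_par].
by rewrite aj (negPf npj).
Qed.

Lemma sum_special (f : nat -> bool) :
  (\sum_a (f (lam G a) && special G a) = \sum_(1 <= j < N) (f j && par G j))%N.
Proof.
have -> : (\sum_(1 <= j < N) (f j && par G j) = \sum_(j < N) (f j && par G j))%N.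
  have [->|N0] := posnP N; first by rewrite big_geq // big_ord0.
  by rewrite -(big_mkord xpredT (fun j => (f j && par G j) : nat)) [in RHS]big_ltn // par0 andbF.
transitivity (\sum_a \sum_(j < N) (f j * ((lam G a == j) && special G a)))%N.
  apply: eq_bigr => a _; rewrite (bigD1 (Ordinal (lamN a))) //= eqxx big1 ?addn0 => [|j ja].
    by case: (f _); rewrite ?mul1n.
  rewrite [_ == _]negbTE ?muln0 // eq_sym; apply: contraNneq ja => ja.
  exact/eqP/val_inj.
rewrite exchange_big; apply: eq_bigr => j _ /=; rewrite -big_distrr /= card_special.
by case: (f j); rewrite ?mul1n.
Qed.

Lemma sum_par_range (f : nat -> bool) :
  (\sum_(0 <= j < M) (f j && par G j) = \sum_(1 <= j < N) (f j && par G j))%N.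
Proof.
have [N0|N0] := posnP N.
  rewrite [RHS]big_geq ?N0 // big1_seq // => j _; by rewrite par_large ?N0 ?andbF.
rewrite (big_cat_nat (n := N)) //= [X in (_ + X)%N]big_nat_cond [X in (_ + X)%N]big1 => [|j].
  by rewrite addn0 big_ltn // par0 andbF.
by rewrite andbT => /andP[Nj _]; rewrite par_large ?andbF.
Qed.

Lemma sum_diag_list :
  (\sum_(1 <= j < M) size (diag_list G tau j) + \sum_(1 <= j < N) run_at t j.-1
   = \sum_(1 <= j < N) (((tau < j)%N && ~~ fr j) * rk j))%N.
Proof.
have sizeE j : (size (diag_list G tau j) + [&& (tau < j)%N, ~~ fr j & run_start G j]
    = ((tau < j)%N && ~~ fr j) * rk j)%N.
  have -> : (size (diag_list G tau j) = \sum_a ((lam G a == j) &&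
      [&& (tau < j)%N, ~~ fr j & ~~ (run_start G j && special G a)]))%N.
    rewrite size_filter -sum1_count big_mkcond big_enum /=.
    by apply: eq_bigr => a _; case: ifP.
  case tj: (tau < j)%N => /=; last by rewrite mul0n big1 // => a _; rewrite andbF.
  case: (fr j) => /=; first by rewrite mul0n big1 // => a _; rewrite andbF.
  rewrite mul1n; have [rj|_] /= := boolP (run_start G j); last first.
    by rewrite addn0; apply: eq_bigr => a _; rewrite andbT.
  have /and3P[_ pj _] := rj.
  have sp := card_special j; rewrite pj in sp.
  rewrite -[X in (_ + X)%N]sp -big_split.
  by apply: eq_bigr => a _ /=; case: (lam G a == j); case: (special G a).
have rE j : (0 < j)%N -> [&& (tau < j)%N, ~~ fr j & run_start G j] = run_at t j.-1.
  move=> j0; rewrite /run_at pos_parityE free_blockE //; case: j j0 => // j _ /=.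
  by rewrite /run_start /= (t_par (ltn0Sn j)) (t_par (ltn0Sn j.+1)) ltnS !andbA.
have dl0 j : (N <= j)%N -> size (diag_list G tau j) = 0%N.
  by move=> Nj; have := sizeE j; rewrite (block_rank_large lamN) // muln0; lia.
have [N0|N0] := posnP N.
  rewrite ![in X in (_ + X)%N]big_geq ?N0 // [RHS]big_geq ?N0 // addn0 big1_seq // => j _.
  by rewrite dl0 ?N0.
rewrite (big_cat_nat (n := N)) //= [X in (_ + X + _)%N]big_nat_cond.
rewrite [X in (_ + X + _)%N]big1 => [|j]; last by rewrite andbT => /andP[Nj _]; rewrite dl0.
rewrite addn0 -big_split; apply: eq_big_nat => j /andP[j0 _] /=.
by rewrite -sizeE -rE.
Qed.

(** The special indices are what the two-stage treatment of level 2 saves over the generic count of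
    pairs. *)
Lemma second_sizes :
  (size (second_pairs G) + size (second_diag G tau) + \sum_(1 <= j < N) special_at t j.-1
   = size (level_pairs G tau 1))%N.
Proof.
have -> : (\sum_(1 <= j < N) special_at t j.-1 = \sum_a ((tau.+1 < lam G a) && special G a))%N.
  rewrite (sum_special (fun j => (tau.+1 < j)%N)); apply: eq_big_nat => -[//|j] _.
  by rewrite /special_at (t_par (ltn0Sn _)).
have -> : (size (second_diag G tau) = \sum_a ((tau.+1 < lam G a) && ~~ special G a))%N.
  by rewrite size_filter -sum1_count big_mkcond big_enum; apply: eq_bigr => a _; case: ifP.
rewrite -addnA -big_split /= !size_filter_sum.
rewrite -(pair_bigA _ (fun a b : 'I_n => ((a < b)%N && (1 < minlam G a b)%N) : nat)).
rewrite -(pair_bigA _ (fun a b : 'I_n => (if a == b then (1 < lam G a - tau)%N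
  else (a < b)%N && (1 < minlam G a b)%N) : nat)) /=.
rewrite -big_split; apply: eq_bigr => a _ /=.
have -> : (((tau.+1 < lam G a) && ~~ special G a) + ((tau.+1 < lam G a) && special G a)
    = (1 < lam G a - tau))%N.
  by rewrite ltn_subRL addn1; case: (tau.+1 < _)%N; case: (special G a).
rewrite -(big_pred1_eq addn a (fun b => (1 < lam G b - tau)%N : nat)).
rewrite [X in (_ + X)%N]big_mkcond -big_split.
apply: eq_bigr => b _ /=; rewrite [a == b]eq_sym.
by have [->|ab] := eqVneq b a; rewrite ?ltnn // addn0.
Qed.

Definition two_exponent := (size (offblock_pairs G) + \sum_(1 <= j < M) size (diag_list G tau j)
  + \sum_(0 <= j < M) [&& (tau.+1 < j)%N, par G j & par G j.-2]
  + size (second_pairs G) + size (second_diag G tau)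
  + \sum_(2 <= k < M) size (level_pairs G tau k))%N.

Lemma density_two :
  density M (level G tau M) = density M (base G fr) / 2%:R ^+ two_exponent.
Proof.
rewrite (@density_levels _ _ _ _ _ M_large tau tau_le1 _ 2%N) //.
rewrite density_second // density_clevel_off // density_clevel0 // density_level1 //.
by rewrite density_base_off // -!mulrA -!invfM -!exprD !addnA.
Qed.

Lemma two_exponentE w : (pair_depth G + size (offblock_pairs G) = w)%N ->
  (\sum_a \sum_b minlam G a b + \sum_(1 <= j < N) (bound_rank t rk j.-1 + chain_at t j.-1)
   = two_exponent + w + \sum_(1 <= j < N) rk j ^ 2
     + \sum_(1 <= j < N) (tail_rank t rk j.-1 + run_at t j.-1 + special_at t j.-1))%N.
Proof.
move=> wE; rewrite (sum_minlam_weight lamN wE) !big_split /=.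
have lamM a : (lam G a <= M)%N by have := M_large a; lia.
have h1 := sum_level_pairs tau lamM; rewrite big_ltn // -second_sizes in h1.
have h2 := sum_diag_list.
have e1 : (\sum_(1 <= j < N) bound_rank t rk j.-1
    = \sum_(1 <= j < N) (((tau < j)%N && ~~ fr j) * rk j))%N.
  apply: eq_big_nat => -[//|j] _; by rewrite /bound_rank free_blockE.
have e2 : (\sum_(1 <= j < N) chain_at t j.-1
    = \sum_(0 <= j < M) [&& (tau.+1 < j)%N, par G j & par G j.-2])%N.
  transitivity (\sum_(0 <= j < M) (((tau.+1 < j)%N && par G j.-2) && par G j))%N; last first.
    by apply: eq_bigr => j _; rewrite -andbA [par G j && _]andbC.
  rewrite (sum_par_range (fun j => (tau.+1 < j)%N && par G j.-2)).
  apply: eq_big_nat => -[//|j] _.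
  by rewrite /chain_at pos_parityE (t_par (ltn0Sn _)) andbAC.
have e3 : (\sum_(1 <= j < N) tail_rank t rk j.-1 + \sum_a (lam G a - tau - 1)
    = \sum_a (lam G a - 1))%N.
  have -> : (\sum_(1 <= j < N) tail_rank t rk j.-1 = \sum_a (t 0%N && (1 < lam G a)))%N.
    rewrite (sum_lam lamN (fun j => (t 0%N && (1 < j)%N) : nat)).
    have [->|N0] := posnP N; first by rewrite big_geq // big_ord0.
    rewrite -(big_mkord xpredT (fun j => (rk j * (t 0%N && (1 < j)%N))%N)) [in RHS]big_ltn //.
    rewrite andbF muln0 add0n; apply: eq_big_nat => -[//|j] _.
    by rewrite /tail_rank mulnC.
  rewrite -big_split; apply: eq_bigr => a _ /=; have := lam_gt0 G a.
  by case: (t 0%N) => /=; case: ltnP => /=; lia.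
rewrite /two_exponent e1 e2; move: h1 h2 e3 wE.
move: (\sum_(1 <= j < N) run_at _ _)%N (\sum_(1 <= j < N) special_at _ _)%N => x1 x2.
move: (\sum_(1 <= j < N) tail_rank _ _ _)%N (\sum_(1 <= j < N) (_ * _))%N => x3 x4.
move: (\sum_(1 <= j < M) size _)%N (\sum_(2 <= j < M) size _)%N => x5 x6.
move: (\sum_(0 <= j < M) _)%N (\sum_(1 <= j < N) _ ^ _)%N => x7 x8.
move: (\sum_a (lam G a - tau - 1))%N (\sum_a (lam G a - 1))%N => x9 x10.
move: (size (offblock_pairs G)) (size (second_pairs G)) (size (second_diag G _)) => x11 x12 x13.
move: (pair_depth G) => x14; lia.
Qed.

End TwoDensity.

Lemma prod_exprz (x : rat) (m n : nat) (f : nat -> int) : x != 0 ->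
  \prod_(m <= i < n) x ^ f i = x ^ (\sum_(m <= i < n) f i).
Proof.
move=> x0; rewrite (big_morph (fun k : int => x ^ k) (id1 := 1) (op1 := *%R)) //.
by move=> k l; rewrite expfzDr.
Qed.

Lemma card_two (two_pr : prime 2) (n M N : nat) (G : jordan_gram two_pr n)
    (t : nat -> bool) (w : nat) (c : nat -> rat) :
    (forall a, lam G a + 3 <= M)%N -> (N <= M)%N -> (1 < M)%N -> (forall a, lam G a < N)%N ->
    (forall j, (0 < j)%N -> t j = par G j) ->
    (pair_depth G + size (offblock_pairs G) = w)%N ->
    (forall j, (0 < j < N)%N ->
      c j = density M (base_block G (free_block G (t 0%N)) j) * 2%:R ^+ (block_rank G j ^ 2)) ->
  density M (level G (t 0%N) M) * 2%:R ^+ (\sum_a \sum_b minlam G a b)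
  = 2%:R ^ (w%:Z - (t 1%N)%:Z) * \prod_(1 <= j < N) (c j *
      2%:R ^ (free_shift t (block_rank G) j.-1 + ((t j)%:Z - parity_sign (t j.-1) (t j) (t j.+1)))).
Proof.
move=> M_large NM M1 lamN t_par wE cE.
have two0 : 2%:R != 0 :> rat by [].
rewrite big_split prod_exprz //=.
have tN j : (0 < j)%N -> (N <= j)%N -> ~~ t j.
  by move=> j0 Nj; rewrite t_par // (par_large lamN).
have h := parity_exponent_total (block_rank G) tN.
have -> : \sum_(1 <= j < N) (free_shift t (block_rank G) j.-1
    + ((t j)%:Z - parity_sign (t j.-1) (t j) (t j.+1))) = (t 1%N)%:Z + \sum_(1 <= j < N)
  ((tail_rank t (block_rank G) j.-1 + run_at t j.-1 + special_at t j.-1)%N%:Z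
    - (bound_rank t (block_rank G) j.-1 + chain_at t j.-1)%N%:Z).
  by rewrite h addrA subrr add0r; apply: eq_bigr => j _; rewrite addrA.
rewrite [RHS]mulrCA -expfzDr // addrA subrK.
rewrite sumrB -!(big_morph Posz PoszD erefl).
have := two_exponentE M_large NM M1 lamN t_par wE.
have -> : \prod_(1 <= j < N) c j
    = \prod_(1 <= j < N) density M (base_block G (free_block G (t 0%N)) j)
      * 2%:R ^+ (\sum_(1 <= j < N) block_rank G j ^ 2)%N.
  by rewrite expr_sum -big_split; apply: eq_big_nat.
rewrite density_two // (density_base _ _ lamN).
move: (\prod_(1 <= j < N) _) => q.
move: (\sum_(1 <= j < N) block_rank G j ^ 2)%N => R2.
move: (\sum_(a < n) \sum_(b < n) minlam G a b)%N (two_exponent M G t) => S T.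
move: (\sum_(1 <= j < N) (bound_rank _ _ _ + _))%N => X.
move: (\sum_(1 <= j < N) (tail_rank _ _ _ + _ + _))%N => Y e.
have X0 : 2%:R ^+ X != 0 :> rat by rewrite expf_neq0.
have T0 : 2%:R ^+ T != 0 :> rat by rewrite expf_neq0.
rewrite addrA expfzDr // -PoszD -exprnN -exprnP.
apply: (mulIf X0); rewrite -[LHS]mulrA -exprD e !mulrA divfK //.
rewrite (_ : T + w + R2 + Y = T + (R2 + (w + Y)))%N; last by lia.
by rewrite exprD mulrA divfK // -mulrA -exprD.
Qed.

Lemma rank0_even (p : nat) (p_pr : prime p) (L : lattice p_pr) :
  lattice_rank L = 0%N -> even_lattice L.
Proof.
move=> L0 x; have -> : x = 0.
  rewrite [x]lattice_basisE big1 // => i _; have := ltn_ord i.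
  by rewrite [X in (_ < X)%N]L0.
by rewrite polar0 rpred0.
Qed.

Lemma jordan_parityE (p : nat) (p_pr : prime p) (L_ : nat -> lattice p_pr) i :
  jordan_parity L_ i = `[< ~ even_lattice (L_ i) >].
Proof.
rewrite /jordan_parity; destruct (pselect (even_lattice (L_ i))) as [h|h] => /=.
  by rewrite asboolF.
by rewrite asboolT.
Qed.

Theorem theorem5p6 (p : nat) (p_pr : prime p)
  (L : lattice p_pr) (L_ : nat -> lattice p_pr)
  (iota : forall i : nat, {linear L_ i -> L}) (N : nat) :
  integral L -> jordan_decomposition iota N ->
  let r (i : nat) : nat := lattice_rank (L_ i) in
  let t := jordan_parity L_ in
  let s := jordan_s L_ in
  let w : nat :=
    (\sum_(1 <= i < N) (i - 1) * ((r i * (r i - 1)) %/ 2)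
     + \sum_(0 <= j < N) \sum_(0 <= i < j) i * r i * r j)%N in
  let A (i : nat) : rat :=
    if jordan_free L_ i then
      (card_set (O_red_form (L_ i)))%:R * 2%:R ^ ((t 0%N)%:Z * (r i)%:Z)
    else
      (card_set (O_red_polar (L_ i)))%:R
        * 2%:R ^ (((t 0%N)%:Z - 1) * (r i)%:Z) in
  finite_set (O_disc L) /\
  (p <> 2%N ->
     card_set (O_disc L)
     = (p ^ w * \prod_(1 <= i < N) card_set (O_red_form (L_ i)))%N) /\
  (p = 2%N ->
     (card_set (O_disc L))%:R
     = 2%:R ^ (w%:Z - (t 1%N)%:Z)
       * \prod_(1 <= i < N) (A i * 2%:R ^ ((t i)%:Z - s i)) :> rat).
Proof.
move=> L_int jd r t s w A.
have uni i : unimodular (L_ i) by case: jd.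
have part_int i : integral (L_ i) by case: (uni i).
pose g i := projT1 (cid (unimodular_gram (uni i))).
have gP i : [/\ (g i)^T = g i, g i \in unitmx & map_mx (@tofrac _) (g i) = gram (L_ i)].
  by rewrite /g; case: (cid _).
have g_sym i : (g i)^T = g i by case: (gP i).
have g_unit i : g i \in unitmx by case: (gP i).
have gE i : map_mx (@tofrac _) (g i) = gram (L_ i) by case: (gP i).
(* All exponents are below N, so this leaves the three spare digits. *)
pose G := tagged_gram N g_sym g_unit; pose M := (N + 3)%N.
have lamN a : (lam G a < N)%N.
  by rewrite /= /jlam; have := ltn_ord (tag (enum_val a)); lia.
have M_large a : (lam G a + 3 <= M)%N by have := lamN a; rewrite /M; lia.
have rankE j : (0 < j)%N -> r j = block_rank G j.
  case: j => // i _; have [iN|Ni] := ltnP i.+1 N.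
    have iN' : (i < N.-1)%N by lia.
    exact: esym (card_jblock L_ (Ordinal iN')).
  by rewrite (block_rank_large lamN) //; case: jd => _ h _ _ _; apply: h.
have wE : (pair_depth G + size (offblock_pairs G) = w)%N.
  exact: (pair_depth_weight lamN rankE).
have [fin cardE] := card_disc_sol L_int jd gE M_large.
have M0 : (0 < M)%N by rewrite /M; lia.
have formE j : (0 < j < N)%N -> (card_set (O_red_form (L_ j)))%:R
    = density M (base_block G (fun=> true) j) * p%:R ^+ (block_rank G j ^ 2) :> rat.
  case: j => // i /andP[_ iN]; have iN' : (i < N.-1)%N by lia.
  rewrite -rankE //; exact: (card_red_form g_sym g_unit gE part_int (Ordinal iN') M0).
have polarE j : (0 < j < N)%N -> (card_set (O_red_polar (L_ j)))%:R
    = density M (base_block G (fun=> false) j) * p%:R ^+ (block_rank G j ^ 2) :> rat.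
  case: j => // i /andP[_ iN]; have iN' : (i < N.-1)%N by lia.
  rewrite -rankE //; exact: (card_red_polar g_sym g_unit gE part_int (Ordinal iN') M0).
split=> //; split=> [p2|p2].
  apply/eqP; rewrite -(eqr_nat rat) cardE natrM natrX natr_prod; apply/eqP.
  rewrite -(card_odd M_large lamN p2 M0 wE formE); congr (_ * _); apply: density_ext => E.
  rewrite -(sol_form_level M_large).
  destruct (pselect (even_lattice L)) as [ev|nev]; rewrite /=; first exact: iff_refl.
  (* For odd p every integral lattice is even, so the bilinear case does not arise. *)
  exfalso; apply: (nev); by apply/evenP => x; apply: odd_prime_form.
pose tb i := `[< ~ even_lattice (L_ i) >].
have tE i : t i = tb i by apply: jordan_parityE.
subst p.
have t_par j : (0 < j)%N -> tb j = par G j.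
  case: j => // i _; have [iN|Ni] := ltnP i.+1 N; last first.
    rewrite (par_large lamN) //; apply: asboolF => nev; apply: nev.
    by apply: rank0_even; case: jd => _ h _ _ _; apply: h.
  have iN' : (i < N.-1)%N by lia.
  have h := par_even_lattice g_sym g_unit gE (Ordinal iN').
  apply/asboolP/existsP => [/h[a [/= aj Ba]]|[a /andP[/eqP aj Ba]]].
    by exists a; rewrite Ba andbT; apply/eqP.
  by apply/h; exists a.
have cE j : (0 < j < N)%N ->
    (if parity_free tb j.-1 then card_set (O_red_form (L_ j)) else card_set (O_red_polar (L_ j)))%:R
    = density M (base_block G (free_block G (tb 0%N)) j) * 2%:R ^+ (block_rank G j ^ 2) :> rat.
  move=> jN; have j0 : (0 < j)%N by case/andP: jN.
  (* [base_block] reads its predicate at j only, so it may be replaced by the constant value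
     there. *)
  have -> : density M (base_block G (free_block G (tb 0%N)) j)
    = density M (base_block G (fun=> free_block G (tb 0%N) j) j) by [].
  rewrite (free_blockE t_par) //; case: (parity_free _ _); [exact: formE|exact: polarE].
have NM : (N <= M)%N by rewrite /M; lia.
have M1 : (1 < M)%N by rewrite /M; lia.
have := card_two M_large NM M1 lamN t_par wE cE; rewrite cardE -(tE 1%N).
have -> : density M (fun E => if pselect (even_lattice L) then sol_form G E else sol_polar G E)
    = density M (level G (tb 0%N) M).
  apply: density_ext => E; rewrite /tb -(propext (jordan_even L_int jd)).
  destruct (pselect (even_lattice L)) as [ev|nev]; rewrite /=.
    by rewrite asboolF //; apply: sol_form_level.
  by rewrite asboolT //; apply: sol_polar_level.
move=> ->; congr (_ * _); apply: eq_big_nat => -[//|k] /andP[_ kN].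
have sE : s k.+1 = parity_sign (tb k) (tb k.+1) (tb k.+2).
  rewrite /s /jordan_s /= -/t !tE.
  by case: (tb k); case: (tb k.+1); case: (tb k.+2).
have fE : jordan_free L_ k.+1 = parity_free tb k.
  by rewrite /jordan_free /parity_free /= -/t !tE !eqb0.
rewrite expfzDr // mulrA -sE -tE; congr (_ * _).
by rewrite /A fE /free_shift tE -rankE //=; case: (parity_free tb k).
Qed.
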